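(* Let $\tau$ be an irreducible depth-zero supercuspidal representation of $G_r=\operatorname{GL}_r(F)$ with type $(K_r,\tau_0)$, let $n\ge1$, $M=(G_r)^n\subset G_{nr}$, let $(J,\rho)$ be the type for $[M,\tau^{\otimes n}]$ described in the context, and let $\rho_M=\tau_0^{\otimes n}$. Let $H_1=\operatorname{End}_{G_{nr}^F}\bigl(\operatorname{Ind}_{P^F}^{G_{nr}^F}(\rho_M)\bigr)^{\mathrm{op}}$ with canonical basis $\{T_w\mid w\in S_n\}$, and let $H_0\subset\mathcal H(G_{nr},\rho)$ be the finite Hecke subalgebra with canonical basis $\{[w]\mid w\in S_n\}$. Then $H_1$ is canonically isomorphic to $H_0$ (via $T_w\mapsto[w]$), and this isomorphism preserves the actions of the two algebras: for every irreducible representation $V$ of $G_{nr}$ in the Bernstein block $[M,\tau^{\otimes n}]$, $T_w$ and $[w]$ act by the same operator on $$V_\rho=\operatorname{Hom}_J(\rho,V)=\operatorname{Hom}_{P^F}(\rho_M,V^{K_{nr+}}).$$ In particular, the structure of $V^{K_{nr+}}$ as a $K_{nr}/K_{nr+}$-representation is determined by the $H_0$-module structure of $V_\rho$.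
   Context: $F$ is a non-Archimedean local field with residue field $\mathbb F_q$; $G_m=\operatorname{GL}_m(F)$, $K_m=\operatorname{GL}_m(\mathcal O_F)$, $K_{m+}$ its pro-unipotent radical, $G_m^F=\operatorname{GL}_m(\mathbb F_q)=K_m/K_{m+}$. Here $\tau_0$ is an irreducible cuspidal representation of $\operatorname{GL}_r(\mathbb F_q)$, inflated to $K_r$, such that $\tau=\operatorname{c-Ind}_{F^\times K_r}^{G_r}\tau_1$ for an extension $\tau_1$ of $\tau_0$. The Bernstein block $[M,\tau^{\otimes n}]$ consists of representations all of whose irreducible subquotients are subquotients of $\operatorname{Ind}_P^{G_{nr}}(\tau^{\otimes n}\otimes\chi)$ for unramified characters $\chi$ of $M$. The type $(J,\rho)$. Let $P=MU$ be the block upper triangular parabolic with Levi $M$, $U^-$ the opposite unipotent radical. Put $J=(U^-\cap K_{nr+})(K_{nr}\cap M)(U\cap K_{nr})$ and $J_+=(U^-\cap K_{nr+})(K_{nr+}\cap M)(U\cap K_{nr})$. Then $J/J_+\cong\operatorname{GL}_r(\mathbb F_q)^n$ and $\rho$ is the inflation of $\tau_0^{\otimes n}$ to $J$. $P^F=M^FU^F$ is the block upper triangular parabolic of $G_{nr}^F$ with Levi $M^F=\operatorname{GL}_r(\mathbb F_q)^n$; $\rho_M=\tau_0^{\otimes n}$ is extended to $P^F$ trivially on $U^F$. Action of $H_1$. $H_1$ acts on $\operatorname{Hom}_{G_{nr}^F}(\operatorname{Ind}_{P^F}^{G_{nr}^F}\rho_M,V^{K_{nr+}})\cong\operatorname{Hom}_{P^F}(\rho_M,V^{K_{nr+}})$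 by $h\cdot f=f\circ h$. Realize $\operatorname{Ind}_{P^F}^{G_{nr}^F}\rho_M=\mathbb C[G_{nr}^F]e_{U^F}\otimes_{\mathbb C[M^F]}\rho_M$, $e_{U^F}=|U^F|^{-1}\sum_{u\in U^F}u$. View $w\in S_n$ as a block permutation matrix with blocks $0$ or $I_r$, and let $\gamma_w$ be the permutation of tensor factors of $\rho_M$ with $\gamma_w(\rho_M(m)v)=\rho_M(w^{-1}mw)\gamma_w(v)$. For a simple reflection $s$, $T_s$ is the unique scalar multiple of $ge_{U^F}\otimes v\mapsto ge_{U^F}se_{U^F}\otimes\gamma_s(v)$ satisfying $T_s^2=(q^r-1)T_s+q^r$; $T_w=T_{s_1}\cdots T_{s_k}$ (product in $H_1$) for a reduced expression $w=s_1\cdots s_k$. This identifies $H_1$ with the Iwahori--Hecke algebra $\mathcal H(S_n,q^r)$. Action of $H_0$. $\mathcal H(G_{nr},\rho)$ is the convolution algebra of compactly supported functions $f:G_{nr}\to\operatorname{End}(\rho^\vee)$ with $f(kgk')=\rho^\vee(k)f(g)\rho^\vee(k')$ for $k,k'\in J$ (with respect to a fixed Haar measure). It acts on $V_\rho$ by $(f*\phi)(w)=\int_{G_{nr}}\pi(g)\phi(\check{f(g)}w)\,dg$, where $\check{a}$ denotes the transpose of $a$. By Bushnell--Kutzko, $\mathcal H(G_{nr},\rho)$ is isomorphic to the affine Hecke algebra $\mathcal H_{\mathrm{aff}}(S_n,q^r)$, and $H_0\cong\mathcal H(S_n,q^r)$ is its canonical finite subalgebra with basis $[w]$, $w\in S_n$;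 for a simple reflection $s$, $[s]$ is supported on $JsJ$ and $[s]^2=(q^r-1)[s]+q^r$, and $[w]=[s_1]\cdots[s_k]$ for a reduced expression $w=s_1\cdots s_k$. *)

(* Defs.v *)
From HB Require Import structures.
From mathcomp Require Import all_boot all_order all_fingroup all_algebra.
From mathcomp Require Import boolp classical_sets functions reals.
From mathcomp Require Import complex.

Set Implicit Arguments.
Unset Strict Implicit.
Unset Printing Implicit Defensive.

Import Order.TTheory GRing.Theory Num.Theory.
Local Open Scope classical_set_scope.
Local Open Scope ring_scope.

(* A field complete for a normalised discrete valuation with finite residue
   field.  [lf_val] is only meaningful away from 0 and [lf_red], the reduction
   map from the ring of integers onto the residue field, only on integers. *)
Record localField := LocalField {
  lf_sort :> fieldType;
  lf_res : finFieldType;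
  lf_val : lf_sort -> int;
  lf_red : lf_sort -> lf_res;
  lf_valM : forall x y, x != 0 -> y != 0 ->
    lf_val (x * y) = lf_val x + lf_val y;
  lf_valD : forall x y, x != 0 -> y != 0 -> x + y != 0 ->
    Num.min (lf_val x) (lf_val y) <= lf_val (x + y);
  lf_val_unif : exists x, x != 0 /\ lf_val x = 1;
  (* [(x == 0) || (j <= lf_val x)] says that x lies in the j-th power of the
     maximal ideal *)
  lf_complete : forall u : nat -> lf_sort,
    (forall j : int, exists N : nat, forall a b : nat, (N <= a)%N -> (N <= b)%N ->
       (u a - u b == 0) || (j <= lf_val (u a - u b))) ->
    exists l, forall j : int, exists N : nat, forall a : nat, (N <= a)%N ->
       (u a - l == 0) || (j <= lf_val (u a - l));
  lf_redD : forall x y, (x == 0) || (0 <= lf_val x) ->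
    (y == 0) || (0 <= lf_val y) -> lf_red (x + y) = lf_red x + lf_red y;
  lf_redM : forall x y, (x == 0) || (0 <= lf_val x) ->
    (y == 0) || (0 <= lf_val y) -> lf_red (x * y) = lf_red x * lf_red y;
  lf_red1 : lf_red 1 = 1;
  lf_red_ker : forall x, (x == 0) || (0 <= lf_val x) ->
    (lf_red x == 0) = (x == 0) || (1 <= lf_val x);
  lf_red_surj : forall y, exists2 x, (x == 0) || (0 <= lf_val x) & lf_red x = y
}.

Definition in_pow (F : localField) (j : int) (x : F) : bool :=
  (x == 0) || (j <= lf_val x).

Definition mxred (F : localField) m (g : 'M[F]_m) : 'M[lf_res F]_m :=
  map_mx (@lf_red F) g.

Definition GL (K : fieldType) m : set 'M[K]_m := [set g | g \in unitmx].

(* GL_m(O_F), its pro-unipotent radical, and the congruence subgroup of level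
   j.+1; the latter, for all j, form a basis of neighbourhoods of 1. *)
Definition Kmax (F : localField) m : set 'M[F]_m :=
  [set g | [/\ g \in unitmx, forall i j, in_pow 0 (g i j)
           & forall i j, in_pow 0 (invmx g i j)]].
Definition Kplus (F : localField) m : set 'M[F]_m :=
  [set g | Kmax g /\ mxred g = 1%:M].
Definition Kcong (F : localField) m (j : nat) : set 'M[F]_m :=
  [set g | Kmax g /\ forall a b, in_pow j.+1 ((g - 1%:M) a b)].

Definition FKmax (F : localField) m : set 'M[F]_m :=
  [set g | exists (z : F) (k : 'M[F]_m), [/\ z != 0, Kmax k & g = z *: k]].

(* Unipotent radical of the standard parabolic subgroup whose blocks are cut
   after the positions in D; the parabolic is proper when [proper_cut m D]. *)
Definition unip_rad (K : fieldType) m (D : pred nat) : set 'M[K]_m :=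
  [set u | forall i j : 'I_m,
     ~ (exists2 a, D a & (i < a <= j)%N) -> u i j = (i == j)%:R].
Definition proper_cut m (D : pred nat) : Prop := exists2 a, D a & (0 < a < m)%N.

(* Subgroups of GL_{nr}: square matrices of size \sum_(i < n) r = n * r are cut
   into n x n blocks of size r by MathComp's [submxblock]. *)
Section Blocks.
Variables (K : fieldType) (n r : nat).
Local Notation mat := 'M[K]_(\sum_(i < n) r).

Definition blk (g : mat) (i j : 'I_n) : 'M[K]_r := submxblock g i j.

Definition Levi : set mat :=
  [set g | g \in unitmx /\ forall i j, i != j -> blk g i j = 0].
Definition Urad : set mat :=
  [set g | (forall i, blk g i i = 1%:M)
           /\ forall i j : 'I_n, (j < i)%N -> blk g i j = 0].
Definition Uopp : set mat :=
  [set g | (forall i, blk g i i = 1%:M)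
           /\ forall i j : 'I_n, (i < j)%N -> blk g i j = 0].
Definition Parab : set mat :=
  [set g | g \in unitmx /\ forall i j : 'I_n, (j < i)%N -> blk g i j = 0].

(* As for [perm_mx], the convention is the one that makes w |-> blkperm w
   multiplicative for MathComp's product of permutations. *)
Definition blkperm (w : 'S_n) : mat :=
  \mxblock_(i < n, j < n) ((w i == j)%:R%:M : 'M[K]_r).

Lemma blkpermM (v w : 'S_n) : blkperm (v * w)%g = blkperm v *m blkperm w.
Proof.
rewrite /blkperm mul_mxblock; apply/eq_mxblockP => i j.
rewrite (bigD1 (v i)) //= eqxx mul1mx big1 ?addr0 ?permM // => l lv.
by rewrite eq_sym (negPf lv) raddf0 mul0mx.
Qed.
End Blocks.

Definition Jgrp (F : localField) n r : set 'M[F]_(\sum_(i < n) r) :=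
  [set g | exists a m u, [/\ Uopp a /\ Kplus a, Levi m /\ Kmax m,
                            Urad u /\ Kmax u & g = a *m m *m u]].

Section Theory.
Variable R : realType.
Local Notation C := R[i].

Definition linear_on (L L' : lmodType C) (E : set L) (f : L -> L') : Prop :=
  forall a x y, E x -> E y -> f (a *: x + y) = a *: f x + f y.

Definition subspace (L : lmodType C) (E : set L) : Prop :=
  E 0 /\ forall a x y, E x -> E y -> E (a *: x + y).

Section Reps.
Variables (K : fieldType) (m : nat) (H : set 'M[K]_m).

Definition stable (L : lmodType C) (pi : 'M[K]_m -> L -> L) (S : set L) :=
  forall g x, H g -> S x -> S (pi g x).

(* [pi] makes the subspace E of L a representation of the subgroup H of
   GL_m(K); its values outside H are irrelevant. *)
Definition is_rep (L : lmodType C) (E : set L) (pi : 'M[K]_m -> L -> L) :=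
  [/\ subspace E /\ stable pi E,
      forall g, H g -> linear_on E (pi g),
      forall x, E x -> pi 1%:M x = x
    & forall g h x, H g -> H h -> E x -> pi (g *m h) x = pi g (pi h x)].

Definition irreducible (L : lmodType C) (E : set L) (pi : 'M[K]_m -> L -> L) :=
  [/\ is_rep E pi, exists2 x, E x & x <> 0
    & forall S, S `<=` E -> subspace S -> stable pi S ->
        S = [set 0] \/ S = E].

Definition intertwines (L L' : lmodType C) (E : set L)
    (pi : 'M[K]_m -> L -> L) (pi' : 'M[K]_m -> L' -> L') (f : L -> L') :=
  linear_on E f /\ forall g x, H g -> E x -> f (pi g x) = pi' g (f x).

Definition isomorphic (L L' : lmodType C)
    (E : set L) (pi : 'M[K]_m -> L -> L)
    (E' : set L') (pi' : 'M[K]_m -> L' -> L') :=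
  exists f, intertwines E pi pi' f /\ set_bij E E' f.

(* (E', pi') is a quotient of a subrepresentation S of (E, pi). *)
Definition subquotient (L L' : lmodType C)
    (E' : set L') (pi' : 'M[K]_m -> L' -> L')
    (E : set L) (pi : 'M[K]_m -> L -> L) :=
  exists S f, [/\ S `<=` E /\ subspace S, stable pi S,
                  intertwines S pi pi' f & f @` S = E'].
End Reps.

Definition fixed (K : fieldType) m (H : set 'M[K]_m) (L : lmodType C)
    (pi : 'M[K]_m -> L -> L) : set L :=
  [set x | forall g, H g -> pi g x = x].

Definition smooth (F : localField) m (L : lmodType C)
    (pi : 'M[F]_m -> L -> L) : Prop :=
  forall x, exists j, fixed (@Kcong F m j) pi x.

Definition smooth_irreducible (F : localField) m (L : lmodType C)
    (pi : 'M[F]_m -> L -> L) : Prop :=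
  irreducible (@GL F m) [set: L] pi /\ smooth pi.

Definition mxact (K : fieldType) m d (tau : 'M[K]_m -> 'M[C]_d) :
  'M[K]_m -> 'cV[C]_d -> 'cV[C]_d := fun g x => tau g *m x.

Definition irreducible_cuspidal (k : finFieldType) r d
    (tau0 : 'M[k]_r -> 'M[C]_d) : Prop :=
  irreducible (@GL k r) setT (mxact tau0) /\
  forall D, proper_cut r D ->
    fixed (@unip_rad k r D) (mxact tau0) = [set 0].

(* All proper Jacquet modules vanish. *)
Definition supercuspidal (F : localField) r (L : lmodType C)
    (tau : 'M[F]_r -> L -> L) : Prop :=
  smooth_irreducible tau /\
  forall D, proper_cut r D -> forall S, subspace S ->
    (forall u x, unip_rad D u -> S (tau u x - x)) -> S = setT.

(* The pro-unipotent radicals of the parahoric subgroups of GL_r(F) are, up to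
   conjugacy, the preimages in GL_r(O_F) of the sets [unip_rad D] over the
   residue field. *)
Definition depth_zero (F : localField) r (L : lmodType C)
    (tau : 'M[F]_r -> L -> L) : Prop :=
  exists D, exists2 x, x <> 0 &
    fixed [set g | Kmax g /\ unip_rad D (mxred g)] tau x.

Definition rtrans (K : fieldType) m (T : Type) (g : 'M[K]_m)
  (f : 'M[K]_m -> T) : 'M[K]_m -> T := fun x => f (x *m g).

(* Functions on GL_m(F) are represented by functions on matrices vanishing at
   the singular ones. *)
Definition on_GL (K : fieldType) m (L : lmodType C) (f : 'M[K]_m -> L) :=
  forall g, g \notin unitmx -> f g = 0.

Definition right_smooth (F : localField) m (L : lmodType C)
    (f : 'M[F]_m -> L) : Prop :=
  exists j, forall g k, GL g -> Kcong j k -> f (g *m k) = f g.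

(* The space of c-Ind_{F^* K_r}^{G_r} tau1; since K_r is compact and open,
   compact support modulo F^* K_r is support in finitely many cosets. *)
Definition cInd (F : localField) r d (tau1 : 'M[F]_r -> 'M[C]_d) :
    set ('M[F]_r -> 'cV[C]_d) :=
  [set f | [/\ on_GL f,
      forall h g, FKmax h -> GL g -> f (h *m g) = tau1 h *m f g,
      right_smooth f
    & exists s : seq 'M[F]_r, forall g, GL g -> f g <> 0 ->
        exists x h k, [/\ x \in s, FKmax h, Kmax k & g = h *m x *m k]]].

Definition depth_zero_sc_of_type (F : localField) r d
    (tau0 : 'M[lf_res F]_r -> 'M[C]_d) (L : lmodType C)
    (tau : 'M[F]_r -> L -> L) : Prop :=
  [/\ irreducible_cuspidal tau0, supercuspidal tau, depth_zero tau &
    exists tau1 : 'M[F]_r -> 'M[C]_d,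
    [/\ is_rep (@FKmax F r) setT (mxact tau1),
        forall g, Kmax g -> tau1 g = tau0 (mxred g)
      & isomorphic (@GL F r) setT tau (cInd tau1) (@rtrans F r _)]].

Definition multilinear n (L W : lmodType C) (f : ('I_n -> L) -> W) : Prop :=
  forall v (i : 'I_n) a x y,
    let upd z := fun j => if j == i then z else v j in
    f (upd (a *: x + y)) = a *: f (upd x) + f (upd y).

Definition is_tensor_power n (L T : lmodType C) (t : ('I_n -> L) -> T) : Prop :=
  multilinear t /\
  forall (W : lmodType C) (f : ('I_n -> L) -> W), multilinear f ->
    exists! g : T -> W, linear g /\ forall v, g (t v) = f v.

(* (T, sigma) is the representation tau^{\otimes n} of the Levi subgroup. *)
Definition is_tensor_rep (F : localField) n r (L : lmodType C)
    (tau : 'M[F]_r -> L -> L) (T : lmodType C)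
    (sigma : 'M[F]_(\sum_(i < n) r) -> T -> T) : Prop :=
  exists2 t : ('I_n -> L) -> T, is_tensor_power t &
    forall m, Levi m -> linear (sigma m) /\
      forall v, sigma m (t v) = t (fun i => tau (blk m i i) (v i)).

Section Padic.
Variables (F : localField) (n r : nat).
Local Notation nr := (\sum_(i < n) r)%N.
Local Notation G := (@GL F nr).

Definition unramified (chi : 'M[F]_nr -> C) : Prop :=
  [/\ forall m, Levi m -> chi m != 0,
      forall m m', Levi m -> Levi m' -> chi (m *m m') = chi m * chi m'
    & forall m, Levi m -> (forall i, lf_val (\det (blk m i i)) = 0) ->
        chi m = 1].

(* The space of Ind_P^G (sigma \otimes chi), unnormalised: the normalising
   factor delta_P^{1/2} is an unramified character of M, so it makes no
   difference to the Bernstein block below. *)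
Definition parInd (T : lmodType C) (sigma : 'M[F]_nr -> T -> T)
    (chi : 'M[F]_nr -> C) : set ('M[F]_nr -> T) :=
  [set f | [/\ on_GL f, right_smooth f &
     forall m u g, Levi m -> Urad u -> GL g ->
       f (m *m u *m g) = chi m *: sigma m (f g)]].

Definition bernstein_block (T : lmodType C) (sigma : 'M[F]_nr -> T -> T)
    (V : lmodType C) (pi : 'M[F]_nr -> V -> V) : Prop :=
  [/\ is_rep G setT pi, smooth pi &
   forall (W : lmodType C) (piW : 'M[F]_nr -> W -> W),
     smooth_irreducible piW -> subquotient G setT piW setT pi ->
     exists2 chi, unramified chi &
       subquotient G setT piW (parInd sigma chi) (@rtrans F nr T)].
End Padic.

Section Rho.
Variables (n d : nat).
Local Notation N := #|{: {ffun 'I_n -> 'I_d}}|.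

(* Coordinates on (C^d)^{\otimes n}: the basis is indexed by the functions
   'I_n -> 'I_d, through [enum_val]. *)
Definition tidx (a : 'I_N) : {ffun 'I_n -> 'I_d} := enum_val a.
Definition ptens (v : 'I_n -> 'cV[C]_d) : 'cV[C]_N :=
  \col_a \prod_i v i (tidx a i) 0.
Definition tensmx (A : 'I_n -> 'M[C]_d) : 'M[C]_N :=
  \matrix_(a, b) \prod_i A i (tidx a i) (tidx b i).
Definition gammamx (w : 'S_n) : 'M[C]_N :=
  \matrix_(a, b) (tidx b == [ffun i => tidx a (w i)])%:R.

Lemma tensmx_ptens A v : tensmx A *m ptens v = ptens (fun i => A i *m v i).
Proof.
apply/colP => a; rewrite !mxE.
under [RHS]eq_bigr do rewrite mxE.
rewrite bigA_distr_bigA /= [RHS](reindex (@enum_val {ffun 'I_n -> 'I_d} predT)) /=; last first.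
  by apply: onW_bij; exact: enum_val_bij.
by apply: eq_bigr => b _; rewrite !mxE -big_split.
Qed.

Lemma gammamx_ptens w v :
  gammamx w *m ptens v = ptens (fun i => v (w^-1 i)%g).
Proof.
apply/colP => a; rewrite !mxE.
rewrite (bigD1 (enum_rank [ffun i => tidx a (w i)])) //= big1 ?addr0.
  rewrite !mxE /tidx enum_rankK eqxx mul1r [RHS](reindex_inj (@perm_inj _ w)) /=.
  by apply: eq_bigr => i _; rewrite permK ffunE.
move=> b neq; rewrite !mxE; case: eqP => [eb|]; last by rewrite mul0r.
by rewrite -eb enum_valK eqxx in neq.
Qed.

(* rho_M, already extended to P^F trivially on U^F: it only depends on the
   diagonal blocks. *)
Definition rhoM (k : fieldType) r (tau0 : 'M[k]_r -> 'M[C]_d)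
    (g : 'M[k]_(\sum_(i < n) r)) : 'M[C]_N :=
  tensmx (fun i => tau0 (blk g i i)).

(* The diagonal blocks of the reduction give J/J_+ = GL_r(F_q)^n. *)
Definition rho (F : localField) r (tau0 : 'M[lf_res F]_r -> 'M[C]_d)
    (g : 'M[F]_(\sum_(i < n) r)) : 'M[C]_N := rhoM tau0 (mxred g).

End Rho.

Section Haar.
Variables (F : localField) (m : nat).

Definition compact_support (L : lmodType C) (f : 'M[F]_m -> L) : Prop :=
  exists s : seq 'M[F]_m, forall g, f g <> 0 ->
    exists x k, [/\ x \in s, GL x, Kmax k & g = x *m k].

Definition Cc (f : 'M[F]_m -> C) : Prop :=
  [/\ on_GL (f : _ -> C^o), compact_support (f : _ -> C^o) &
      forall g, GL g -> exists j, forall k, Kcong j k -> f (g *m k) = f g].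

(* A Haar measure of GL_m(F), as an invariant positive functional on Cc. *)
Definition is_haar (mu : ('M[F]_m -> C) -> C) : Prop :=
  [/\ forall a f g, Cc f -> Cc g ->
        mu (fun x => a * f x + g x) = a * mu f + mu g,
      forall g f, GL g -> Cc f -> mu (fun x => f (g *m x)) = mu f,
      forall f, Cc f -> (forall x, 0 <= f x) -> 0 <= mu f
    & exists2 f, Cc f & mu f <> 0].

Definition is_vint (mu : ('M[F]_m -> C) -> C) (L : lmodType C)
    (h : 'M[F]_m -> L) (v : L) : Prop :=
  exists (l : nat) (f : 'I_l -> 'M[F]_m -> C) (y : 'I_l -> L),
    [/\ forall i, Cc (f i),
        forall g, GL g -> h g = \sum_(i < l) f i g *: y i
      & v = \sum_(i < l) mu (f i) *: y i].

(* A vector-valued locally constant function with compact support is a finite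
   sum of terms f_i y_i with f_i in Cc, which determines its integral. *)
Definition vint (mu : ('M[F]_m -> C) -> C) (L : lmodType C)
    (h : 'M[F]_m -> L) : L := xget 0 [set v | is_vint mu h v].
End Haar.

Section Hecke.
Variables (F : localField) (n r d : nat).
Variables (tau0 : 'M[lf_res F]_r -> 'M[C]_d).
Local Notation nr := (\sum_(i < n) r)%N.
Local Notation N := #|{: {ffun 'I_n -> 'I_d}}|.
Local Notation J := (@Jgrp F n r).
Variable mu : ('M[F]_nr -> C) -> C.

(* In the dual basis, transposition of matrices is the transpose. *)
Definition rhod (g : 'M[F]_nr) : 'M[C]_N := (rho tau0 (invmx g))^T.

Definition hecke : set ('M[F]_nr -> 'M[C]_N) :=
  [set f | [/\ on_GL f, compact_support f &
     forall k g k', J k -> GL g -> J k' ->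
       f (k *m g *m k') = rhod k *m f g *m rhod k']].

Definition hconv (f1 f2 : 'M[F]_nr -> 'M[C]_N) : 'M[F]_nr -> 'M[C]_N :=
  fun x => vint mu (fun g => f1 g *m f2 (invmx g *m x)).

Definition hone : 'M[F]_nr -> 'M[C]_N :=
  fun g => if `[< J g >]
           then (mu (fun x => (`[< J x >])%:R))^-1 *: rhod g else 0.

Section Action.
Variables (V : lmodType C) (pi : 'M[F]_nr -> V -> V).

Definition hact (f : 'M[F]_nr -> 'M[C]_N) (phi : 'cV[C]_N -> V) :
    'cV[C]_N -> V :=
  fun w => vint mu (fun g => pi g (phi ((f g)^T *m w))).

Definition HomJ : set ('cV[C]_N -> V) :=
  [set phi | linear phi /\
     forall j x, J j -> phi (rho tau0 j *m x) = pi j (phi x)].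

(* p in P^F acts on V^{K_+} through any lift g of p to K. *)
Definition HomPF : set ('cV[C]_N -> V) :=
  [set phi | [/\ linear phi, forall x, fixed (@Kplus F nr) pi (phi x) &
     forall g x, Kmax g -> Parab (mxred g) ->
       phi (rhoM tau0 (mxred g) *m x) = pi g (phi x)]].
End Action.
End Hecke.

Section Finite.
Variables (k : finFieldType) (n r d : nat) (tau0 : 'M[k]_r -> 'M[C]_d).
Local Notation nr := (\sum_(i < n) r)%N.
Local Notation N := #|{: {ffun 'I_n -> 'I_d}}|.

(* The group algebra of GL_{nr}(k): functions vanishing at singular matrices. *)
Definition ga_mul (x y : {ffun 'M[k]_nr -> C}) : {ffun 'M[k]_nr -> C} :=
  [ffun h => \sum_(g | g \in unitmx) x g * y (invmx g *m h)].
Definition ga_elt (g : 'M[k]_nr) : {ffun 'M[k]_nr -> C} :=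
  [ffun h => (h == g)%:R].
Definition ga_eU : {ffun 'M[k]_nr -> C} :=
  (#|[pred u : 'M[k]_nr | `[< Urad u >]]|%:R)^-1 *:
    \sum_(u : 'M[k]_nr | `[< Urad u >]) ga_elt u.
Definition ga_CGeU : set {ffun 'M[k]_nr -> C} :=
  [set x | exists2 y : {ffun 'M[k]_nr -> C},
     (forall g, g \notin unitmx -> y g = 0) & x = ga_mul y ga_eU].

Definition balanced (W : lmodType C)
    (f : {ffun 'M[k]_nr -> C} -> 'cV[C]_N -> W) : Prop :=
  [/\ forall v, linear_on ga_CGeU (f^~ v),
      forall x, ga_CGeU x -> linear (f x)
    & forall x m v, ga_CGeU x -> Levi m ->
        f (ga_mul x (ga_elt m)) v = f x (rhoM tau0 m *m v)].

(* I, with beta x v = x \otimes v, is C[G^F] e_{U^F} \otimes_{C[M^F]} rho_M. *)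
Definition is_finInd (I : lmodType C)
    (beta : {ffun 'M[k]_nr -> C} -> 'cV[C]_N -> I)
    (act : 'M[k]_nr -> I -> I) : Prop :=
  [/\ balanced beta,
      forall (W : lmodType C) (f : {ffun 'M[k]_nr -> C} -> 'cV[C]_N -> W),
        balanced f -> exists! g : I -> W, linear g /\
          forall x v, ga_CGeU x -> g (beta x v) = f x v
    & forall g, GL g -> linear (act g) /\
        forall x v, ga_CGeU x ->
          act g (beta x v) = beta (ga_mul (ga_elt g) x) v].

Section H1.
Variables (I : lmodType C) (beta : {ffun 'M[k]_nr -> C} -> 'cV[C]_N -> I).
Variable act : 'M[k]_nr -> I -> I.

Definition H1 : set (I -> I) :=
  [set h | linear h /\ forall g y, GL g -> h (act g y) = act g (h y)].

(* The product of the opposite of the endomorphism algebra. *)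
Definition mul1 (h h' : I -> I) : I -> I := h' \o h.

Definition is_T_simple (s : 'S_n) (h : I -> I) : Prop :=
  let qr : C := (#|k| ^ r)%:R in
  [/\ H1 h,
      exists c : C, forall g v, GL g ->
        h (beta (ga_mul (ga_elt g) ga_eU) v) =
        c *: beta (ga_mul (ga_mul (ga_mul (ga_elt g) ga_eU)
                                  (ga_elt (blkperm k r s))) ga_eU)
                  (gammamx d s *m v)
    & mul1 h h = (qr - 1) *: h + qr *: id].
End H1.
End Finite.

Definition simple_refl n (s : 'S_n) : Prop :=
  exists i j : 'I_n, j = i.+1 :> nat /\ s = tperm i j.

Definition word_of n (ss : seq 'S_n) (w : 'S_n) : Prop :=
  (forall s, s \in ss -> simple_refl s) /\ w = (\prod_(s <- ss) s)%g.
Definition reduced_word n (ss : seq 'S_n) (w : 'S_n) : Prop :=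
  word_of ss w /\ forall ss', word_of ss' w -> (size ss <= size ss')%N.

Definition along_reduced n (A : Type) (mul : A -> A -> A) (one : A)
    (b : 'S_n -> A) : Prop :=
  forall w, exists2 ss, reduced_word ss w &
    b w = foldr (fun s x => mul (b s) x) one ss.

Definition is_T_basis (k : finFieldType) n r d (I : lmodType C)
    (beta : {ffun 'M[k]_(\sum_(i < n) r) -> C} ->
            'cV[C]_#|{: {ffun 'I_n -> 'I_d}}| -> I)
    (act : 'M[k]_(\sum_(i < n) r) -> I -> I) (T : 'S_n -> I -> I) : Prop :=
  (forall s, simple_refl s -> is_T_simple beta act s (T s)) /\
  along_reduced (@mul1 I) id T.

Definition is_hecke_basis (F : localField) n r d
    (tau0 : 'M[lf_res F]_r -> 'M[C]_d)
    (mu : ('M[F]_(\sum_(i < n) r) -> C) -> C)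
    (b : 'S_n -> 'M[F]_(\sum_(i < n) r) ->
         'M[C]_#|{: {ffun 'I_n -> 'I_d}}|) : Prop :=
  let qr : C := (#|lf_res F| ^ r)%:R in
  (forall s, simple_refl s ->
    [/\ hecke tau0 (b s),
        forall g, b s g <> 0 -> exists k k', [/\ Jgrp k, Jgrp k' &
          g = k *m blkperm F r s *m k']
      & hconv mu (b s) (b s) = (qr - 1) *: b s + qr *: hone tau0 mu]) /\
  along_reduced (hconv mu) (hone tau0 mu) b.

Definition lin_span (B : finType) (A : lmodType C) (b : B -> A) : set A :=
  [set x | exists c : B -> C, x = \sum_w c w *: b w].

Definition is_basis (B : finType) (A : lmodType C) (E : set A) (b : B -> A) :=
  E = lin_span b /\ forall c : B -> C, \sum_w c w *: b w = 0 -> forall w, c w = 0.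

Definition algebra_iso (A A' : lmodType C)
    (mul : A -> A -> A) (one : A) (E : set A)
    (mul' : A' -> A' -> A') (one' : A') (E' : set A') (f : A -> A') : Prop :=
  [/\ linear_on E f, set_bij E E' f, f one = one' &
      forall x y, E x -> E y -> f (mul x y) = mul' (f x) (f y)].

Definition HomGF (F : localField) m (I : lmodType C)
    (act : 'M[lf_res F]_m -> I -> I) (V : lmodType C)
    (pi : 'M[F]_m -> V -> V) : set (I -> V) :=
  [set f | [/\ linear f, forall y, fixed (@Kplus F m) pi (f y) &
     forall g y, Kmax g -> f (act (mxred g) y) = pi g (f y)]].

End Theory.

(* Main.v *)
Require Import Defs.
From HB Require Import structures.
From mathcomp Require Import all_boot all_order all_fingroup all_algebra.
From mathcomp Require Import boolp classical_sets functions reals.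
From mathcomp Require Import complex zify ring.
Import Order.TTheory GRing.Theory Num.Theory.
Local Open Scope classical_set_scope.
Local Open Scope ring_scope.

Set Implicit Arguments.
Unset Strict Implicit.
Unset Printing Implicit Defensive.


(** Endomorphisms of the induced representation I of the finite group and Hecke
    operators supported on K are the same objects: matrix-valued functions on
    GL_(nr)(F_q) that transform by rho_M under P on both sides ([bicov]). For h in
    H_1 the function is its convolution kernel [ker_of]. For a Hecke operator it is
    the restriction to K, which factors through the reduction because J is the
    preimage of P ([JgrpP]). The Haar integral of a function that factors through
    the reduction is a multiple of a finite sum ([vint_fin]), and the volume of K_+
    is not zero ([vol_neq0]), so composition and convolution agree after
    normalisation. This gives the isomorphism [Psi].

    By the Bruhat decomposition and the cuspidality of tau0 such a function is zero
    as soon as it vanishes at the block permutations ([bicov_zero]); at a block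
    permutation w it is a multiple of gamma_w by Schur's lemma ([bicov_scalar]). The
    generator T_s is c_s times the operator e_U s e_U followed by gamma_s, and along
    reduced words these operators multiply without corrections ([opX_mul]), so
    that T_w is a nonzero multiple of the operator of w. The braid and quadratic
    relations force all c_s to be equal ([T_coef_adj]), whence T_w is independent of
    the reduced word and the T_w form a basis. A Hecke operator [s] supported on JsJ
    corresponds to a multiple of T_s, and the quadratic relation forces the multiple
    to be 1 ([b_simple]). Frobenius reciprocity ([res_bij]) identifies V_rho with the
    homomorphisms from I to the K_+-fixed vectors; composition with h and the action
    of [Psi h] are then given by the same finite sum ([hact_Psi]).

    For the last assertion, the heart of the matter is a statement on the finite
    group: a function to the space of rho_M (or a tuple of such functions) that is
    covariant under P on the left lies in the span of translates of its averages
    against the matrix coefficients of rho_M ([covariant_span]). It is used twice.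

    First, the K_+-fixed vectors of V are sums of values Phi (y) with Phi a
    homomorphism from I and y in I ([VK_spanned]). Realise V as a subquotient of a
    parabolically induced representation and lift a K_+-fixed vector to a K_+-fixed
    function f. By the Iwasawa decomposition f is determined by its restriction to K.
    The depth-zero vectors of tau form a copy of tau0, since a K_+-fixed function in
    the compactly induced representation is supported on the compact-mod-centre
    subgroup ([cInd_support]); so the restriction of f to K is a left P-covariant
    function with values in rho_M, and its averages are values of homomorphisms
    from I.

    Second, every linear relation between vectors Phi_j (y_j) follows from relations
    between compositions of the Phi_j with elements of H_1 ([transfer_relation]). An
    isomorphism theta of H_0-modules preserves relations of the second kind, so that
    Phi (y) |-> theta (Phi) (y) extends to a well defined map on K_+-fixed vectors,
    which is the required isomorphism ([fixed_vectors_iso]). *)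

(** * The ring of integers and the maximal compact subgroup *)

Section Integers.
Variable F : localField.
Local Notation k := (lf_res F).
Implicit Types (x y : F) (i j : int).

Lemma in_pow0 j : in_pow j (0 : F).
Proof. by rewrite /in_pow eqxx. Qed.

Lemma val1 : lf_val (1 : F) = 0.
Proof.
have := lf_valM (oner_neq0 F) (oner_neq0 F).
by rewrite mulr1 => /eqP; rewrite -subr_eq0 opprD addNKr oppr_eq0 => /eqP.
Qed.

Lemma valN x : lf_val (- x) = lf_val x.
Proof.
have [->|x0] := eqVneq x 0; first by rewrite oppr0.
have n1 : (-1 : F) != 0 by rewrite oppr_eq0 oner_neq0.
have v1 : lf_val (-1 : F) = 0.
  have := lf_valM n1 n1; rewrite mulrNN mulr1 val1 => /eqP.
  by rewrite eq_sym -mulr2n -mulr_natr mulf_eq0 orbF => /eqP.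
by rewrite -mulN1r lf_valM // v1 add0r.
Qed.

Lemma in_pow_le i j x : i <= j -> in_pow j x -> in_pow i x.
Proof. by move=> ij; rewrite /in_pow; case: eqP => //= _ /(le_trans ij). Qed.

Lemma in_powN j x : in_pow j (- x) = in_pow j x.
Proof. by rewrite /in_pow oppr_eq0 valN. Qed.

Lemma in_powD j x y : in_pow j x -> in_pow j y -> in_pow j (x + y).
Proof.
rewrite /in_pow; have [->|x0] := eqVneq x 0; first by rewrite add0r.
have [->|y0] := eqVneq y 0; first by rewrite addr0 (negPf x0).
have [//|xy0] /= := eqVneq (x + y) 0 => jx jy.
by apply: le_trans (lf_valD x0 y0 xy0); rewrite le_min jx.
Qed.

Lemma in_powB j x y : in_pow j x -> in_pow j y -> in_pow j (x - y).
Proof. by move=> jx jy; apply: in_powD; rewrite ?in_powN. Qed.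

Lemma in_powM i j x y : in_pow i x -> in_pow j y -> in_pow (i + j) (x * y).
Proof.
rewrite /in_pow; have [->|x0] := eqVneq x 0; first by rewrite mul0r eqxx.
have [->|y0] := eqVneq y 0; first by rewrite mulr0 eqxx.
by rewrite mulf_eq0 (negPf x0) (negPf y0) /= lf_valM //; exact: lerD.
Qed.

Lemma int_pow1 : in_pow 0 (1 : F).
Proof. by rewrite /in_pow val1 lexx orbT. Qed.

Lemma intM x y : in_pow 0 x -> in_pow 0 y -> in_pow 0 (x * y).
Proof. by move=> ix iy; rewrite -[0]addr0; exact: in_powM. Qed.

Lemma in_powMl j x y : in_pow 0 x -> in_pow j y -> in_pow j (x * y).
Proof. by move=> ix iy; rewrite -[j]add0r; exact: in_powM. Qed.

Lemma in_powMr j x y : in_pow j x -> in_pow 0 y -> in_pow j (x * y).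
Proof. by move=> ix iy; rewrite -[j]addr0; exact: in_powM. Qed.

Lemma in_pow_sum j (J : Type) (s : seq J) (P : pred J) (f : J -> F) :
  (forall l, P l -> in_pow j (f l)) -> in_pow j (\sum_(l <- s | P l) f l).
Proof.
by move=> fP; elim/big_ind: _ => //; [exact: in_pow0 | exact: in_powD].
Qed.

Lemma int_prod (J : Type) (s : seq J) (P : pred J) (f : J -> F) :
  (forall l, P l -> in_pow 0 (f l)) -> in_pow 0 (\prod_(l <- s | P l) f l).
Proof.
by move=> fP; elim/big_ind: _ => //; [exact: int_pow1 | exact: intM].
Qed.

Lemma red0 : lf_red (0 : F) = 0.
Proof. by apply/eqP; rewrite lf_red_ker ?eqxx. Qed.

Lemma red_eq0 x : in_pow 0 x -> (lf_red x == 0) = in_pow 1 x.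
Proof. exact: lf_red_ker. Qed.

Lemma redN x : in_pow 0 x -> lf_red (- x) = - lf_red x.
Proof.
move=> ix; apply/eqP; rewrite -addr_eq0 -lf_redD ?addNr ?red0 //.
by rewrite -/(in_pow 0 _) in_powN.
Qed.

Lemma red_sum (J : Type) (s : seq J) (P : pred J) (f : J -> F) :
  (forall l, P l -> in_pow 0 (f l)) ->
  lf_red (\sum_(l <- s | P l) f l) = \sum_(l <- s | P l) lf_red (f l).
Proof.
move=> fP; suff [] : in_pow 0 (\sum_(l <- s | P l) f l) /\
  lf_red (\sum_(l <- s | P l) f l) = \sum_(l <- s | P l) lf_red (f l) by [].
elim/big_rec2: _ => [|l y z Pl [iz ez]]; first by rewrite in_pow0 red0.
by rewrite in_powD ?fP // -ez lf_redD //; exact: fP.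
Qed.

Lemma red_prod (J : Type) (s : seq J) (P : pred J) (f : J -> F) :
  (forall l, P l -> in_pow 0 (f l)) ->
  lf_red (\prod_(l <- s | P l) f l) = \prod_(l <- s | P l) lf_red (f l).
Proof.
move=> fP; suff [] : in_pow 0 (\prod_(l <- s | P l) f l) /\
  lf_red (\prod_(l <- s | P l) f l) = \prod_(l <- s | P l) lf_red (f l) by [].
elim/big_rec2: _ => [|l y z Pl [iz ez]]; first by rewrite int_pow1 lf_red1.
by rewrite intM ?fP // -ez lf_redM //; exact: fP.
Qed.

Lemma int_unit x : in_pow 0 x -> lf_red x != 0 ->
  [/\ x != 0, lf_val x = 0 & in_pow 0 x^-1].
Proof.
move=> ix; rewrite red_eq0 // /in_pow negb_or => /andP[x0 v1].
move: ix; rewrite /in_pow (negPf x0) /= => v0.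
have vx : lf_val x = 0.
  by apply/eqP; rewrite eq_le v0 andbT -ltzD1 add0r ltNge.
split=> //; rewrite invr_eq0 (negPf x0) /=.
have := lf_valM x0 (invr_neq0 x0); rewrite mulfV // val1 vx add0r => <-.
by rewrite lexx.
Qed.

(** Lifts 0 and 1 to themselves, so that the entrywise lift of a matrix keeps
    its zero blocks and its identity blocks. *)
Definition lift1 (z : k) : F :=
  if z == 0 then 0 else if z == 1 then 1 else s2val (cid2 (lf_red_surj z)).

Lemma lift1_int z : in_pow 0 (lift1 z).
Proof.
rewrite /lift1; case: eqP => _; first exact: in_pow0.
by case: eqP => _; [exact: int_pow1 | exact: (s2valP (cid2 (lf_red_surj z)))].
Qed.

Lemma lift1K z : lf_red (lift1 z) = z.
Proof.
rewrite /lift1; case: eqP => [->|_]; first exact: red0.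
case: eqP => [->|_]; [exact: lf_red1 | exact: (s2valP' (cid2 (lf_red_surj z)))].
Qed.

Lemma uniformizer_exists : exists p : F, [/\ p != 0, in_pow 1 p & in_pow (-1) p^-1].
Proof.
have [p [p0 vp]] := lf_val_unif F; exists p; rewrite /in_pow invr_eq0 (negPf p0).
rewrite vp lexx; split=> //.
have := lf_valM p0 (invr_neq0 p0); rewrite mulfV // val1 vp => /eqP.
by rewrite eq_sym addrC addr_eq0 => /eqP ->; rewrite lexx.
Qed.
End Integers.

Section MaxCompact.
Variable F : localField.
Local Notation k := (lf_res F).
Variable m : nat.
Implicit Types (g h : 'M[F]_m).

Definition intmx p q (g : 'M[F]_(p, q)) := forall i j, in_pow 0 (g i j).

Lemma intmxM p q s (g : 'M[F]_(p, q)) (h : 'M[F]_(q, s)) :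
  intmx g -> intmx h -> intmx (g *m h).
Proof. by move=> ig ih i j; rewrite mxE; apply: in_pow_sum => l _; exact: intM. Qed.

Lemma intmxD g h : intmx g -> intmx h -> intmx (g + h).
Proof. by move=> ig ih i j; rewrite mxE; exact: in_powD. Qed.

Lemma intmxN g : intmx g -> intmx (- g).
Proof. by move=> ig i j; rewrite mxE in_powN. Qed.

Lemma intmxB g h : intmx g -> intmx h -> intmx (g - h).
Proof. by move=> ig ih; apply: intmxD => //; exact: intmxN. Qed.

Lemma int_nat (b : bool) : in_pow 0 (b%:R : F).
Proof. by case: b; [exact: int_pow1 | exact: in_pow0]. Qed.

Lemma intmx1 : intmx (1%:M : 'M[F]_m).
Proof. by move=> i j; rewrite mxE; exact: int_nat. Qed.

Lemma int_det g : intmx g -> in_pow 0 (\det g).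
Proof.
move=> ig; apply: in_pow_sum => s _; apply: intM; last exact: int_prod.
by elim: (odd_perm s) => /=; rewrite ?expr1 ?expr0 ?in_powN int_pow1.
Qed.

Lemma mxredM g h : intmx g -> intmx h -> mxred (g *m h) = mxred g *m mxred h.
Proof.
move=> ig ih; apply/matrixP => i j; rewrite !mxE red_sum => [|l _]; last exact: intM.
by apply: eq_bigr => l _; rewrite !mxE lf_redM //; [exact: ig | exact: ih].
Qed.

Lemma mxredD g h : intmx g -> intmx h -> mxred (g + h) = mxred g + mxred h.
Proof. by move=> ig ih; apply/matrixP => i j; rewrite !mxE lf_redD //; [exact: ig | exact: ih]. Qed.

Lemma mxredN g : intmx g -> mxred (- g) = - mxred g.
Proof. by move=> ig; apply/matrixP => i j; rewrite !mxE redN //; exact: ig. Qed.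

Lemma mxred1 : mxred (1%:M : 'M[F]_m) = 1%:M.
Proof. by apply/matrixP => i j; rewrite !mxE; case: eqP; rewrite ?lf_red1 ?red0. Qed.

Lemma mxred_det g : intmx g -> \det (mxred g) = lf_red (\det g).
Proof.
move=> ig; rewrite /determinant red_sum => [|s _]; last first.
  apply: intM; last exact: int_prod.
  by elim: (odd_perm s) => /=; rewrite ?expr1 ?expr0 ?in_powN int_pow1.
apply: eq_bigr => s _; rewrite lf_redM; last 2 first.
- by elim: (odd_perm s) => /=; rewrite ?expr1 ?expr0 -/(in_pow 0 _) ?in_powN int_pow1.
- by apply: (@int_prod F) => l _; exact: ig.
rewrite red_prod //; congr (_ * _); last by apply: eq_bigr => l _; rewrite mxE.
by case: (odd_perm s) => /=; rewrite ?expr1 ?expr0 ?redN ?lf_red1 //; exact: int_pow1.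
Qed.

Lemma Kmax_int g : Kmax g -> intmx g.
Proof. by case. Qed.

Lemma Kmax_unit g : Kmax g -> g \in unitmx.
Proof. by case. Qed.

Lemma intmx_adj g : intmx g -> intmx (\adj g).
Proof.
move=> ig i j; rewrite mxE /cofactor; apply: intM.
  elim: (j + i)%N => [|l IH]; first by rewrite expr0 int_pow1.
  by rewrite exprS mulN1r in_powN.
rewrite /determinant; apply: in_pow_sum => s _; apply: intM.
  by elim: (odd_perm s) => /=; rewrite ?expr1 ?expr0 ?in_powN int_pow1.
by apply: int_prod => l _; rewrite !mxE.
Qed.

(** The inverse is det^-1 times the adjugate, and det is a unit as soon as its
    reduction is not zero. *)
Lemma KmaxP g : Kmax g <-> intmx g /\ mxred g \in unitmx.
Proof.
split=> [[ug ig ig']|[ig ur]].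
  split=> //; have := mxredM ig ig'; rewrite mulmxV // mxred1 => e.
  by have [] := mulmx1_unit (esym e).
have [d0 _ di] : [/\ \det g != 0, lf_val (\det g) = 0 & in_pow 0 (\det g)^-1].
  apply: int_unit; first exact: int_det.
  by rewrite -mxred_det // -unitfE -unitmxE.
have ug : g \in unitmx by rewrite unitmxE unitfE.
split=> // i j; rewrite /invmx ug mxE; apply: intM => //.
exact: intmx_adj.
Qed.

Lemma Kmax_red g : Kmax g -> mxred g \in unitmx.
Proof. by move=> /KmaxP[]. Qed.

Lemma KmaxM g h : Kmax g -> Kmax h -> Kmax (g *m h).
Proof.
move=> Kg Kh; apply/KmaxP; split; first by apply: intmxM; exact: Kmax_int.
by rewrite mxredM; [rewrite unitmx_mul !Kmax_red|exact: Kmax_int|exact: Kmax_int].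
Qed.

Lemma KmaxV g : Kmax g -> Kmax (invmx g).
Proof. by case=> ug ig ig'; split; rewrite ?unitmx_inv // invmxK. Qed.

Lemma Kmax1 : Kmax (1%:M : 'M[F]_m).
Proof. by apply/KmaxP; rewrite mxred1 unitmx1; split=> //; exact: intmx1. Qed.

Lemma mxredV g : Kmax g -> mxred (invmx g) = invmx (mxred g).
Proof.
move=> Kg; have := mxredM (Kmax_int Kg) (Kmax_int (KmaxV Kg)).
rewrite mulmxV ?Kmax_unit // mxred1 => e.
by rewrite -[LHS](mulKmx (Kmax_red Kg)) -e mulmx1.
Qed.

Lemma KplusP g : Kplus g <-> intmx g /\ mxred g = 1%:M.
Proof.
split=> [[Kg e]|[ig e]]; first by split=> //; exact: Kmax_int.
by split=> //; apply/KmaxP; split=> //; rewrite e unitmx1.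
Qed.

Lemma KplusM g h : Kplus g -> Kplus h -> Kplus (g *m h).
Proof.
move=> [Kg rg] [Kh rh]; split; first exact: KmaxM.
by rewrite mxredM ?rg ?rh ?mulmx1 //; exact: Kmax_int.
Qed.

Lemma KplusV g : Kplus g -> Kplus (invmx g).
Proof. by move=> [Kg rg]; split; [exact: KmaxV | rewrite mxredV // rg invmx1]. Qed.

Lemma Kplus1 : Kplus (1%:M : 'M[F]_m).
Proof. by split; [exact: Kmax1 | exact: mxred1]. Qed.

Lemma Kplus_conj g h : Kmax g -> Kplus h -> Kplus (g *m h *m invmx g).
Proof.
move=> Kg [Kh rh]; split; first by apply: KmaxM; [exact: KmaxM | exact: KmaxV].
have ig := Kmax_int Kg; have ih := Kmax_int Kh.
rewrite mxredM ?mxredM ?rh ?mulmx1 ?mxredV ?mulmxV ?Kmax_red //.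
- exact: intmxM.
- exact: (Kmax_int (KmaxV Kg)).
Qed.

Lemma Kplus_div g h : Kmax g -> Kmax h -> mxred g = mxred h ->
  Kplus (invmx g *m h).
Proof.
move=> Kg Kh e; split; first by apply: KmaxM => //; exact: KmaxV.
rewrite mxredM ?mxredV -?e ?mulVmx ?Kmax_red //; last exact: Kmax_int.
exact: (Kmax_int (KmaxV Kg)).
Qed.

Definition lft (y : 'M[k]_m) : 'M[F]_m := map_mx (@lift1 F) y.

Lemma lftK y : mxred (lft y) = y.
Proof. by apply/matrixP => i j; rewrite !mxE lift1K. Qed.

Lemma lft_int y : intmx (lft y).
Proof. by move=> i j; rewrite mxE; exact: lift1_int. Qed.

Lemma lft_Kmax y : y \in unitmx -> Kmax (lft y).
Proof. by move=> uy; apply/KmaxP; rewrite lftK; split=> //; exact: lft_int. Qed.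

Lemma lift1_0 : lift1 (0 : k) = 0.
Proof. by rewrite /lift1 eqxx. Qed.

Lemma lift1_1 : lift1 (1 : k) = 1.
Proof. by rewrite /lift1 oner_eq0 eqxx. Qed.
End MaxCompact.

(** * Congruence subgroups *)

Lemma mul_invmx (K : fieldType) m (A B : 'M[K]_m) : A \in unitmx -> B \in unitmx ->
  invmx (A *m B) = invmx B *m invmx A.
Proof.
move=> uA uB; have uAB : A *m B \in unitmx by rewrite unitmx_mul uA.
by apply: (can_inj (mulKmx uAB)); rewrite mulmxV // mulmxA mulmxK // mulmxV.
Qed.

Section Congruence.
Variables (F : localField) (m : nat).
Local Notation k := (lf_res F).
Local Notation mat := 'M[F]_m.
Implicit Types (g h x y : mat) (j : nat).

Definition powmx (j : int) g := forall a b, in_pow j (g a b).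

Lemma powmxMl (j : int) g h : intmx g -> powmx j h -> powmx j (g *m h).
Proof. by move=> ig ih a b; rewrite mxE; apply: in_pow_sum => l _; exact: in_powMl. Qed.

Lemma powmxD (j : int) g h : powmx j g -> powmx j h -> powmx j (g + h).
Proof. by move=> ig ih a b; rewrite mxE; exact: in_powD. Qed.

Lemma powmxN (j : int) g : powmx j (- g) <-> powmx j g.
Proof. by split=> ig a b; have := ig a b; rewrite mxE in_powN. Qed.

Lemma powmx_le (i j : int) g : i <= j -> powmx j g -> powmx i g.
Proof. by move=> ij ig a b; exact: in_pow_le (ig a b). Qed.

Lemma mxred_eq g h : intmx g -> intmx h -> mxred g = mxred h <-> powmx 1 (g - h).
Proof.
move=> ig ih; have e a b : (mxred g a b == mxred h a b) = in_pow 1 ((g - h) a b).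
  rewrite !mxE -subr_eq0 -redN ?ih // -lf_redD ?red_eq0 //.
  - by apply: in_powB; [exact: ig | exact: ih].
  - exact: ig.
  - by rewrite -/(in_pow 0 _) in_powN; exact: ih.
split=> [E a b|p]; first by rewrite -e E.
by apply/matrixP => a b; apply/eqP; rewrite e.
Qed.

Lemma Kplus_pow g : Kplus g <-> powmx 1 (g - 1%:M).
Proof.
split=> [/KplusP[ig e]|p].
  by apply/mxred_eq => //; [exact: intmx1 | rewrite mxred1].
have ig : intmx g.
  by rewrite -(subrK 1%:M g); apply: intmxD; [exact: powmx_le p | exact: intmx1].
by apply/KplusP; split=> //; rewrite -(mxred1 F m); apply/mxred_eq => //; exact: intmx1.
Qed.

Lemma KcongP j g : Kcong j g <-> powmx j.+1%:Z (g - 1%:M).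
Proof.
split=> [[]//|p]; split=> //.
by have /Kplus_pow[] : powmx 1 (g - 1%:M) by apply: powmx_le p.
Qed.

Lemma Kcong_plus j g : Kcong j g -> Kplus g.
Proof. by move=> /KcongP p; apply/Kplus_pow; apply: powmx_le p. Qed.

Lemma Kplus_cong : @Kplus F m = Kcong 0.
Proof.
by apply/seteqP; split=> g; [move/Kplus_pow => p; apply/KcongP | exact: Kcong_plus].
Qed.

Lemma Kcong_le i j g : (i <= j)%N -> Kcong j g -> Kcong i g.
Proof. by move=> ij /KcongP p; apply/KcongP; apply: powmx_le p; rewrite lez_nat. Qed.

Lemma Kcong_unit j g : Kcong j g -> g \in unitmx.
Proof. by case=> /Kmax_unit. Qed.

Lemma Kcong1 j : Kcong j (1%:M : mat).
Proof. by apply/KcongP; rewrite subrr => a b; rewrite mxE in_pow0. Qed.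

Lemma KcongM j g h : Kcong j g -> Kcong j h -> Kcong j (g *m h).
Proof.
move=> Kg Kh; apply/KcongP.
have -> : g *m h - 1%:M = g *m (h - 1%:M) + (g - 1%:M).
  by rewrite mulmxBr mulmx1 addrA subrK.
apply: powmxD; last exact/KcongP.
by apply: powmxMl; [exact: (Kmax_int Kg.1) | exact/KcongP].
Qed.

Lemma KcongV j g : Kcong j g -> Kcong j (invmx g).
Proof.
move=> Kg; apply/KcongP.
have -> : invmx g - 1%:M = invmx g *m - (g - 1%:M).
  by rewrite opprB mulmxBr mulmx1 mulVmx // (Kcong_unit Kg).
apply: powmxMl; first exact: (Kmax_int (KmaxV Kg.1)).
by apply/powmxN/KcongP.
Qed.

Definition coset_eq j x y := Kcong j (invmx x *m y).

Lemma coset_eq_refl j x : x \in unitmx -> coset_eq j x x.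
Proof. by move=> ux; rewrite /coset_eq mulVmx //; exact: Kcong1. Qed.

Lemma coset_eq_sym j x y : x \in unitmx -> y \in unitmx -> coset_eq j x y -> coset_eq j y x.
Proof.
move=> ux uy /KcongV.
by rewrite /coset_eq mul_invmx ?unitmx_inv // invmxK.
Qed.

Lemma coset_eq_trans j x y z : y \in unitmx -> coset_eq j x y -> coset_eq j y z -> coset_eq j x z.
Proof. by move=> uy /KcongM xy /xy; rewrite /coset_eq mulmxA mulmxK. Qed.

Lemma coset_eq_unit j x y : x \in unitmx -> coset_eq j x y -> y \in unitmx.
Proof. by move=> ux /Kcong_unit; rewrite unitmx_mul => /andP[]. Qed.

Lemma coset_eq_mull j g x y : g \in unitmx -> x \in unitmx -> coset_eq j (g *m x) (g *m y) = coset_eq j x y.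
Proof.
move=> ug ux; rewrite /coset_eq; congr (Kcong j _).
by rewrite mul_invmx // mulmxA mulmxKV.
Qed.

(** Successive congruence subgroups have finite index because the residue field
    is finite: 1 + p^(j+1) X mod p^(j+2) is determined by X mod p. *)
Lemma cong_cover j : exists s : seq mat,
  (forall x, x \in s -> Kcong j x) /\
  forall g, Kcong j g -> exists2 x, x \in s & coset_eq j.+1 x g.
Proof.
have [p [p0 p1 pV]] := uniformizer_exists F.
have pj (i : nat) : in_pow i%:Z (p ^+ i) /\ in_pow (- i%:Z) (p ^- i).
  elim: i => [|i [IH IH']]; first by rewrite expr0 invr1 oppr0; split; exact: int_pow1.
  by rewrite exprS invfM -[i.+1]add1n PoszD opprD; split; exact: in_powM.
pose c (Y : 'M[k]_m) := 1%:M + p ^+ j.+1 *: lft Y.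
have cK Y : Kcong j (c Y).
  apply/KcongP; rewrite /c addrC addKr => a b; rewrite mxE.
  by apply: in_powMr; [exact: (pj j.+1).1 | exact: lft_int].
exists [seq c Y | Y <- enum 'M[k]_m]; split=> [x /mapP[Y _ ->] //|g /KcongP Kg].
pose X := p ^- j.+1 *: (g - 1%:M).
have iX : intmx X.
  move=> a b; rewrite mxE -(subrr (j.+1%:Z)) addrC.
  by apply: in_powM; [exact: (pj j.+1).2 | exact: Kg].
exists (c (mxred X)); first by apply: map_f; rewrite mem_enum.
have uc := Kcong_unit (cK (mxred X)).
apply/KcongP; have -> : invmx (c (mxred X)) *m g - 1%:M =
    invmx (c (mxred X)) *m (p ^+ j.+1 *: (X - lft (mxred X))).
  rewrite -[X in _ - X](mulVmx uc) -mulmxBr; congr (_ *m _).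
  rewrite /c opprD addrA scalerBr; congr (_ - _).
  by rewrite /X scalerA mulfV ?scale1r // expf_neq0.
apply: powmxMl; first exact: (Kmax_int (KmaxV (cK _).1)).
have i0 : powmx 1 (X - lft (mxred X)).
  by apply/mxred_eq; [| exact: lft_int | rewrite lftK].
move=> a b; rewrite mxE -addn1 PoszD; apply: in_powM => //; exact: (pj j.+1).1.
Qed.

Lemma plus_cover j : exists s : seq mat,
  (forall x, x \in s -> Kplus x) /\
  forall g, Kplus g -> exists2 x, x \in s & coset_eq j x g.
Proof.
elim: j => [|j [s [sK sC]]].
  exists [:: 1%:M]; split=> [x|g]; first by rewrite inE => /eqP ->; exact: Kplus1.
  by rewrite Kplus_cong => Kg; exists 1%:M; rewrite ?inE // /coset_eq invmx1 mul1mx.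
have [t [tK tC]] := cong_cover j.
exists [seq x *m y | x <- s, y <- t]; split.
  move=> _ /allpairsP[[x y] [/= xs yt ->]]; apply: KplusM; first exact: sK.
  exact: Kcong_plus (tK _ yt).
move=> g Kg; have [x xs xg] := sC _ Kg; have [y yt yg] := tC _ xg.
exists (x *m y); first by apply: allpairs_f.
have ux := Kmax_unit (sK _ xs).1.
by rewrite -(mulKVmx ux g) coset_eq_mull // (Kcong_unit (tK _ yt)).
Qed.

Lemma irredundant j (s : seq mat) : {in s, forall x, x \in unitmx} ->
  exists2 t : seq mat, [/\ uniq t, {subset t <= s} &
     forall x y, x \in t -> y \in t -> coset_eq j x y -> x = y] &
     forall x, x \in s -> exists2 y, y \in t & coset_eq j y x.
Proof.
elim: s => [|x s IH] su; first by exists [::].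
have [|t [ut ts ti] tc] := IH; first by move=> y ys; apply: su; rewrite inE ys orbT.
have tu y : y \in t -> y \in unitmx by move=> /ts ys; apply: su; rewrite inE ys orbT.
have ux : x \in unitmx by apply: su; rewrite inE eqxx.
have [[y yt yx]|nx] := pselect (exists2 y, y \in t & coset_eq j y x).
  exists t; first by split=> // z /ts; rewrite inE orbC => ->.
  by move=> z; rewrite inE => /predU1P[->|/tc//]; exists y.
exists (x :: t); last first.
  move=> z; rewrite inE => /predU1P[->|/tc[y yt yz]].
    by exists x; [rewrite inE eqxx | exact: coset_eq_refl].
  by exists y; rewrite // inE yt orbT.
split.
- by rewrite /= ut andbT; apply/negP => xt; apply: nx; exists x => //; exact: coset_eq_refl.
- by move=> z; rewrite !inE => /predU1P[->|/ts ->]; rewrite ?eqxx ?orbT.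
- move=> y z; rewrite !inE => /predU1P[->|yt] /predU1P[->|zt] // yz; last exact: ti.
    by case: nx; exists z => //; apply: coset_eq_sym => //; exact: tu.
  by case: nx; exists y.
Qed.

Definition coset_reps j (s : seq mat) := [/\ (0 < size s)%N,
  forall x, x \in s -> Kplus x & forall g, Kplus g ->
    exists sg : mat -> mat, perm_eq (map sg s) s /\
      forall x, x \in s -> coset_eq j (sg x) (g *m x)].

(** Invariance of a list of representatives, up to the congruence subgroup, under
    left multiplication by K_+ is what makes averages over K_+ available. *)
Lemma transversal j : exists s, coset_reps j s.
Proof.
have [s [sK sC]] := plus_cover j.
have su : {in s, forall x, x \in unitmx} by move=> x /sK[/Kmax_unit].
have [R [uR Rs Ri] Rc] := irredundant j su.
have RC g : Kplus g -> exists2 x, x \in R & coset_eq j x g.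
  move=> /sC[x xs xg]; have [y yR yx] := Rc _ xs.
  by exists y => //; exact: coset_eq_trans (su _ xs) yx xg.
exists R; split.
- by have [x] := RC _ (Kplus1 F m); case: (R).
- by move=> x /Rs /sK.
move=> g Kg; have ug := Kmax_unit Kg.1.
have ex x : exists y, x \in R -> y \in R /\ coset_eq j y (g *m x).
  have [xR|_] := boolP (x \in R); last by exists x.
  have [y yR yx] := RC (g *m x) (KplusM Kg (sK _ (Rs _ xR))).
  by exists y.
have [sg sgP] := choice ex; exists sg; split; last by move=> x /sgP[].
have uRx x : x \in R -> x \in unitmx by move=> /Rs /su.
have inj : {in R &, injective sg}.
  move=> x y xR yR e; apply: Ri => //; rewrite -(coset_eq_mull j y ug (uRx _ xR)).
  have [a1 a2] := sgP _ xR; have [b1 b2] := sgP _ yR.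
  apply: coset_eq_trans (uRx _ a1) _ _; last by rewrite e.
  by apply: coset_eq_sym => //; rewrite ?unitmx_mul ?ug ?uRx.
have um : uniq (map sg R) by rewrite map_inj_in_uniq.
have sz : (size R <= size (map sg R))%N by rewrite size_map.
apply: uniq_perm => //; have [|_ //] := uniq_min_size um _ sz.
by move=> _ /mapP[x xR ->]; case: (sgP _ xR).
Qed.
End Congruence.

(** * Haar integrals of locally constant functions *)

Section HaarIntegral.
Variables (R : realType) (F : localField) (m : nat).
Local Notation C := R[i].
Local Notation k := (lf_res F).
Local Notation mat := 'M[F]_m.
Variable mu : (mat -> C) -> C.
Hypothesis muP : is_haar mu.
Implicit Types (f : mat -> C) (g x y : mat) (j : nat).

Lemma Cc_lin a f (g : mat -> C) : Cc f -> Cc g -> Cc (fun x => a * f x + g x).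
Proof.
move=> [f0 [s fs] fj] [g0 [t gt] gj]; split.
- by move=> x ux; rewrite f0 // g0 // mulr0 addr0.
- exists (s ++ t) => x; have [fx|/eqP fx] := eqVneq (f x) 0.
    rewrite fx mulr0 add0r => /gt[y [z [yt ? ? ?]]].
    by exists y, z; rewrite mem_cat yt orbT.
  by have [y [z [ys ? ? ?]]] := fs _ fx; exists y, z; rewrite mem_cat ys.
- move=> x ux; have [i fi] := fj _ ux; have [l gl] := gj _ ux.
  exists (maxn i l) => z Kz; rewrite fi ?gl //; apply: Kcong_le Kz.
    by rewrite leq_maxr.
  by rewrite leq_maxl.
Qed.

Lemma Cc0 : Cc (fun _ : mat => 0 : C).
Proof. by split=> [//||g _]; [exists [::] | exists 0%N]. Qed.

Lemma mu_lin a f (g : mat -> C) : Cc f -> Cc g ->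
  mu (fun x => a * f x + g x) = a * mu f + mu g.
Proof. by case: muP => + _ _ _; exact. Qed.

Lemma mu0 : mu (fun=> 0) = 0.
Proof.
have := mu_lin 1 Cc0 Cc0; rewrite mul1r addr0 mul1r => /eqP.
by rewrite -subr_eq0 opprD addNKr oppr_eq0 => /eqP.
Qed.

Lemma Cc_sum (J : Type) (s : seq J) (a : J -> C) (f : J -> mat -> C) :
  (forall l, Cc (f l)) -> Cc (fun x => \sum_(l <- s) a l * f l x).
Proof.
move=> fC; elim: s => [|l s IH].
  by under eq_fun do rewrite big_nil; exact: Cc0.
by under eq_fun do rewrite big_cons; exact: Cc_lin.
Qed.

Lemma mu_sum (J : Type) (s : seq J) (a : J -> C) (f : J -> mat -> C) :
  (forall l, Cc (f l)) ->
  mu (fun x => \sum_(l <- s) a l * f l x) = \sum_(l <- s) a l * mu (f l).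
Proof.
move=> fC; elim: s => [|l s IH].
  by rewrite big_nil -[RHS]mu0; under eq_fun do rewrite big_nil.
rewrite big_cons -IH -mu_lin //; last exact: Cc_sum.
by under eq_fun do rewrite big_cons.
Qed.

Definition cind j x : mat -> C := fun y => `[< coset_eq j x y >]%:R.

Lemma Cc_cutoff j x f : x \in unitmx -> (forall g, f g <> 0 -> g \in unitmx) ->
  (forall g, GL g -> exists j, forall k, Kcong j k -> f (g *m k) = f g) ->
  Cc (fun y => f y * cind j x y).
Proof.
move=> ux f0 fj; split.
- move=> g ug; rewrite (_ : f g = 0) ?mul0r //.
  by apply: contrapT => /f0; rewrite (negPf ug).
- exists [:: x] => g; rewrite /cind; case: asboolP => [xg _|_]; last by rewrite mulr0.
  exists x, (invmx x *m g); rewrite inE eqxx mulmxA mulmxV // mul1mx.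
  by split=> //; case: xg.
- move=> g ug; have [i fi] := fj g ug; exists (maxn i j) => z Kz.
  have Kz1 : Kcong j z by apply: Kcong_le Kz; rewrite leq_maxr.
  rewrite fi; last by apply: Kcong_le Kz; rewrite leq_maxl.
  congr (_ * _); rewrite /cind; congr (nat_of_bool _)%:R; apply: asbool_equiv_eq.
  rewrite /coset_eq mulmxA; split=> [|K]; last exact: KcongM.
  by move=> /KcongM /(_ (KcongV Kz1)); rewrite mulmxK // (Kcong_unit Kz1).
Qed.

Lemma Cc_ind j x : x \in unitmx -> Cc (cind j x).
Proof.
move=> ux; pose f := fun g : mat => (g \in unitmx)%:R : C.
rewrite (_ : cind j x = fun y => f y * cind j x y).
  apply: Cc_cutoff => // [g|g ug]; first by rewrite /f; case: (g \in unitmx).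
  exists 0%N => z Kz; congr (nat_of_bool _)%:R.
  by rewrite unitmx_mul (Kcong_unit Kz) andbT.
apply/funext => y; rewrite /f /cind; case: asboolP => [/(coset_eq_unit ux) -> |_].
  by rewrite mul1r.
by rewrite mulr0.
Qed.

Lemma mu_ind j x : x \in unitmx -> mu (cind j x) = mu (cind j 1%:M).
Proof.
move=> ux; case: muP => _ inv _ _.
rewrite -(inv (invmx x) (cind j 1%:M)); last 2 first.
- by rewrite /GL /= unitmx_inv.
- by apply: Cc_ind; exact: unitmx1.
by congr mu; apply/funext => y; rewrite /cind /coset_eq invmx1 mul1mx.
Qed.

Definition vol := mu (cind 0 1%:M).

Lemma mu_ind0 j : vol = 0 -> mu (cind j 1%:M) = 0.
Proof.
move=> v0; case: (muP) => _ _ pos _; have u1 := unitmx1 F m.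
apply: le_anti; apply/andP; split; last first.
  by apply: pos => [|y]; [exact: Cc_ind | rewrite ler0n].
have : 0 <= mu (fun y => -1 * cind j 1%:M y + cind 0 1%:M y).
  apply: pos => [|y]; first by apply: Cc_lin; exact: Cc_ind.
  rewrite mulN1r addrC subr_ge0 /cind ler_nat; case: asboolP => // K.
  by case: asboolP => // -[]; exact: Kcong_le K.
by rewrite mu_lin ?mulN1r -/vol ?v0 ?addr0 ?oppr_ge0 //; exact: Cc_ind.
Qed.

(** The cosets in s may repeat; cutting f along an irredundant sublist writes it
    as a sum, and the integral is additive. *)
Lemma mu_split j (s : seq mat) f : {in s, forall x, x \in unitmx} ->
  (forall g, f g <> 0 -> exists2 x, x \in s & coset_eq j x g) ->
  (forall g, f g <> 0 -> g \in unitmx) ->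
  (forall g, GL g -> exists j, forall k, Kcong j k -> f (g *m k) = f g) ->
  mu f <> 0 -> exists2 x, x \in s & mu (fun y => f y * cind j x y) <> 0.
Proof.
move=> su fs f0 fj mf; have [t [ut ts ti] tc] := irredundant j su.
apply: contrapT => no; apply: mf.
have tu x : x \in t -> x \in unitmx by move=> /ts /su.
pose f' x := if x \in t then fun y => f y * cind j x y else fun=> 0.
have f'C x : Cc (f' x).
  by rewrite /f'; case: ifP => [/tu ux|_]; [exact: Cc_cutoff | exact: Cc0].
rewrite (_ : f = fun y => \sum_(x <- t) 1 * f' x y).
  rewrite mu_sum // big_seq big1 // => x xt; rewrite mul1r /f' xt.
  by apply: contrapT => nx; apply: no; exists x => //; exact: ts.
apply/funext => y; rewrite big_seq.
under eq_bigr => x xt do rewrite mul1r /f' xt.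
rewrite -big_seq -mulr_sumr.
have [->|/eqP fy] := eqVneq (f y) 0; first by rewrite mul0r.
have uy := f0 _ fy; have [x0 /tc[x xt xx0] x0y] := fs _ fy.
have ux0 : x0 \in unitmx by apply: coset_eq_unit (tu _ xt) xx0.
have xy : coset_eq j x y := coset_eq_trans ux0 xx0 x0y.
rewrite (bigD1_seq x) //= /cind; case: asboolP => // _.
rewrite big_seq_cond big1 ?addr0 ?mulr1 // => z /andP[zt zx].
case: asboolP => // zy; case/eqP: zx; apply: ti => //.
exact: (coset_eq_trans uy zy (coset_eq_sym (tu _ xt) uy xy)).
Qed.

(** Were the volume of K_+ zero, a nonzero integral could be localised to
    smaller and smaller cosets; by completeness they shrink to a point, near
    which the integrand is constant. *)
Lemma vol_neq0 : vol != 0.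
Proof.
apply/eqP => v0; case: (muP) => _ _ _ [f fC mf].
have [f0 [s fs] fj] := fC.
have f0' g : f g <> 0 -> g \in unitmx by move=> fg; apply: contrapT => /negP /f0.
(* The part of the integral over the coset x K(j) is nonzero. *)
pose good (j : nat) x := x \in unitmx /\ mu (fun y => f y * cind j x y) <> 0.
have [x0 gx0] : exists x, good 0%N x.
  pose s' := [seq x <- [seq x *m lft u | x <- s, u <- enum 'M[k]_m] | x \in unitmx].
  have su' : {in s', forall x, x \in unitmx} by move=> x; rewrite mem_filter => /andP[].
  have fs' g : f g <> 0 -> exists2 x, x \in s' & coset_eq 0 x g.
    move=> fg; have [y [z [ys uy Kz ->]]] := fs _ fg.
    have ul := Kmax_unit (lft_Kmax (Kmax_red Kz)).
    exists (y *m lft (mxred z)).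
      rewrite mem_filter unitmx_mul ul andbT; apply/andP; split; first exact: uy.
      by apply: allpairs_f => //; rewrite mem_enum.
    rewrite coset_eq_mull // /coset_eq -Kplus_cong.
    by apply: Kplus_div; rewrite ?lftK //; apply: lft_Kmax; exact: Kmax_red.
  by have [x /su' ux mx] := mu_split su' fs' f0' fj mf; exists x.
have step (j : nat) x : good j x -> exists2 y, coset_eq j x y & good j.+1 y.
  move=> [ux mx]; have [t [tK tC]] := cong_cover F m j.
  have [y] : exists2 y, y \in [seq x *m y | y <- t] &
      mu (fun g => f g * cind j x g * cind j.+1 y g) <> 0.
    apply: mu_split mx => [y|g|g|].
    - by move=> /mapP[z /tK/Kcong_unit uz ->]; rewrite unitmx_mul ux.
    - rewrite /cind; case: asboolP => [/tC[z zt zy] _|_]; last by rewrite mulr0.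
      exists (x *m z); first exact: map_f.
      by rewrite -[g](mulKVmx ux) coset_eq_mull // (Kcong_unit (tK _ zt)).
    - by move=> fy; apply: f0' => fy0; apply: fy; rewrite fy0 mul0r.
    - by case: (Cc_cutoff j ux f0' fj).
  move=> /mapP[z zt ->] mz; exists (x *m z).
    by rewrite /coset_eq mulKmx //; exact: tK.
  split; first by rewrite unitmx_mul ux (Kcong_unit (tK _ zt)).
  move=> mz0; apply: mz; rewrite -[RHS]mz0; congr mu; apply/funext => g.
  rewrite -mulrA; congr (_ * _); rewrite /cind.
  case: (asboolP (coset_eq j.+1 _ _)) => [K|_]; last by rewrite mulr0.
  have uz := Kcong_unit (tK _ zt).
  case: asboolP => [_|[]]; first by rewrite mulr1.
  apply: (coset_eq_trans (y := x *m z)); first by rewrite unitmx_mul ux uz.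
    by rewrite /coset_eq mulKmx //; exact: tK.
  exact: Kcong_le K.
have [xs [xs0 xsP]] : exists xs : nat -> mat, xs 0%N = x0 /\
    forall j, coset_eq j (xs j) (xs j.+1) /\ good j (xs j).
  have st (j : nat) x : exists y, good j x -> coset_eq j x y /\ good j.+1 y.
    have [/step[y]|ng] := pselect (good j x); first by exists y.
    by exists x.
  have [nx nxP] := choice (fun p : nat * mat => st p.1 p.2).
  pose xs := fix xs j := if j is i.+1 then nx (i, xs i) else x0.
  exists xs; split=> // j; have gj : good j (xs j).
    by elim: j => // j IH; case: (nxP (j, xs j) IH).
  by split=> //; case: (nxP (j, xs j) gj).
have xu j : xs j \in unitmx by case: (xsP j) => _ [].
have xle i j : (i <= j)%N -> coset_eq i (xs i) (xs j).
  move=> /subnKC <-; elim: (j - i)%N => [|l IH]; first by rewrite addn0; exact: coset_eq_refl.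
  rewrite addnS; apply: coset_eq_trans IH _ => //.
  by case: (xsP (i + l)%N) => + _; apply: Kcong_le; rewrite leq_addr.
have [y yE] : exists y : nat -> mat, forall j, y j = invmx (xs 0%N) *m xs j by exists (fun j => invmx (xs 0%N) *m xs j).
have yK j : Kplus (y j) by rewrite yE; apply: Kcong_plus (xle 0%N j _).
have yle i j : (i <= j)%N -> powmx i.+1%:Z (y j - y i).
  move=> ij; have -> : y j - y i = y i *m (invmx (xs i) *m xs j - 1%:M).
    by rewrite mulmxBr mulmx1 !yE mulmxA mulmxK.
  apply: powmxMl; first exact: (Kmax_int (yK i).1).
  by apply/KcongP; exact: xle.
have yC i j (l : nat) : (l <= i)%N -> (l <= j)%N -> powmx l.+1%:Z (y i - y j).
  move=> li lj; have -> : y i - y j = (y i - y l) - (y j - y l).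
    by rewrite opprB addrA subrK.
  by apply: powmxD; [exact: yle | apply/powmxN; exact: yle].
have abs_le (z : int) : z <= `|z|%N.+1%:Z.
  by apply: le_trans (ler_norm z) _; rewrite -addn1 PoszD lerDl.
have [l lP] : exists l : mat, forall j : int, exists N : nat,
    forall a : nat, (N <= a)%N -> powmx j (y a - l).
  have ex (p : 'I_m * 'I_m) : exists l, forall j : int, exists N : nat,
      forall c : nat, (N <= c)%N -> in_pow j (y c p.1 p.2 - l).
    apply: (@lf_complete F (fun c => y c p.1 p.2)) => z.
    exists `|z|%N => c e zc ze; have := yC c e `|z|%N zc ze p.1 p.2.
    by rewrite !mxE => /(in_pow_le (abs_le z)).
  have [l lP] := choice ex.
  exists (\matrix_(a, b) l (a, b)) => z.
  have [N NP] := choice (fun p => lP p z).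
  exists (\max_p N p)%N => c Nc a b; rewrite !mxE; apply: (NP (a, b)).
  exact: leq_trans (leq_bigmax (a, b)) Nc.
have ly (j : nat) : powmx j.+1%:Z (l - y j).
  have [N NP] := lP j.+1%:Z; have [b Nb jb] : exists2 b, (N <= b)%N & (j <= b)%N.
    by exists (maxn N j); [exact: leq_maxl | exact: leq_maxr].
  have -> : l - y j = - (y b - l) + (y b - y j) by rewrite opprB addrA subrK.
  by apply: powmxD; [apply/powmxN; exact: NP | exact: yle].
have Kl : Kplus l.
  apply/Kplus_pow; have -> : l - 1%:M = l - y 0%N by rewrite yE mulVmx.
  exact: ly.
pose x := xs 0%N *m l.
have ux : x \in unitmx by rewrite unitmx_mul xu (Kmax_unit Kl.1).
have [j jP] := fj x ux.
have xx : coset_eq j (xs j) x.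
  apply/KcongP; have -> : invmx (xs j) *m x - 1%:M = invmx (y j) *m (l - y j).
    rewrite mulmxBr mulVmx ?(Kmax_unit (yK j).1) //; congr (_ - _).
    have e : xs j = xs 0%N *m y j by rewrite yE mulKVmx.
    apply: (can_inj (mulKmx (xu j))); rewrite mulKVmx // /x e -!mulmxA.
    by rewrite mulKVmx // (Kmax_unit (yK j).1).
  by apply: powmxMl => //; exact: (Kmax_int (KmaxV (yK j).1)).
case: (xsP j) => _ [_]; apply.
rewrite (_ : (fun _ => _) = fun z => f x * cind j (xs j) z + 0).
  by rewrite mu_lin ?mu0 ?addr0 ?mu_ind ?mu_ind0 ?mulr0 //; [exact: Cc_ind | exact: Cc0].
apply/funext => z; rewrite /cind addr0; case: asboolP => [xz|_]; last by rewrite !mulr0.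
congr (_ * _); rewrite -[z](mulKVmx ux) jP //.
by apply: coset_eq_trans xz => //; exact: coset_eq_sym.
Qed.

(** A linear dependence between the values of a decomposition lets one of its
    terms be absorbed into the others, so the integral does not depend on the
    decomposition. *)
Lemma vint_zero (L : lmodType C) l (f : 'I_l -> mat -> C) (y : 'I_l -> L) :
  (forall i, Cc (f i)) -> (forall g, GL g -> \sum_(i < l) f i g *: y i = 0) ->
  \sum_(i < l) mu (f i) *: y i = 0.
Proof.
elim: l f y => [|l IH] f y fC f0; first by rewrite big_ord0.
have [|free] := pselect (exists c : 'I_l.+1 -> C,
    \sum_i c i *: y i = 0 /\ exists i, c i != 0); last first.
  rewrite big1 // => i _; suff -> : f i = fun=> 0 by rewrite mu0 scale0r.
  apply/funext => g; have [ug|nug] := boolP (g \in unitmx); last by case: (fC i) => + _ _; exact.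
  apply: contrapT => /eqP fi; apply: free; exists (f^~ g); split; last by exists i.
  exact: f0.
move=> [c [c0 [i ci]]].
have yi : y i = \sum_(j < l) (- (c i)^-1 * c (lift i j)) *: y (lift i j).
  move: c0; rewrite (bigD1_ord i) //= => /eqP; rewrite addr_eq0 => /eqP e.
  rewrite -[LHS](scalerK ci) e scalerN scaler_sumr -sumrN.
  by apply: eq_bigr => j _; rewrite scalerA mulNr scaleNr.
pose d (j : 'I_l) := - (c i)^-1 * c (lift i j).
have absorb (a : 'I_l.+1 -> C) : \sum_j a j *: y j =
    \sum_(j < l) (d j * a i + a (lift i j)) *: y (lift i j).
  rewrite (bigD1_ord i) //= yi scaler_sumr -big_split; apply: eq_bigr => j _ /=.
  by rewrite scalerDl scalerA [a i * _]mulrC.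
rewrite absorb; under eq_bigr do rewrite -mu_lin //.
by apply: IH => [j|g ug]; [exact: Cc_lin | rewrite -[RHS](f0 g ug) absorb].
Qed.

Lemma vint_eq (L : lmodType C) (h : mat -> L) v : is_vint mu h v -> vint mu h = v.
Proof.
move=> hv; rewrite /vint; case: xgetP => [w _ [l [f [y [fC hf ->]]]]|no]; last by case: (no v).
case: hv => [l' [f' [y' [fC' hf' ->]]]].
apply/eqP; rewrite -subr_eq0 -sumrN; apply/eqP.
pose G (i : 'I_(l + l')) := match fintype.split i with inl i => f i | inr i => f' i end.
pose Y (i : 'I_(l + l')) := match fintype.split i with inl i => y i | inr i => - y' i end.
have E (a : (mat -> C) -> C) : \sum_i a (f i) *: y i + \sum_i - (a (f' i) *: y' i) =
    \sum_i a (G i) *: Y i.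
  rewrite big_split_ord /=; congr (_ + _); apply: eq_bigr => i _; rewrite /G /Y.
    by rewrite (unsplitK (inl _ i)).
  by rewrite (unsplitK (inr _ i)) scalerN.
rewrite E; apply: vint_zero => [i|g ug]; first by rewrite /G; case: (fintype.split i).
by rewrite -(E (fun f => f g)) sumrN -hf // -hf' // subrr.
Qed.

Lemma cind_lft (u : 'M[k]_m) g : u \in unitmx ->
  cind 0 (lft u) g = (`[< Kmax g >] && (mxred g == u))%:R.
Proof.
move=> uu; have Ku := lft_Kmax uu; have ul := Kmax_unit Ku.
congr (nat_of_bool _)%:R; apply/asboolP/andP => [|[/asboolP Kg /eqP e]].
  rewrite /coset_eq -Kplus_cong => Kg; have e := mulKVmx ul g.
  have KK : Kmax g by rewrite -e; apply: KmaxM => //; case: Kg.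
  split; first exact/asboolP.
  rewrite -e mxredM; [|exact: Kmax_int|exact: Kmax_int Kg.1].
  by rewrite lftK Kg.2 mulmx1.
by rewrite /coset_eq -Kplus_cong; apply: Kplus_div; rewrite ?lftK.
Qed.

(** Such an h is constant on the cosets of K_+, which all have the same volume. *)
Lemma vint_fin (L : lmodType C) (h : mat -> L) (h0 : 'M[k]_m -> L) :
  (forall g, GL g -> Kmax g -> h g = h0 (mxred g)) ->
  (forall g, GL g -> ~ Kmax g -> h g = 0) ->
  vint mu h = vol *: \sum_(u : 'M[k]_m | u \in unitmx) h0 u.
Proof.
move=> hK h_0; apply: vint_eq.
pose A := [pred u : 'M[k]_m | u \in unitmx].
exists #|A|, (fun i => cind 0 (lft (enum_val i))), (fun i => h0 (enum_val i)).
have uA (i : 'I_#|A|) : enum_val i \in unitmx by have := enum_valP i; rewrite inE.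
have uL (i : 'I_#|A|) : lft (enum_val i) \in unitmx by exact: Kmax_unit (lft_Kmax (uA i)).
have indE (i : 'I_#|A|) g : cind 0 (lft (enum_val i)) g =
    (`[< Kmax g >] && (mxred g == enum_val i))%:R by exact: cind_lft.
split=> [i|g ug|].
- by apply: Cc_ind; exact: uL.
- under eq_bigr do rewrite indE.
  case: asboolP => [Kg|Kg]; last first.
    by rewrite h_0 // big1 // => i _; rewrite scale0r.
  rewrite hK // /=; transitivity (\sum_(u in A) (mxred g == u)%:R *: h0 u); last first.
    by rewrite big_enum_val.
  rewrite (bigD1 (mxred g)) /= ?inE ?Kmax_red // eqxx scale1r big1 ?addr0 // => u /andP[_ ne].
  by rewrite eq_sym (negPf ne) scale0r.
- rewrite scaler_sumr; transitivity (\sum_(u in A) vol *: h0 u) => //.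
  by rewrite big_enum_val; apply: eq_bigr => i _; rewrite mu_ind.
Qed.
End HaarIntegral.

(** * Block matrices and standard parabolic subgroups *)

Section BlockMatrices.
Variables (K : fieldType) (n r : nat).
Local Notation mat := 'M[K]_(\sum_(i < n) r).
Implicit Types (g h p u : mat) (i j : 'I_n).

Lemma blkM g h i j : blk (g *m h) i j = \sum_l blk g i l *m blk h l j.
Proof.
by rewrite /blk -[g in LHS]submxblockK -[h in LHS]submxblockK mul_mxblock mxblockK.
Qed.

Lemma blk_inj g h : (forall i j, blk g i j = blk h i j) -> g = h.
Proof. by move=> e; apply/mxblockP. Qed.

Lemma blkD g h i j : blk (g + h) i j = blk g i j + blk h i j.
Proof. exact: submxblockD. Qed.

Lemma blkN g i j : blk (- g) i j = - blk g i j.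
Proof. exact: submxblockN. Qed.

Lemma blkE g a b : g a b =
  blk g (tagnat.sig1 a) (tagnat.sig1 b) (tagnat.sig2 a) (tagnat.sig2 b).
Proof. by rewrite mxE !tagnat.sig2K. Qed.

Lemma blk_perm (w : 'S_n) i j : blk (blkperm K r w) i j = (w i == j)%:R%:M.
Proof. exact: mxblockK. Qed.

Lemma blk1 i j : blk (1%:M : mat) i j = (i == j)%:R%:M.
Proof.
apply/matrixP => x y; rewrite !mxE.
rewrite -[_ == _ :> 'I_(\sum_(i < n) r)]val_eqE tagnat.eq_Rank.
by case: (i == j); rewrite /= ?mul0rn.
Qed.

Lemma blkperm1 : blkperm K r (1%g : 'S_n) = 1%:M.
Proof. by apply/blk_inj => i j; rewrite blk_perm blk1 perm1. Qed.

Lemma blkpermV (w : 'S_n) : blkperm K r w^-1%g *m blkperm K r w = 1%:M.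
Proof. by rewrite -blkpermM mulVg blkperm1. Qed.

Lemma blkperm_unit (w : 'S_n) : blkperm K r w \in unitmx.
Proof. by case/mulmx1_unit: (blkpermV w). Qed.

Lemma invmx_blkperm (w : 'S_n) : invmx (blkperm K r w) = blkperm K r w^-1%g.
Proof. by rewrite -[LHS]mul1mx -(blkpermV w) mulmxK ?blkperm_unit. Qed.

Lemma blk_perml (w : 'S_n) g i j : blk (blkperm K r w *m g) i j = blk g (w i) j.
Proof.
rewrite blkM (bigD1 (w i)) //= blk_perm eqxx mul1mx big1 ?addr0 // => l lw.
by rewrite blk_perm eq_sym (negPf lw) raddf0 mul0mx.
Qed.

Lemma blk_permr (w : 'S_n) g i j : blk (g *m blkperm K r w) i j = blk g i (w^-1%g j).
Proof.
rewrite blkM (bigD1 (w^-1%g j)) //= blk_perm permKV eqxx mulmx1 big1 ?addr0 // => l lw.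
rewrite blk_perm (_ : w l == j = false) ?raddf0 ?mulmx0 //.
by apply: contraNF lw => /eqP <-; rewrite permK.
Qed.

Definition bdiag (B : 'I_n -> 'M[K]_r) : mat :=
  \mxblock_(i < n, j < n) (if i == j then B i else 0).

Lemma blk_bdiag B i j : blk (bdiag B) i j = if i == j then B i else 0.
Proof. exact: mxblockK. Qed.

Lemma blk_bdiagl B g i j : blk (bdiag B *m g) i j = B i *m blk g i j.
Proof.
rewrite blkM (bigD1 i) //= blk_bdiag eqxx big1 ?addr0 // => l li.
by rewrite blk_bdiag eq_sym (negPf li) mul0mx.
Qed.

Lemma blk_bdiagr B g i j : blk (g *m bdiag B) i j = blk g i j *m B j.
Proof.
rewrite blkM (bigD1 j) //= blk_bdiag eqxx big1 ?addr0 // => l li.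
by rewrite blk_bdiag (negPf li) mulmx0.
Qed.

Lemma bdiagM B B' : bdiag B *m bdiag B' = bdiag (fun i => B i *m B' i).
Proof.
apply/blk_inj => i j; rewrite blk_bdiagl !blk_bdiag.
by case: eqP => // _; rewrite mulmx0.
Qed.

Lemma bdiag1 : bdiag (fun=> 1%:M) = 1%:M.
Proof. by apply/blk_inj => i j; rewrite blk_bdiag blk1; case: eqP; rewrite ?raddf0. Qed.

Lemma bdiagV B : (forall i, B i \in unitmx) ->
  bdiag B *m bdiag (fun i => invmx (B i)) = 1%:M.
Proof.
move=> uB; rewrite bdiagM -bdiag1; congr bdiag; apply/funext => i.
by rewrite mulmxV.
Qed.

Lemma bdiag_unit B : (forall i, B i \in unitmx) -> bdiag B \in unitmx.
Proof. by move=> /bdiagV/mulmx1_unit[]. Qed.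

Lemma invmx_bdiag B : (forall i, B i \in unitmx) ->
  invmx (bdiag B) = bdiag (fun i => invmx (B i)).
Proof. by move=> uB; rewrite -[RHS](mulKmx (bdiag_unit uB)) bdiagV // mulmx1. Qed.

Lemma bdiag_Levi B : (forall i, B i \in unitmx) -> Levi (bdiag B).
Proof.
move=> uB; split=> [|i j ij]; first exact: bdiag_unit.
by rewrite blk_bdiag (negPf ij).
Qed.

Lemma Levi_bdiag g : Levi g -> g = bdiag (fun i => blk g i i).
Proof.
by move=> [_ g0]; apply/blk_inj => i j; rewrite blk_bdiag; case: eqP => [->|/eqP/g0].
Qed.

Lemma Levi_blk_unit g i : Levi g -> blk g i i \in unitmx.
Proof.
move=> [ug g0].
have : \sum_l blk g i l *m blk (invmx g) l i = 1%:M by rewrite -blkM mulmxV // blk1 eqxx.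
rewrite (bigD1 i) //= [X in _ + X]big1 => [|l li]; first by rewrite addr0 => /mulmx1_unit[].
by rewrite g0 ?mul0mx // eq_sym.
Qed.

Lemma Levi_Parab g : Levi g -> Parab g.
Proof. by move=> [ug g0]; split=> // i j ji; apply: g0; rewrite neq_ltn ji orbT. Qed.

Lemma LeviV g : Levi g -> Levi (invmx g).
Proof.
move=> Lg; have uB i := Levi_blk_unit i Lg; rewrite (Levi_bdiag Lg) invmx_bdiag //.
by apply: bdiag_Levi => i; rewrite unitmx_inv.
Qed.

Lemma upper_blk g : (forall a b : 'I_(\sum_(i < n) r), (b < a)%N -> g a b = 0) ->
  forall i j, (j < i)%N -> blk g i j = 0.
Proof.
move=> g0 i j ji; apply/matrixP => x y; rewrite !mxE; apply: g0.
by rewrite ltnNge; apply: contraL ji => /tagnat.le_sig1; rewrite !tagnat.Rank1K -leqNgt.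
Qed.

Lemma Urad_E u a b : Urad u -> (tagnat.sig1 b <= tagnat.sig1 a)%N -> u a b = (a == b)%:R.
Proof.
move=> [u1 u0] ba; rewrite -[in RHS](tagnat.sig2K a) -[in RHS](tagnat.sig2K b).
rewrite -[_ == _ :> 'I_(\sum_(i < n) r)]val_eqE tagnat.eq_Rank blkE.
move: (tagnat.sig1 a) (tagnat.sig2 a) (tagnat.sig1 b) (tagnat.sig2 b) ba => i x j y.
rewrite leq_eqVlt => /predU1P[/val_inj <-|ji]; first by rewrite u1 mxE eqxx.
by rewrite u0 // mxE -val_eqE [val i == _]gtn_eqF.
Qed.

Lemma Urad_unit u : Urad u -> u \in unitmx.
Proof.
move=> Uu; rewrite unitmxE -det_tr det_trig.
  by rewrite big1 ?unitr1 // => a _; rewrite mxE (Urad_E Uu) ?eqxx.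
apply/is_trig_mxP => a b ab; rewrite mxE (Urad_E Uu); first by rewrite -val_eqE gtn_eqF.
by apply: (@tagnat.le_sig1 n (fun=> r)); exact: ltnW.
Qed.

Lemma Urad_Parab u : Urad u -> Parab u.
Proof. by move=> Uu; split; [exact: Urad_unit | case: Uu]. Qed.

Lemma ParabM p q : Parab p -> Parab q -> Parab (p *m q).
Proof.
move=> [up p0] [uq q0]; split=> [|i j ji]; first by rewrite unitmx_mul up.
rewrite blkM big1 // => l _; have [li|il] := ltnP l i; first by rewrite p0 ?mul0mx.
by rewrite q0 ?mulmx0 //; exact: leq_trans ji il.
Qed.

Lemma Parab_blkM p q i : Parab p -> Parab q -> blk (p *m q) i i = blk p i i *m blk q i i.
Proof.
move=> [_ p0] [_ q0]; rewrite blkM (bigD1 i) //= big1 ?addr0 // => l li.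
have [lt|gt|/val_inj e] := ltngtP l i; first by rewrite p0 ?mul0mx.
  by rewrite q0 ?mulmx0.
by rewrite e eqxx in li.
Qed.

Lemma Parab1 : Parab (1%:M : mat).
Proof.
split=> [|i j ji]; first exact: unitmx1.
by rewrite blk1 -val_eqE gtn_eqF ?raddf0.
Qed.

Lemma Urad1 : Urad (1%:M : mat).
Proof.
split=> [i|i j ji]; first by rewrite blk1 eqxx.
by rewrite blk1 -val_eqE gtn_eqF ?raddf0.
Qed.

Lemma UradM u v : Urad u -> Urad v -> Urad (u *m v).
Proof.
move=> Uu Uv; have Pu := Urad_Parab Uu; have Pv := Urad_Parab Uv; split=> [i|].
  by rewrite Parab_blkM //; case: Uu Uv => -> _ [-> _]; rewrite mulmx1.
by case: (ParabM Pu Pv).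
Qed.

Lemma Parab_LU p : (forall i j, (j < i)%N -> blk p i j = 0) ->
  (forall i, blk p i i \in unitmx) ->
  let m := bdiag (fun i => blk p i i) in
  [/\ Levi m, Urad (invmx m *m p) & p = m *m (invmx m *m p)].
Proof.
move=> p0 up m; have Lm : Levi m by exact: bdiag_Levi.
have um : m \in unitmx by case: Lm.
split=> //; last by rewrite mulKVmx.
rewrite invmx_bdiag //; split=> [i|i j ji]; rewrite blk_bdiagl ?mulVmx //.
by rewrite (p0 i j) ?mulmx0.
Qed.

Hypothesis r_gt0 : (0 < r)%N.

Lemma Parab_blkperm_le p q (v w : 'S_n) i : Parab p -> (forall i, blk p i i != 0) ->
  Parab q -> p *m blkperm K r v = blkperm K r w *m q -> (w i <= v i)%N.
Proof.
move=> Pp pu [_ q0] e; rewrite leqNgt; apply/negP => lt.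
have := congr1 (fun g => blk g i (v i)) e; rewrite /= blk_permr blk_perml permK.
by rewrite q0 // => /eqP; rewrite (negPf (pu i)).
Qed.

Lemma perm_le_eq (v w : 'S_n) : (forall i, (w i <= v i)%N) -> w = v.
Proof.
move=> le; have s : (\sum_i w i = \sum_i v i)%N.
  rewrite -(reindex_inj (P := predT) (F := fun i : 'I_n => i : nat) (@perm_inj _ w)).
  by rewrite -(reindex_inj (P := predT) (F := fun i : 'I_n => i : nat) (@perm_inj _ v)).
apply/permP => i; apply/val_inj/eqP; rewrite eqn_leq le /=.
have := leqnn (\sum_i v i)%N; rewrite -{2}s (bigD1 i) //= [in leqRHS](bigD1 i) //=.
apply: contraTT; rewrite -!ltnNge => lt.
by rewrite -addSn leq_add // leq_sum.
Qed.
End BlockMatrices.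

Section FiniteParabolic.
Variables (k : finFieldType) (n r : nat).
Local Notation mat := 'M[k]_(\sum_(i < n) r).
Implicit Types (p q g u : mat).

(** Left multiplication by p maps the finite set of block upper triangular
    matrices injectively, hence bijectively, to itself. *)
Lemma ParabV p : Parab p -> Parab (invmx p).
Proof.
move=> Pp; have [up _] := Pp.
pose A := [set q : mat | `[< Parab q >]]%SET.
have sub : [set p *m q | q in A]%SET \subset A.
  apply/fintype.subsetP => _ /imsetP[q + ->]; rewrite !finset.in_set => /asboolP Pq.
  by apply/asboolP; exact: ParabM.
have inj : injective (mulmx p : mat -> mat) by exact: can_inj (mulKmx up).
have /eqP eA : [set p *m q | q in A]%SET == A.
  by rewrite eqEcard sub (card_imset _ inj) leqnn.
have : 1%:M \in A by rewrite finset.in_set; apply/asboolP; exact: Parab1.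
rewrite -eA => /imsetP[q]; rewrite finset.in_set => /asboolP Pq e.
by rewrite -[invmx p]mulmx1 e mulKmx.
Qed.

Lemma Parab_blk_unit p i : Parab p -> blk p i i \in unitmx.
Proof.
move=> Pp; have := Parab_blkM i Pp (ParabV Pp).
by rewrite mulmxV; [rewrite blk1 eqxx => /esym/mulmx1_unit[] | case: Pp].
Qed.

Lemma UradV u : Urad u -> Urad (invmx u).
Proof.
move=> Uu; have Pu := Urad_Parab Uu; have PV := ParabV Pu; split; last by case: PV.
move=> i; have := Parab_blkM i Pu PV; rewrite mulmxV ?Urad_unit // blk1 eqxx.
by case: Uu => -> _; rewrite mul1mx.
Qed.

Lemma Levi_conjU m u : Levi m -> Urad u -> Urad (m *m u *m invmx m).
Proof.
move=> Lm [u1 u0]; have uB i := Levi_blk_unit i Lm.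
rewrite (Levi_bdiag Lm) invmx_bdiag //; split=> [i|i j ji]; rewrite blk_bdiagr blk_bdiagl.
  by rewrite u1 mulmx1 mulmxV.
by rewrite u0 // mulmx0 mul0mx.
Qed.

Lemma Parab_fact p : Parab p -> exists m u, [/\ Levi m, Urad u & p = m *m u].
Proof.
move=> Pp; have [] := @Parab_LU k n r p; first by case: Pp.
  by move=> i; exact: Parab_blk_unit.
by move=> Lm Uu e; eexists; eexists; split; eassumption.
Qed.

(** Comparing, in p v = w q, the blocks in position (i, v i) gives w i <= v i for
    all i, and such permutations are equal. *)
Lemma Bruhat_disjoint p q (v w : 'S_n) : (0 < r)%N -> Parab p -> Parab q ->
  p *m blkperm k r v = blkperm k r w *m q -> v = w.
Proof.
move=> r0 Pp Pq e; apply/esym/perm_le_eq => i; apply: Parab_blkperm_le e => //.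
move=> j; apply/eqP => p0; have := Parab_blk_unit j Pp.
rewrite p0; case: (r) r0 => // r' _.
by rewrite unitmxE det0 unitr0.
Qed.
End FiniteParabolic.

Section Iwahori.
Variables (F : localField) (n r : nat).
Local Notation k := (lf_res F).
Local Notation mat := 'M[F]_(\sum_(i < n) r).
Implicit Types (g h : mat).

Lemma blk_red g i j : blk (mxred g) i j = mxred (blk g i j).
Proof. by apply/matrixP => a b; rewrite !mxE. Qed.

Lemma lft_blk (y : 'M[k]_(\sum_(i < n) r)) i j : blk (lft y) i j = lft (blk y i j).
Proof. by apply/matrixP => a b; rewrite !mxE. Qed.

Lemma lft0 m : lft (0 : 'M[k]_m) = 0.
Proof. by apply/matrixP => a b; rewrite !mxE lift1_0. Qed.

Lemma lft1 m : lft (1%:M : 'M[k]_m) = 1%:M.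
Proof. by apply/matrixP => a b; rewrite !mxE; case: eqP; rewrite ?lift1_0 ?lift1_1. Qed.

Lemma mxred0 m : mxred (0 : 'M[F]_m) = 0.
Proof. by apply/matrixP => a b; rewrite !mxE red0. Qed.

Lemma blk_int g i j : intmx g -> intmx (blk g i j).
Proof. by move=> ig a b; rewrite mxE. Qed.

Lemma int_blk g : (forall i j, intmx (blk g i j)) -> intmx g.
Proof. by move=> ig a b; rewrite blkE; exact: ig. Qed.

Lemma red_bdiag B : mxred (bdiag B : mat) = bdiag (fun i => mxred (B i)).
Proof.
by apply/blk_inj => i j; rewrite blk_red !blk_bdiag; case: eqP => // _; rewrite mxred0.
Qed.

Lemma bdiag_Kmax (B : 'I_n -> 'M[F]_r) : (forall i, Kmax (B i)) -> Kmax (bdiag B).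
Proof.
move=> KB; apply/KmaxP; split.
  apply: int_blk => i j; rewrite blk_bdiag; case: eqP => _; first exact: Kmax_int.
  by move=> a b; rewrite mxE in_pow0.
by rewrite red_bdiag; apply: bdiag_unit => i; exact: Kmax_red.
Qed.

Lemma red_Levi g : Levi g -> Kmax g -> Levi (mxred g).
Proof.
move=> [_ g0] Kg; split=> [|i j ij]; first exact: Kmax_red.
by rewrite blk_red g0 // mxred0.
Qed.

Lemma red_Urad g : Urad g -> Urad (mxred g).
Proof.
move=> [g1 g0]; split=> [i|i j ij]; rewrite blk_red ?g1 ?mxred1 //.
by rewrite g0 // mxred0.
Qed.

Lemma lft_Levi (y : 'M[k]_(\sum_(i < n) r)) : Levi y -> Levi (lft y).
Proof.
move=> [uy y0]; split=> [|i j ij]; first exact: Kmax_unit (lft_Kmax uy).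
by rewrite lft_blk y0 // lft0.
Qed.

Lemma lft_Urad (y : 'M[k]_(\sum_(i < n) r)) : Urad y -> Urad (lft y).
Proof.
move=> [y1 y0]; split=> [i|i j ij]; rewrite lft_blk ?y1 ?lft1 //.
by rewrite y0 // lft0.
Qed.

Lemma red_blkperm (w : 'S_n) : mxred (blkperm F r w) = blkperm k r w.
Proof.
apply/blk_inj => i j; rewrite blk_red !blk_perm.
by case: eqP => _; rewrite ?mxred1 // !raddf0 mxred0.
Qed.

Lemma Kmax_blkperm (w : 'S_n) : Kmax (blkperm F r w).
Proof.
apply/KmaxP; rewrite red_blkperm blkperm_unit; split=> //.
apply: int_blk => i j; rewrite blk_perm => a b; rewrite mxE.
by case: (w i == j); case: (a == b); rewrite ?mulr0n ?mulr1n ?in_pow0 ?int_pow1.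
Qed.

(** When the columns below the diagonal blocks vanish mod p, they can be cleared
    one after the other by elements of U^- congruent to 1. *)
Lemma JgrpP g : Jgrp g <-> Kmax g /\ Parab (mxred g).
Proof.
split=> [[a [m [u [[Ua Ka] [Lm Km] [Uu Ku] ->]]]]|[Kg Pg]].
  have Kam : Kmax (a *m m) by apply: KmaxM => //; case: Ka.
  split; first exact: KmaxM.
  rewrite mxredM ?mxredM; try exact: Kmax_int; last by case: Ka => /Kmax_int.
  case: Ka => _ ->; rewrite mul1mx; apply: ParabM.
    by apply/Levi_Parab/red_Levi.
  exact/Urad_Parab/red_Urad.
have clear (t : nat) : (t <= n)%N -> exists a h, [/\ Uopp a /\ Kplus a,
    Kmax h, Parab (mxred h), g = a *m h
    & forall i j : 'I_n, (j < i)%N -> (j < t)%N -> blk h i j = 0].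
  elim: t => [_|t IH lt].
    exists 1%:M, g; split=> //; last by rewrite mul1mx.
    split; last exact: Kplus1.
    split=> [i|i j ij]; first by rewrite blk1 eqxx.
    by rewrite blk1 -val_eqE ltn_eqF ?raddf0.
  have [a [h [[Ua Ka] Kh Ph gE h0]]] := IH (ltnW lt).
  pose t' : 'I_n := Ordinal lt; pose D := blk h t' t'.
  have KD : Kmax D.
    apply/KmaxP; split; first exact/blk_int/Kmax_int.
    by rewrite -blk_red; exact: Parab_blk_unit.
  pose X (i : 'I_n) := if (t < i)%N then blk h i t' *m invmx D else 0.
  pose Z : mat := \mxblock_(i < n, j < n) (if j == t' then X i else 0).
  have ZE i j : blk Z i j = if j == t' then X i else 0 by exact: mxblockK.
  have iX i : intmx (X i).
    rewrite /X; case: ifP => _; last by move=> a0 b0; rewrite mxE in_pow0.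
    apply: intmxM; first exact/blk_int/Kmax_int.
    exact/Kmax_int/KmaxV.
  have iZ : intmx Z.
    apply: int_blk => i j; rewrite ZE; case: ifP => // _ a0 b0.
    by rewrite mxE in_pow0.
  have rZ : mxred Z = 0.
    apply/blk_inj => i j; rewrite blk_red ZE [in RHS]/blk submxblock0.
    case: eqP => _; last by rewrite mxred0.
    rewrite /X; case: ifP => [ti|_]; last by rewrite mxred0.
    rewrite mxredM; [|exact/blk_int/Kmax_int|exact/Kmax_int/KmaxV].
    by rewrite -blk_red; case: Ph => _ ->; rewrite ?mul0mx.
  have blkZ g' i j : blk (Z *m g') i j = X i *m blk g' t' j.
    rewrite blkM (bigD1 t') //= ZE eqxx big1 ?addr0 // => l lt'.
    by rewrite ZE (negPf lt') mul0mx.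
  have ZZ : Z *m Z = 0.
    apply/blk_inj => i j; rewrite blkZ ZE {2}/X /= ltnn [RHS]submxblock0.
    by case: ifP; rewrite mulmx0.
  have K1 : Kplus (1%:M + Z).
    apply/KplusP; split; first by apply: intmxD => //; exact: intmx1.
    by rewrite mxredD ?rZ ?addr0 ?mxred1 //; exact: intmx1.
  have K2 : Kplus (1%:M - Z).
    apply/KplusP; split; first by apply: intmxB => //; exact: intmx1.
    by rewrite mxredD ?mxredN ?rZ ?subr0 ?mxred1 //; [exact: intmx1 | exact: intmxN].
  have bZ0 (i j : 'I_n) : (i <= j)%N -> blk Z i j = 0.
    move=> ij; rewrite ZE; case: eqP => // jt; rewrite /X.
    by rewrite jt /= in ij; rewrite ltnNge ij.
  exists (a *m (1%:M + Z)), ((1%:M - Z) *m h); split.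
  - split; last exact: KplusM.
    have [a1 a0] := Ua; rewrite mulmxDr mulmx1.
    have E (i j : 'I_n) : (i <= j)%N -> blk (a *m Z) i j = 0.
      move=> ij; rewrite blkM big1 // => l _.
      have [il|li] := ltnP i l; first by rewrite a0 ?mul0mx.
      by rewrite bZ0 ?mulmx0 //; exact: leq_trans ij.
    split=> [i|i j ij]; first by rewrite blkD E ?addr0.
    by rewrite blkD E ?addr0 ?a0 // ltnW.
  - by apply: KmaxM => //; case: K2.
  - rewrite mxredM; [|by case: K2 => /Kmax_int|exact: Kmax_int].
    by case: K2 => _ ->; rewrite mul1mx.
  - rewrite gE -mulmxA; congr (_ *m _); rewrite mulmxA mulmxDl !mulmxBr !mulmx1 ZZ.
    by rewrite mul1mx subr0 subrK mul1mx.
  - move=> i j ji; rewrite mulmxBl mul1mx blkD blkN blkZ.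
    rewrite ltnS leq_eqVlt => /predU1P[jt|jt].
      have -> : j = t' by exact: val_inj.
      by rewrite /X -jt ji mulmxKV ?subrr // (Kmax_unit KD).
    by rewrite h0 // h0 // mulmx0 subr0.
have [a [h [[Ua Ka] Kh Ph gE h0]]] := clear n (leqnn n).
have KB i : Kmax (blk h i i).
  apply/KmaxP; split; first exact/blk_int/Kmax_int.
  by rewrite -blk_red; exact: Parab_blk_unit.
have Km := bdiag_Kmax KB.
have [||Lm Uu hE] := @Parab_LU F n r h.
- by move=> i j ji; apply: h0.
- by move=> i; exact: Kmax_unit (KB i).
exists a, (bdiag (fun i => blk h i i)), (invmx (bdiag (fun i => blk h i i)) *m h).
split=> //; last by rewrite -mulmxA -hE.
by split=> //; apply: KmaxM => //; exact: KmaxV.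
Qed.
End Iwahori.

(** * Bruhat and Iwasawa decompositions *)

Section Bruhat.
Variables (K : fieldType) (m : nat).
Implicit Types (g h p q : 'M[K]_m).

Definition upper p := (forall a b : 'I_m, (b < a)%N -> p a b = 0) /\ forall a, p a a != 0.

Lemma upper_unit p : upper p -> p \in unitmx.
Proof.
move=> [p0 p1]; rewrite unitmxE -det_tr det_trig.
  by rewrite unitfE; apply/prodf_neq0 => a _; rewrite mxE.
by apply/is_trig_mxP => a b ab; rewrite mxE p0.
Qed.

Lemma upper1 : upper (1%:M : 'M[K]_m).
Proof.
split=> [a b ba|a]; last by rewrite mxE eqxx oner_neq0.
by rewrite mxE -val_eqE gtn_eqF.
Qed.

Lemma upperM p q : upper p -> upper q -> upper (p *m q).
Proof.
move=> [p0 p1] [q0 q1]; split=> [a b ba|a].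
  rewrite mxE big1 // => c _; have [ca|ac] := ltnP c a; first by rewrite p0 ?mul0r.
  by rewrite q0 ?mulr0 //; exact: leq_trans ac.
rewrite mxE (bigD1 a) //= big1 ?addr0 ?mulf_neq0 // => c ca.
have [lt|gt|/val_inj e] := ltngtP c a; first by rewrite p0 ?mul0r.
  by rewrite q0 ?mulr0.
by rewrite e eqxx in ca.
Qed.

Lemma unit_col_neq0 g (t : 'I_m) : g \in unitmx -> exists i, g i t != 0.
Proof.
move=> ug; apply: contrapT => no; have : col t g = 0.
  apply/colP => i; rewrite !mxE; apply: contrapT => /eqP gi; apply: no.
  by exists i.
rewrite colE => /(congr1 (mulmx (invmx g))); rewrite mulKmx // mulmx0.
by move=> /colP/(_ t); rewrite !mxE eqxx /= => /eqP; rewrite oner_eq0.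
Qed.

(** Bruhat decomposition: columns are cleared from left to right, the pivot
    being the lowest nonzero entry of the column. *)
Lemma Bruhat g : g \in unitmx -> exists p q (w : 'S_m),
  [/\ upper p, upper q & p *m g *m q = perm_mx w].
Proof.
move=> ug.
have elim (t : nat) : (t <= m)%N -> exists p q, [/\ upper p, upper q &
    forall j : 'I_m, (j < t)%N -> exists i,
      (forall a, (p *m g *m q) a j = (a == i)%:R) /\
      (forall b, (p *m g *m q) i b = (b == j)%:R)].
  elim: t => [_|t IH lt]; first by exists 1%:M, 1%:M; split=> //; exact: upper1.
  have [p [q [Up Uq pq]]] := IH (ltnW lt).
  have [h hE] : exists h, p *m g *m q = h by eexists.
  rewrite hE in pq.
  have uh : h \in unitmx by rewrite -hE !unitmx_mul ug (upper_unit Up) (upper_unit Uq).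
  pose t' : 'I_m := Ordinal lt.
  have [i0 hi0] := unit_col_neq0 t' uh.
  have [i hi imax] := @arg_maxnP _ i0 (fun i => h i t' != 0) (@nat_of_ord m) hi0.
  have below (a : 'I_m) : (i < a)%N -> h a t' = 0.
    by move=> ia; apply: contraTeq ia => /imax; rewrite -leqNgt.
  have left0 (j : 'I_m) : (j < t)%N -> h i j = 0.
    move=> jt; have [s [sc sr]] := pq j jt; rewrite sc.
    case: eqP => // e; move: hi; rewrite e sr -val_eqE /= gtn_eqF // eqxx //.
  pose c := h i t'.
  (* L scales the pivot to 1 and clears the column above it; Rm clears the rest
     of the row of the pivot. *)
  pose L : 'M[K]_m := \matrix_(a, b) if b == i then (if a == i then c^-1 else - h a t' / c)
                                  else (a == b)%:R.
  pose Rm : 'M[K]_m := \matrix_(a, b) ((a == b)%:R - ((a == t') && (b != t'))%:R * (h i b / c)).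
  have UL : upper L.
    split=> [a b ba|a]; rewrite mxE.
      case: (b =P i) ba => [-> ia|_ ba]; last by rewrite -val_eqE gtn_eqF.
      by rewrite -val_eqE gtn_eqF // below // oppr0 mul0r.
    case: (a =P i) => _ /=; first by rewrite invr_eq0.
    by rewrite eqxx oner_neq0.
  have UR : upper Rm.
    split=> [a b ba|a]; rewrite mxE.
      rewrite -val_eqE gtn_eqF // sub0r; case: (a =P t') => [at'|_]; last by rewrite mul0r oppr0.
      by rewrite left0 ?mul0r ?mulr0 ?oppr0 // -[t]/(val t') -at'.
    rewrite eqxx; case: (a =P t') => [->|_]; last by rewrite mul0r subr0 oner_neq0.
    by rewrite /= mul0r subr0 oner_neq0.
  have LhE a b : (L *m h) a b = if a == i then h i b / c else h a b - h a t' / c * h i b.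
    rewrite mxE (bigD1 i) //= mxE eqxx; case: eqP => [->|/eqP ai].
      rewrite big1 ?addr0 1?mulrC // => l li; rewrite mxE (negPf li) eq_sym (negPf li).
      by rewrite mul0r.
    rewrite (bigD1 a) //= mxE (negPf ai) eqxx mul1r big1 ?addr0.
      by rewrite addrC mulNr mulNr.
    by move=> l /andP[li la]; rewrite mxE (negPf li) eq_sym (negPf la) mul0r.
  have colt a : (L *m h) a t' = (a == i)%:R.
    rewrite LhE; case: eqP => [_|_]; first by rewrite mulfV.
    by rewrite mulfVK ?subrr.
  have hE' a b : (L *m h *m Rm) a b =
      if a == i then (b == t')%:R else h a b - h a t' / c * h i b.
    rewrite mxE; under eq_bigr do rewrite [Rm _ _]mxE mulrBr.
    rewrite sumrB (bigD1 b) //= eqxx mulr1 big1 ?addr0; last first.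
      by move=> l lb; rewrite (negPf lb) mulr0.
    have -> : \sum_l (L *m h) a l * (((l == t') && (b != t'))%:R * (h i b / c)) =
        (a == i)%:R * ((b != t')%:R * (h i b / c)).
      rewrite (bigD1 t') //= eqxx colt big1 ?addr0 // => l lt'.
      by rewrite (negPf lt') mul0r mulr0.
    rewrite LhE; case: (a =P i) => [_|_]; last by rewrite mul0r subr0.
    rewrite mul1r; case: (b =P t') => [->|_]; last by rewrite mul1r subrr.
    by rewrite mul0r subr0 mulfV.
  exists (L *m p), (q *m Rm); split; [exact: upperM | exact: upperM |].
  have -> : L *m p *m g *m (q *m Rm) = L *m h *m Rm by rewrite -hE !mulmxA.
  move=> j; rewrite ltnS leq_eqVlt => /predU1P[jt|jt].
    have {j jt} -> : j = t' by exact: val_inj.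
    exists i; split=> [a|b]; rewrite hE' ?eqxx //.
    by case: eqP => // _; rewrite mulfVK // subrr.
  have [s [sc sr]] := pq j jt.
  have si : s == i = false.
    by apply/eqP => e; move: hi; rewrite -e sr -val_eqE /= gtn_eqF // eqxx.
  exists s; split=> [a|b]; rewrite hE'.
    rewrite left0 // mulr0 subr0 sc; case: eqP => // ->.
    by rewrite [i == s]eq_sym si -val_eqE ltn_eqF.
  by rewrite si !sr -[t' == j]val_eqE /= gtn_eqF // mul0r mul0r subr0.
have [p [q [Up Uq pq]]] := elim m (leqnn m).
have [s sP] := choice (fun j : 'I_m => pq j (ltn_ord j)).
have s_inj : injective s.
  move=> j j' e; have [_ r1] := sP j; have [_ r2] := sP j'.
  by have := r1 j; rewrite e r2 eqxx; case: eqP => // _ /eqP; rewrite eq_sym oner_eq0.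
exists p, q, (perm s_inj)^-1%g; split=> //; apply/matrixP => a b.
have [-> _] := sP b; rewrite !mxE; congr (nat_of_bool _)%:R.
by rewrite -[in RHS](inj_eq (@perm_inj _ (perm s_inj))) permKV permE.
Qed.
End Bruhat.

Section Iwasawa.
Variables (F : localField).
Local Notation k := (lf_res F).

Lemma unipotent_Kmax m (Z : 'M[F]_m) : intmx Z -> Z *m Z = 0 -> Kmax (1%:M - Z).
Proof.
move=> iZ ZZ; have i1 : intmx (1%:M : 'M[F]_m) by exact: intmx1.
apply/KmaxP; split; first exact: intmxB.
have : mxred (1%:M - Z) *m mxred (1%:M + Z) = 1%:M.
  rewrite -mxredM; [|exact: intmxB|exact: intmxD].
  by rewrite mulmxBl !mulmxDr !mulmx1 !mul1mx ZZ addr0 addrK mxred1.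
by case/mulmx1_unit.
Qed.

Lemma perm_Kmax m (w : 'S_m) : Kmax (perm_mx w : 'M[F]_m).
Proof.
apply/KmaxP; split; first by move=> a b; rewrite !mxE; exact: int_nat.
rewrite (_ : mxred _ = perm_mx w) ?unitmx_perm //.
by apply/matrixP => a b; rewrite !mxE; case: eqP; rewrite ?lf_red1 ?red0.
Qed.

Lemma div_int (x y : F) : y != 0 -> (x != 0 -> lf_val y <= lf_val x) -> in_pow 0 (x / y).
Proof.
move=> y0; have [-> _|x0 /(_ isT) xy] := eqVneq x 0; first by rewrite mul0r in_pow0.
rewrite /in_pow mulf_eq0 invr_eq0 (negPf x0) (negPf y0) /=.
have := lf_valM y0 (mulf_neq0 x0 (invr_neq0 y0)); rewrite mulrC mulfVK // => e.
by rewrite -(lerD2l (lf_val y)) -e addr0.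
Qed.

(** Iwasawa decomposition: rows are cleared from the bottom up, the pivot being
    an entry of least valuation, so that the column operations are integral. *)
Lemma Iwasawa m (g : 'M[F]_m) : exists2 x, Kmax x &
  forall a b : 'I_m, (b < a)%N -> (g *m x) a b = 0.
Proof.
have elim (t : nat) : (t <= m)%N -> exists2 x, Kmax x &
    forall a b : 'I_m, (m - t <= a)%N -> (b < a)%N -> (g *m x) a b = 0.
  elim: t => [_|t IH lt].
    exists 1%:M; first exact: Kmax1.
    by move=> a b; rewrite subn0 leqNgt ltn_ord.
  have [x Kx x0] := IH (ltnW lt); have [h hE] : exists h, g *m x = h by eexists.
  rewrite hE in x0; have h0 := x0.
  have im : (m - t.+1 < m)%N by rewrite ltn_subrL (leq_trans _ lt).
  pose i : 'I_m := Ordinal im.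
  have it : i.+1 = (m - t)%N by rewrite /= subnSK.
  have row (a : 'I_m) : (m - t.+1 <= a)%N -> a = i \/ (m - t <= a)%N.
    by rewrite leq_eqVlt -it => /predU1P[e|]; [left; exact: val_inj | right].
  have [all0|/existsNP[b0 /not_implyP[b0i hb0]]] :=
      pselect (forall b : 'I_m, (b <= i)%N -> h i b = 0).
    exists x => // a b; rewrite hE => /row[-> bi|ta ba]; last exact: h0.
    by apply: all0; exact: ltnW.
  pose P (b : 'I_m) := (b <= i)%N && (h i b != 0).
  have Pb0 : P b0 by rewrite /P b0i; apply/eqP.
  have [b1 /andP[b1i hb1] b1min] := @Order.TotalTheory.arg_minP _ _ _ b0 P (fun b => lf_val (h i b)) Pb0.
  pose w := tperm b1 i; have [h1 h1D] : exists h1, h1 = h *m perm_mx w by eexists.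
  have h1E a b : h1 a b = h a (w b).
    have hw : perm_mx w = perm_mx w^-1%g :> 'M[F]_m by rewrite tpermV.
    by rewrite h1D hw -col_permE mxE.
  have ii : h1 i i = h i b1 by rewrite h1E tpermR.
  pose Z : 'M[F]_m := \matrix_(a, b) (((a == i) && (b < i)%N)%:R * (h1 i b / h1 i i)).
  have wle (b : 'I_m) : (b < i)%N -> (w b <= i)%N.
    move=> bi; rewrite /w; case: tpermP => [_|_|_ _] //; exact: ltnW.
  have iZ : intmx Z.
    move=> a b; rewrite mxE; case: (boolP (_ && _)) => [/andP[_ bi]|_]; last by rewrite mul0r in_pow0.
    rewrite mul1r ii; apply: div_int => // hw; rewrite h1E; apply: b1min.
    by rewrite /P wle // -h1E.
  have ZZ : Z *m Z = 0.
    apply/matrixP => a b; rewrite !mxE big1 // => c _; rewrite !mxE.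
    case: (c =P i) => [->|_]; last by rewrite mul0r mulr0.
    by rewrite ltnn andbF mul0r mul0r.
  exists (x *m perm_mx w *m (1%:M - Z)).
    apply: KmaxM; last exact: unipotent_Kmax.
    by apply: KmaxM => //; exact: perm_Kmax.
  have -> : g *m (x *m perm_mx w *m (1%:M - Z)) = h1 *m (1%:M - Z) by rewrite h1D -hE !mulmxA.
  have res a b : (h1 *m (1%:M - Z)) a b = h1 a b - h1 a i * ((b < i)%N%:R * (h1 i b / h1 i i)).
    rewrite mulmxBr mulmx1 mxE [X in _ + X]mxE; congr (_ - _).
    rewrite mxE (bigD1 i) //= big1 ?addr0; first by rewrite mxE eqxx.
    by move=> c ci; rewrite mxE (negPf ci) mul0r mulr0.
  move=> a b /row[-> bi|ta ba]; rewrite res.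
    by rewrite bi mul1r mulrC mulfVK ?subrr // ii.
  have ia : (i < a)%N by rewrite it.
  rewrite [h1 a i]h1E tpermR h0 ?mul0r ?subr0 //; last exact: leq_ltn_trans b1i ia.
  rewrite h1E h0 // /w; case: tpermP => // _.
  exact: leq_ltn_trans b1i ia.
have [x Kx x0] := elim m (leqnn m); exists x => // a b; apply: x0.
by rewrite subnn.
Qed.

Lemma Iwasawa_block n r (g : 'M[F]_(\sum_(i < n) r)) : g \in unitmx ->
  exists m u x, [/\ Levi m, Urad u, Kmax x & g = m *m u *m x].
Proof.
move=> ug; have [x Kx p0] := Iwasawa g; have ux := Kmax_unit Kx.
pose p := g *m x; have up : p \in unitmx by rewrite unitmx_mul ug.
have diag a : p a a != 0.
  move: up; rewrite unitmxE -det_tr det_trig ?unitfE.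
    by move=> /prodf_neq0/(_ a isT); rewrite mxE.
  by apply/is_trig_mxP => c b cb; rewrite mxE p0.
have [|i|Lm Uu pE] := @Parab_LU F n r p.
- exact: upper_blk.
- apply: upper_unit; split=> [a b ba|a]; rewrite mxE ?diag // p0 //.
  by have := @tagnat.lt_Rank n (fun=> r) i b a; rewrite ltEord /= => ->.
exists (bdiag (fun i => blk p i i)), (invmx (bdiag (fun i => blk p i i)) *m p), (invmx x).
by split=> //; [exact: KmaxV | rewrite -pE /p mulmxK].
Qed.

(** A matrix outside F^* K has, after scaling, a reduction of intermediate rank
    rho.  Up to K on both sides it commutes with the projector E onto the first
    rho coordinates, which makes it contract the unipotent radical of the
    corresponding maximal parabolic into K_+. *)
Lemma noncentral_contracts r (g : 'M[F]_r) : (0 < r)%N -> g \in unitmx -> ~ FKmax g ->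
  exists rho x y, [/\ (0 < rho < r)%N, Kmax x, Kmax y &
    forall v : 'M[k]_r, unip_rad (pred1 rho) v -> exists2 u, Kmax u /\ mxred u = v &
      Kplus (invmx (x *m g *m y) *m u *m (x *m g *m y))].
Proof.
move=> r0 ug ncg.
have [i hi] := unit_col_neq0 (Ordinal r0) ug.
have [[a b] /= zab zmin] := @Order.TotalTheory.arg_minP _ _ _ (i, Ordinal r0)
  (fun p => g p.1 p.2 != 0) (fun p => lf_val (g p.1 p.2)) hi.
pose z := g a b; pose g0 := z^-1 *: g.
have ig0 : intmx g0.
  by move=> c e; rewrite mxE mulrC; apply: div_int => // ce; exact: (zmin (c, e)).
pose A := mxred g0; pose rho := \rank A.
have A0 : A != 0.
  apply/eqP => /matrixP/(_ a b); rewrite !mxE mulVf // lf_red1.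
  by apply/eqP; exact: oner_neq0.
have rlt : (rho < r)%N.
  rewrite ltn_neqAle rank_leq_row andbT; apply/eqP => rk; apply: ncg.
  exists z, g0; split=> //; last by rewrite scalerA mulfV // scale1r.
  by apply/KmaxP; split=> //; rewrite -row_free_unit /row_free -/rho rk eqxx.
(* Lifting a rank decomposition of A makes the reduction of g1 equal to E. *)
pose x := invmx (lft (col_ebase A)); pose y := invmx (lft (row_ebase A)).
have Kx : Kmax x by apply/KmaxV/lft_Kmax; exact: col_ebase_unit.
have Ky : Kmax y by apply/KmaxV/lft_Kmax; exact: row_ebase_unit.
have [g1 g1E] : exists g1, g1 = x *m g0 *m y by eexists.
have ig1 : intmx g1 by rewrite g1E; apply: intmxM; [apply: intmxM => //|]; exact: Kmax_int.
have rg1 : mxred g1 = pid_mx rho.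
  rewrite g1E mxredM ?mxredM //; try exact: Kmax_int; last by apply: intmxM => //; exact: Kmax_int.
  rewrite !mxredV ?lftK; try by apply: lft_Kmax; rewrite ?col_ebase_unit ?row_ebase_unit.
  rewrite -[mxred g0]/A -{2}(mulmx_ebase A) -!mulmxA mulKmx ?col_ebase_unit //.
  by rewrite mulmxV ?row_ebase_unit // mulmx1.
pose E : 'M[F]_r := pid_mx rho.
have [E' E'D] : exists E', E' = 1%:M - E by eexists.
have redE : mxred E = pid_mx rho.
  by apply/matrixP => c e; rewrite !mxE; case: (_ && _); rewrite ?lf_red1 ?red0.
have iE : intmx E by move=> c e; rewrite mxE; exact: int_nat.
have i1 : intmx (1%:M : 'M[F]_r) by exact: intmx1.
have iE' : intmx E' by rewrite E'D; exact: intmxB.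
have EE : E *m E = E by rewrite pid_mx_id // ltnW.
have ek : (pid_mx rho : 'M[k]_r) *m (pid_mx rho : 'M[k]_r) = pid_mx rho.
  by apply: pid_mx_id; exact: ltnW.
have EE' : E *m E' = 0 by rewrite E'D mulmxBr mulmx1 EE subrr.
have E'E : E' *m E = 0 by rewrite E'D mulmxBl mul1mx EE subrr.
have redE' : mxred E' = 1%:M - pid_mx rho.
  by rewrite E'D mxredD ?mxredN ?mxred1 ?redE //; exact: intmxN.
have E1 : E + E' = 1%:M by rewrite E'D addrC subrK.
(* B agrees with g1 on the first block, where both reduce to the identity. The
   matrices l and rr carry out the block elimination with pivot B that makes g2
   block diagonal with first block 1, so that E commutes with it. *)
pose B := E *m g1 *m E + E'.
have iEg : intmx (E *m g1) by exact: intmxM.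
have iEgE : intmx (E *m g1 *m E) by exact: intmxM.
have KB : Kplus B.
  apply/KplusP; split; first exact: intmxD.
  by rewrite mxredD // !mxredM // rg1 redE redE' !ek addrC subrK.
have uB := Kmax_unit KB.1.
have iBV : intmx (invmx B) by exact: Kmax_int (KmaxV KB.1).
have BE : B *m E = E *m g1 *m E by rewrite mulmxDl E'E addr0 -mulmxA EE.
have EB : E *m B = E *m g1 *m E by rewrite mulmxDr EE' addr0 !mulmxA EE.
have E'B : E' *m B = E' by rewrite mulmxDr !mulmxA E'E !mul0mx add0r {2}E'D mulmxBr mulmx1 E'E subr0.
have E'V : E' *m invmx B = E' by rewrite -{1}E'B mulmxK.
have EV : E *m invmx B = invmx B *m E.
  by rewrite -[LHS](mulKmx uB) [B *m (_ *m _)]mulmxA BE -EB mulmxK.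
pose l := 1%:M - E' *m g1 *m E *m invmx B.
pose rr := invmx B *m (1%:M - E *m g1 *m E').
have iE'g : intmx (E' *m g1) by exact: intmxM.
have iE'gE : intmx (E' *m g1 *m E) by exact: intmxM.
have iEgE' : intmx (E *m g1 *m E') by exact: intmxM.
have iE'gEB : intmx (E' *m g1 *m E *m invmx B) by exact: intmxM.
have Kl : Kplus l.
  apply/KplusP; split; first exact: intmxB.
  rewrite mxredD ?mxredN ?mxred1 //; last exact: intmxN.
  rewrite !mxredM // rg1 redE redE' mulmxBl mul1mx ek subrr !mul0mx subr0 //.
have Kr : Kplus rr.
  apply: KplusM; first exact: KplusV.
  apply/KplusP; split; first exact: intmxB.
  rewrite mxredD ?mxredN ?mxred1 //; last exact: intmxN.
  by rewrite !mxredM // rg1 redE redE' ek mulmxBr mulmx1 ek subrr subr0.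
pose g2 := l *m g1 *m rr.
have EBgE : E *m invmx B *m g1 *m E = E by rewrite EV -[RHS](mulKmx uB) BE !mulmxA.
have lgE : l *m g1 *m E = E *m g1 *m E.
  rewrite /l mulmxBl mul1mx mulmxBl.
  have -> : E' *m g1 *m E *m invmx B *m g1 *m E = E' *m g1 *m E.
    by rewrite -[in RHS]EBgE !mulmxA.
  by rewrite -[X in X - _]mul1mx -E1 mulmxDl !mulmxA addrK.
have rE : rr *m E = E *m invmx B.
  by rewrite /rr -mulmxA mulmxBl mul1mx -[E *m g1 *m E' *m E]mulmxA E'E mulmx0 subr0 EV.
have g2E : g2 *m E = E by rewrite /g2 -mulmxA rE mulmxA lgE -EB mulmxK.
have El : E *m l = E by rewrite /l mulmxBr mulmx1 !mulmxA EE' !mul0mx subr0.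
have EgB : E *m g1 *m invmx B = E + E *m g1 *m E'.
  rewrite -[E *m g1 in LHS]mulmx1 -E1 mulmxDr mulmxDl -[E *m g1 *m E' *m _]mulmxA E'V.
  by rewrite -EB mulmxK.
have Eg2 : E *m g2 = E.
  have EgE : (E + E *m g1 *m E') *m E = E by rewrite mulmxDl EE -mulmxA E'E mulmx0 addr0.
  by rewrite /g2 !mulmxA El ?/rr ?mulmxA EgB mulmxBr mulmx1 !mulmxA EgE addrK.
have il : intmx l := Kmax_int Kl.1.
have irr : intmx rr := Kmax_int Kr.1.
have ilg : intmx (l *m g1) by exact: intmxM.
have ig2 : intmx g2 by exact: intmxM.
have rg2 : mxred g2 = pid_mx rho.
  by rewrite (mxredM ilg irr) (mxredM il ig1) Kl.2 Kr.2 rg1 mul1mx mulmx1.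
exists rho, (l *m x), (y *m rr); split.
- by rewrite lt0n mxrank_eq0 A0.
- by apply: KmaxM => //; case: Kl.
- by apply: KmaxM => //; case: Kr.
move=> v Uv; have vE (c e : 'I_r) : ~~ (c < rho <= e)%N -> v c e = (c == e)%:R.
  by move=> ce; apply: Uv => -[_ /eqP -> ce']; rewrite ce' in ce.
(* The nilpotent part N has only an upper right block, so E N = N and N E = 0;
   conjugation by g2 then turns it into N g2, whose reduction is N E = 0. *)
pose N := lft v - 1%:M.
have N0 (c e : 'I_r) : ~~ (c < rho <= e)%N -> N c e = 0.
  by move=> /vE ce; rewrite !mxE ce; case: eqP; rewrite ?lift1_0 ?lift1_1 ?subrr.
have EN : E *m N = N.
  apply/matrixP => c e; rewrite mxE (bigD1 c) //= mxE eqxx big1 ?addr0 => [|c' cc]; last first.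
    by rewrite mxE val_eqE eq_sym (negPf cc) mul0r.
  rewrite /=; case: ltnP => [_|cr]; first by rewrite mul1r.
  by rewrite mul0r N0 // ltnNge cr.
have NE : N *m E = 0.
  apply/matrixP => c e; rewrite !mxE big1 // => c' _; rewrite [E _ _]mxE.
  case: (ltnP c' rho) => [lt|_]; last by rewrite andbF mulr0.
  by rewrite N0 ?mul0r // [(rho <= _)%N]leqNgt lt andbF.
have iN : intmx N by apply: intmxB => //; exact: lft_int.
have uv : v \in unitmx.
  rewrite unitmxE -det_tr det_trig.
    by rewrite big1 ?unitr1 // => c _; rewrite mxE vE ?eqxx // [(rho <= _)%N]leqNgt andbN.
  apply/is_trig_mxP => c e ce; rewrite mxE vE; first by rewrite -val_eqE gtn_eqF.
  rewrite [(rho <= _)%N]leqNgt; apply/negP => /andP[er /negP]; apply.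
  exact: ltn_trans ce er.
exists (lft v); first by rewrite lftK; split=> //; exact: lft_Kmax.
have zg2 : l *m x *m g *m (y *m rr) = z *: g2.
  rewrite /g2 g1E /g0 -scalemxAr -scalemxAl -scalemxAr -scalemxAl scalerA mulfV //.
  by rewrite scale1r !mulmxA.
have z0 : z != 0 by [].
have ug2 : g2 \in unitmx.
  have : z *: g2 \in unitmx.
    rewrite -zg2 (unitmx_mul (l *m x *m g)) (unitmx_mul (l *m x)) ug.
    by rewrite (Kmax_unit (KmaxM Kl.1 Kx)) (Kmax_unit (KmaxM Ky Kr.1)).
  by rewrite unitmxZ // unitfE.
rewrite zg2.
have -> : invmx (z *: g2) *m lft v *m (z *: g2) = 1%:M + N *m g2.
  rewrite invmxZ ?unitmxZ ?unitfE // -!scalemxAl -scalemxAr scalerA mulVf // scale1r.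
  have -> : lft v = 1%:M + N by rewrite addrC subrK.
  have ENg : g2 *m N = N by rewrite -{1}EN mulmxA g2E EN.
  rewrite mulmxDr mulmx1 mulmxDl mulVmx //; congr (_ + _).
  by rewrite -{1}ENg mulKmx.
have iNg : intmx (N *m g2) by exact: intmxM.
apply/KplusP; split; first exact: intmxD.
by rewrite mxredD // mxred1 mxredM // rg2 -redE -mxredM // NE mxred0 addr0.
Qed.
End Iwasawa.

(** * Tensor powers and bicovariant functions *)

Section TensorPowers.
Variables (R : realType) (n d : nat).
Local Notation C := R[i].
Local Notation idx := {ffun 'I_n -> 'I_d}.
Local Notation N := #|{: {ffun 'I_n -> 'I_d}}|.
Implicit Types (A B : 'I_n -> 'M[C]_d) (a b c : idx) (w v : 'S_n).

Lemma big_tidx (V : nmodType) (f : idx -> V) : \sum_(a < N) f (tidx a) = \sum_a f a.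
Proof.
by rewrite [RHS](reindex (@enum_val {ffun 'I_n -> 'I_d} predT)) //=; exact/onW_bij/enum_val_bij.
Qed.

Lemma tidxK a : tidx (enum_rank a) = a.
Proof. exact: enum_rankK. Qed.

Lemma tensmxM A B : tensmx A *m tensmx B = tensmx (fun i => A i *m B i).
Proof.
apply/matrixP => a b; rewrite !mxE.
under [RHS]eq_bigr do rewrite mxE.
rewrite bigA_distr_bigA /= -(big_tidx (fun c => \prod_i (A i (tidx a i) (c i) * B i (c i) (tidx b i)))).
by apply: eq_bigr => c _; rewrite !mxE -big_split.
Qed.

Lemma prod_nat_eq a b (P : pred 'I_n) :
  \prod_(i | P i) (a i == b i)%:R = [forall i, P i ==> (a i == b i)]%:R :> C.
Proof.
case: (boolP [forall i, _]) => [/fintype.forallP ab|].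
  by rewrite big1 // => i Pi; have /implyP/(_ Pi) -> := ab i.
move=> /forallPn[j]; rewrite negb_imply => /andP[Pj /negPf ab].
by rewrite (bigD1 j) //= ab mul0r.
Qed.

Lemma tensmx1 : tensmx (fun=> 1%:M) = 1%:M :> 'M[C]_N.
Proof.
apply/matrixP => a b; rewrite !mxE.
under eq_bigr do rewrite mxE.
rewrite (prod_nat_eq (tidx a) (tidx b) predT); congr (nat_of_bool _)%:R.
apply/fintype.forallP/eqP => [ab|-> i]; last by rewrite eqxx.
by apply: enum_val_inj; apply/ffunP => i; apply/eqP; have := ab i.
Qed.

Lemma gammamx1 : gammamx R d (1%g : 'S_n) = 1%:M.
Proof.
apply/matrixP => a b; rewrite !mxE; congr (nat_of_bool _)%:R.
rewrite eq_sym -(inj_eq enum_val_inj); congr (_ == _); apply/ffunP => i.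
by rewrite ffunE perm1.
Qed.

Lemma gammamxM v w : gammamx R d (v * w)%g = gammamx R d w *m gammamx R d v.
Proof.
apply/matrixP => a b; rewrite !mxE.
rewrite (bigD1 (enum_rank [ffun i => tidx a (w i)])) //= ?mxE tidxK eqxx mul1r.
rewrite big1 ?addr0 => [|c ca]; last first.
  rewrite ?mxE; case: (tidx c =P _) => [e|_]; last by rewrite mul0r.
  by case/eqP: ca; rewrite -e enum_valK.
by congr (_ == _)%:R; apply/ffunP => i; rewrite !ffunE permM.
Qed.

Lemma gammamxKV w : gammamx R d w *m gammamx R d w^-1%g = 1%:M.
Proof. by rewrite -gammamxM mulVg gammamx1. Qed.

Lemma gammamx_tens w A :
  gammamx R d w *m tensmx A = tensmx (fun i => A (w^-1%g i)) *m gammamx R d w.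
Proof.
apply/matrixP => a b; rewrite !mxE.
rewrite (bigD1 (enum_rank [ffun i => tidx a (w i)])) //= ?mxE tidxK eqxx mul1r.
rewrite [X in _ + X = _]big1 ?addr0 => [|c ca]; last first.
  rewrite ?mxE; case: (tidx c =P _) => [e|_]; last by rewrite mul0r.
  by case/eqP: ca; rewrite -e enum_valK.
rewrite (bigD1 (enum_rank [ffun i => tidx b (w^-1%g i)])) //= ?mxE tidxK.
have -> : tidx b == [ffun i => [ffun j => tidx b (w^-1%g j)] (w i)].
  by apply/eqP/ffunP => i; rewrite !ffunE permK.
rewrite mulr1 [X in _ = _ + X]big1 ?addr0 => [|c cb]; last first.
  rewrite ?mxE; case: (tidx b =P _) => [e|_]; last by rewrite mulr0.
  case/eqP: cb; apply: enum_val_inj; rewrite enum_rankK; apply/ffunP => i.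
  by rewrite -/(tidx b) e !ffunE permKV.
rewrite [RHS](reindex_inj (@perm_inj _ w)) /=.
by apply: eq_bigr => i _; rewrite !ffunE permK.
Qed.

Definition factor (i0 : 'I_n) (X : 'M[C]_d) : 'M[C]_N :=
  tensmx (fun i => if i == i0 then X else 1%:M).

Definition upd (a : idx) (i0 : 'I_n) (x : 'I_d) : idx :=
  [ffun i => if i == i0 then x else a i].

Lemma upd_at a i0 x : upd a i0 x i0 = x.
Proof. by rewrite ffunE eqxx. Qed.

Lemma upd_upd a i0 x y : upd (upd a i0 x) i0 y = upd a i0 y.
Proof. by apply/ffunP => i; rewrite !ffunE; case: eqP. Qed.

Lemma upd_id a i0 : upd a i0 (a i0) = a.
Proof. by apply/ffunP => i; rewrite !ffunE; case: eqP => [->|]. Qed.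

Lemma factorE i0 X a b : factor i0 X (enum_rank a) (enum_rank b) =
  X (a i0) (b i0) * (upd a i0 (b i0) == b)%:R.
Proof.
rewrite mxE !tidxK (bigD1 i0) //= eqxx; congr (_ * _).
under eq_bigr => i /negPf ii do rewrite ii mxE.
rewrite prod_nat_eq; congr (nat_of_bool _)%:R.
apply/fintype.forallP/eqP => [ab|e i].
  apply/ffunP => i; rewrite ffunE; case: eqP => [->//|/eqP ii].
  by have /implyP/(_ ii)/eqP := ab i.
by apply/implyP => ii; rewrite -e ffunE (negPf ii).
Qed.

Lemma mul_factor p i0 X (M : 'M[C]_(N, p)) a z :
  (factor i0 X *m M) (enum_rank a) z =
  \sum_x X (a i0) x * M (enum_rank (upd a i0 x)) z.
Proof.
rewrite mxE (reindex (@enum_rank idx)) /=; last exact/onW_bij/enum_rank_bij.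
under eq_bigr do rewrite factorE mulrAC mulr_natr mulrb.
rewrite -big_mkcond (reindex_onto (upd a i0) (fun c => c i0)) => [|c /eqP//].
by apply: eq_big => [x|x _]; rewrite upd_at ?eqxx.
Qed.

Lemma factor_mul p i0 X (M : 'M[C]_(p, N)) z b :
  (M *m factor i0 X) z (enum_rank b) =
  \sum_x M z (enum_rank (upd b i0 x)) * X x (b i0).
Proof.
rewrite mxE (reindex (@enum_rank idx)) /=; last exact/onW_bij/enum_rank_bij.
under eq_bigr do rewrite factorE mulrA mulr_natr mulrb.
rewrite -big_mkcond (reindex_onto (upd b i0) (fun c => c i0)) => [|c /eqP <-].
  by apply: eq_big => [x|x _]; rewrite ?upd_at // upd_upd upd_id !eqxx.
by rewrite upd_upd upd_id.
Qed.
End TensorPowers.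

Section CuspidalRep.
Variables (R : realType) (k : finFieldType) (n r d : nat).
Local Notation C := R[i].
Local Notation idx := {ffun 'I_n -> 'I_d}.
Local Notation N := #|{: {ffun 'I_n -> 'I_d}}|.
Variable tau0 : 'M[k]_r -> 'M[C]_d.
Hypothesis cusp : irreducible_cuspidal tau0.
Hypothesis r_gt0 : (0 < r)%N.
Local Notation mat := 'M[k]_(\sum_(i < n) r).
Local Notation rhoM := (@rhoM R n d k r tau0).

Lemma tau0_1 : tau0 1%:M = 1%:M.
Proof.
case: cusp => -[[_ _ pi1 _] _ _] _; apply/matrixP => i j.
have := pi1 (delta_mx j 0) I; rewrite /mxact -colE => /colP/(_ i).
by rewrite !mxE eqxx andbT.
Qed.

Lemma tau0_M g h : g \in unitmx -> h \in unitmx -> tau0 (g *m h) = tau0 g *m tau0 h.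
Proof.
move=> ug uh; case: cusp => -[[_ _ _ piM] _ _] _; apply/matrixP => i j.
have := piM g h (delta_mx j 0) ug uh I; rewrite /mxact mulmxA -!colE => /colP/(_ i).
by rewrite !mxE.
Qed.

Lemma d_gt0 : (0 < d)%N.
Proof.
case: cusp => -[_ [x _ x0] _] _; case: (posnP d) => // d0; case: x0.
by apply/colP => -[i id]; exfalso; move: id; rewrite d0.
Qed.

Lemma N_gt0 : (0 < N)%N.
Proof. by apply/card_gt0P; exists [ffun=> Ordinal d_gt0]. Qed.

(** Schur's lemma: an eigenspace of an intertwiner is a nonzero subrepresentation. *)
Lemma Schur_tau0 (B : 'M[C]_d) :
  (forall g, g \in unitmx -> B *m tau0 g = tau0 g *m B) -> exists c, B = c%:M.
Proof.
move=> comm; case: (cusp) => -[_ _ irr] _.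
have [c /eigenvalueP[v vB v0]] : exists c, eigenvalue B^T c.
  have /closed_rootP[c] : size (char_poly B^T) != 1%N.
    by rewrite size_char_poly eqSS -lt0n d_gt0.
  by rewrite -eigenvalue_root_char; exists c.
have Bv : B *m v^T = c *: v^T by apply: trmx_inj; rewrite trmx_mul trmxK vB linearZ /= trmxK.
exists c; pose S : set 'cV[C]_d := [set x | B *m x = c *: x].
have [||||e] := irr S.
- by [].
- split=> [|a x y Sx Sy]; first by rewrite /S /= mulmx0 scaler0.
  by rewrite /S /= mulmxDr -scalemxAr Sx Sy scalerDr !scalerA mulrC.
- by move=> g x ug Sx; rewrite /S /= /mxact mulmxA comm // -mulmxA Sx -scalemxAr.
- move=> e; case/eqP: v0; apply: trmx_inj; rewrite linear0.
  by have : S v^T by []; rewrite e.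
apply/matrixP => i j; have : S (delta_mx j 0) by rewrite e.
rewrite /S /= -colE => /colP/(_ i); rewrite !mxE => ->.
by rewrite eqxx andbT mulr_natr.
Qed.

Lemma tau0_factor (i0 : 'I_n) g : g \in unitmx ->
  tensmx (fun i => tau0 (if i == i0 then g else 1%:M)) = factor i0 (tau0 g).
Proof.
move=> ug; congr (tensmx _); apply/funext => i.
by case: eqP => // _; rewrite tau0_1.
Qed.

(** Freezing all indices but one turns an intertwiner of the tensor power into an
    intertwiner of tau0. *)
Lemma Schur_tensor (A : 'M[C]_N) :
  (forall g : 'I_n -> 'M[k]_r, (forall i, g i \in unitmx) ->
     A *m tensmx (fun i => tau0 (g i)) = tensmx (fun i => tau0 (g i)) *m A) ->
  exists c, A = c%:M.
Proof.
move=> comm; pose M (a b : idx) := A (enum_rank a) (enum_rank b).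
have slice i0 a b : exists c, forall x y, M (upd a i0 x) (upd b i0 y) = (x == y)%:R * c.
  pose B : 'M[C]_d := \matrix_(x, y) M (upd a i0 x) (upd b i0 y).
  have [g ug|c Bc] := @Schur_tau0 B.
    have := comm (fun i => if i == i0 then g else 1%:M).
    rewrite tau0_factor // => /(_ _)/matrixP e.
    apply/matrixP => x y; have := e _ (enum_rank (upd a i0 x)) (enum_rank (upd b i0 y)).
    rewrite mul_factor factor_mul upd_at !mxE => E.
    under eq_bigr do rewrite mxE; under [RHS]eq_bigr do rewrite mxE.
    under [RHS]eq_bigr do rewrite -(upd_upd a i0 x).
    under eq_bigr do rewrite -(upd_upd b i0 y).
    by rewrite upd_at in E; apply: E => i; case: eqP => _; rewrite ?unitmx1.
  exists c => x y; have /matrixP/(_ x y) := Bc; rewrite !mxE => ->.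
  by rewrite mulr_natl.
have off a b : a != b -> M a b = 0.
  move=> ab; have [i0 ne] : exists i0, a i0 != b i0.
    by apply/fintype.existsP; apply: contraNT ab; rewrite negb_exists => /fintype.forallP e;
       apply/eqP/ffunP => i; apply/eqP; have := e i; rewrite negbK.
  have [c cE] := slice i0 a b.
  by have := cE (a i0) (b i0); rewrite !upd_id (negPf ne) mul0r.
have diag i0 a x : M (upd a i0 x) (upd a i0 x) = M a a.
  have [c cE] := slice i0 a a.
  by have := cE (a i0) (a i0); rewrite !upd_id => ->; rewrite cE !eqxx.
have const a b : M a a = M b b.
  (* Passes from a to b by changing one index at a time. *)
  pose mix (t : nat) : idx := [ffun i : 'I_n => if (i < t)%N then b i else a i].
  have mixE t : (t <= n)%N -> M (mix t) (mix t) = M a a.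
    elim: t => [_|t IH lt].
      by have -> : mix 0%N = a by apply/ffunP => i; rewrite ffunE.
    rewrite -(IH (ltnW lt)) -(diag (Ordinal lt) (mix t) (b (Ordinal lt))).
    suff -> : mix t.+1 = upd (mix t) (Ordinal lt) (b (Ordinal lt)) by [].
    apply/ffunP => i; rewrite !ffunE ltnS leq_eqVlt -val_eqE /=.
    by case: (ltngtP i t) => //= e; congr (b _); exact: val_inj.
  rewrite -(mixE n) //; congr M; apply/ffunP => i; rewrite ffunE ltn_ord //.
exists (M [ffun=> Ordinal d_gt0] [ffun=> Ordinal d_gt0]); apply/matrixP => a b.
rewrite mxE -[a]enum_valK -[b]enum_valK (inj_eq (@enum_rank_inj _)) -/(M _ _).
have [->|ab] := eqVneq (enum_val a) (enum_val b); last by rewrite off.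
by rewrite mulr1n; exact: const.
Qed.

Lemma rhoM_M p q : Parab p -> Parab q -> rhoM (p *m q) = rhoM p *m rhoM q.
Proof.
move=> Pp Pq; rewrite /Defs.rhoM tensmxM; congr tensmx; apply/funext => i.
by rewrite Parab_blkM // tau0_M // Parab_blk_unit.
Qed.

Lemma rhoM_U u : Urad u -> rhoM u = 1%:M.
Proof.
move=> [u1 _]; rewrite /Defs.rhoM -tensmx1; congr tensmx; apply/funext => i.
by rewrite u1 tau0_1.
Qed.

Lemma rhoM_1 : rhoM 1%:M = 1%:M.
Proof. exact/rhoM_U/Urad1. Qed.

Lemma rhoM_V p : Parab p -> rhoM (invmx p) *m rhoM p = 1%:M.
Proof.
move=> Pp; rewrite -rhoM_M //; last exact: ParabV.
by rewrite mulVmx ?rhoM_1 //; case: Pp.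
Qed.

Lemma rhoM_VK p : Parab p -> rhoM p *m rhoM (invmx p) = 1%:M.
Proof.
move=> Pp; rewrite -rhoM_M //; last exact: ParabV.
by rewrite mulmxV ?rhoM_1 //; case: Pp.
Qed.

Lemma rhoM_bdiag (B : 'I_n -> 'M[k]_r) : rhoM (bdiag B) = tensmx (fun i => tau0 (B i)).
Proof. by congr tensmx; apply/funext => i; rewrite blk_bdiag eqxx. Qed.

(** The unipotent matrices attached to an arbitrary level function on the
    indices are conjugate, by a permutation sorting the levels, to the unipotent
    radical of a standard parabolic subgroup; so they have no fixed vectors. *)
Lemma cuspidal_levels (f : 'I_r -> nat) (v : 'cV[C]_d) :
  (exists x y, (f x < f y)%N) ->
  (forall Y : 'M[k]_r, Y \in unitmx ->
     (forall x y, ~~ (f x < f y)%N -> Y x y = (x == y)%:R) -> tau0 Y *m v = v) ->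
  v = 0.
Proof.
move=> [x0 [y0 xy0]] fixv.
pose t := [tuple f i | i < r]; pose s := sort leq t.
have szs : size s == r by rewrite size_sort size_tuple.
have [p sE] : exists p : 'S_r, s = [tuple tnth t (p i) | i < r] :> seq nat.
  by apply/tuple_permP; rewrite perm_sort.
have fp i : f (p i) = nth 0%N s i.
  by rewrite sE -tnth_nth !tnth_mktuple.
have s_sorted : sorted leq s by apply: sort_sorted; exact: leq_total.
have s_le i j : (i <= j < r)%N -> (nth 0 s i <= nth 0 s j)%N.
  move=> /andP[ij jr]; apply: (sorted_leq_nth leq_trans leqnn) => //.
    by rewrite inE (eqP szs); exact: leq_ltn_trans jr.
  by rewrite inE (eqP szs).
(* The standard parabolic cuts where the sorted levels jump; at a = 0 the
   truncated predecessor makes D false. *)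
pose D : pred nat := fun a => (nth 0 s a.-1 < nth 0 s a)%N.
have propD : proper_cut r D.
  apply: contrapT => no.
  have const i : (i < r)%N -> nth 0%N s i = nth 0%N s 0%N.
    elim: i => // i IH ir; rewrite -(IH (ltnW ir)); apply/eqP.
    rewrite eqn_leq; apply/andP; split; last by apply: s_le; rewrite leqnSn.
    by rewrite leqNgt; apply/negP => lt; apply: no; exists i.+1.
  move: xy0; rewrite -[x0](permKV p) -[y0](permKV p) !fp !const ?ltnn //.
pose Q : 'M[k]_r := perm_mx p.
have uQ : Q \in unitmx by exact: unitmx_perm.
suff : tau0 Q *m v = 0.
  move=> /(congr1 (mulmx (tau0 (invmx Q)))); rewrite mulmx0 mulmxA -tau0_M ?unitmx_inv //.
  by rewrite mulVmx // tau0_1 mul1mx.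
case: cusp => _ /(_ D propD) fix0.
suff : fixed (@unip_rad k r D) (mxact tau0) (tau0 Q *m v) by rewrite fix0.
move=> X UX; have uX : X \in unitmx.
  apply: upper_unit; split=> [a b ba|a].
    rewrite UX; first by rewrite -val_eqE gtn_eqF.
    by move=> [c _ /andP[ac cb]]; have := leq_trans ac (leq_trans cb (ltnW ba)); rewrite ltnn.
  rewrite UX ?eqxx ?oner_neq0 // => -[c _ /andP[ac ca]].
  by have := leq_trans ac ca; rewrite ltnn.
have uY : invmx Q *m X *m Q \in unitmx by rewrite !unitmx_mul unitmx_inv uQ uX.
have YE x y : (invmx Q *m X *m Q) x y = X (p^-1%g x) (p^-1%g y).
  have -> : Q = perm_mx (p^-1)^-1%g by rewrite invgK.
  rewrite -col_permE mxE.
  have -> : invmx (perm_mx (p^-1)^-1%g : 'M[k]_r) = perm_mx p^-1%g.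
    by rewrite -[RHS](mulKmx (unitmx_perm _ (p^-1)^-1%g)) -perm_mxM mulVg perm_mx1 mulmx1.
  by rewrite -row_permE mxE.
have XQ : X *m Q = Q *m (invmx Q *m X *m Q) by rewrite -mulmxA mulKVmx.
rewrite /mxact mulmxA -tau0_M // XQ tau0_M // -mulmxA fixv // => x y; apply: contraNeq.
rewrite YE -(inj_eq (@perm_inj _ p^-1%g)) => ne.
have [c Dc /andP[ic cj]] : exists2 a, D a & ((p^-1)%g x < a <= (p^-1)%g y)%N.
  by apply: contrapT => /UX; move/eqP: ne.
rewrite -[x](permKV p) -[y](permKV p) !fp.
apply: leq_ltn_trans (s_le _ _ _) (leq_trans Dc (s_le _ _ _)).
  by case: c ic {Dc} cj => // c ic cj; rewrite -ltnS ic (leq_trans _ (leq_trans cj (ltnW (ltn_ord _)))) //.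
by rewrite cj ltn_ord.
Qed.

(** The functions on the finite group that correspond both to endomorphisms of
    the induced representation and to Hecke operators supported on K. *)
Definition bicov (Fn : mat -> 'M[C]_N) := forall p g q, Parab p -> g \in unitmx -> Parab q ->
  Fn (p *m g *m q) = rhoM (invmx q) *m Fn g *m rhoM (invmx p).

Lemma Urad_I (u : mat) : (forall a b, (tagnat.sig1 b <= tagnat.sig1 a)%N -> u a b = (a == b)%:R) ->
  Urad u.
Proof.
move=> uE; split=> [i|i j ji]; apply/matrixP => x y; rewrite !mxE uE ?tagnat.Rank1K //.
- by rewrite -[_ == _ :> 'I_(\sum_(i < n) r)]val_eqE tagnat.eq_Rank eqxx.
- by rewrite -[_ == _ :> 'I_(\sum_(i < n) r)]val_eqE tagnat.eq_Rank -val_eqE gtn_eqF.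
- exact: ltnW.
Qed.

(** Cuspidality leaves only the double cosets of block permutations: for any
    other permutation some diagonal block of P meets the conjugate of U in the
    unipotent radical of a proper parabolic. *)
Lemma bicov_zero Fn : bicov Fn -> (forall w : 'S_n, Fn (blkperm k r w) = 0) ->
  forall g, g \in unitmx -> Fn g = 0.
Proof.
move=> Fcov F0 g ug; have [p [q [w [Up Uq pgq]]]] := Bruhat ug.
have Pup x : upper x -> @Parab k n r x.
  by move=> Ux; split; [exact: upper_unit | exact: upper_blk Ux.1].
have [Pp Pq] := (Pup _ Up, Pup _ Uq).
suff Fw : Fn (perm_mx w) = 0.
  have : rhoM (invmx q) *m Fn g *m rhoM (invmx p) = 0 by rewrite -Fcov // pgq Fw.
  move=> /(congr1 (fun X => rhoM q *m X *m rhoM p)); rewrite mulmx0 mul0mx !mulmxA.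
  by rewrite rhoM_VK // mul1mx -mulmxA rhoM_V // mulmx1.
have uw := unitmx_perm k w.
(* f i x is the block of the index that w sends to index x of block i; if f i is not
   constant, it serves as a level function on the i-th factor. *)
pose f i x : nat := tagnat.sig1 (w^-1%g (tagnat.Rank i x)).
have [[i [x0 [y0 xy0]]]|const] := pselect (exists i x y, (f i x < f i y)%N).
  suff cols : forall z, col z (Fn (perm_mx w)) = 0.
    by apply/matrixP => a z; have /colP/(_ a) := cols z; rewrite !mxE.
  move=> z; set v := col z _.
  have fixv (Y : 'M[k]_r) : Y \in unitmx ->
      (forall x y, ~~ (f i x < f i y)%N -> Y x y = (x == y)%:R) ->
      factor i (tau0 Y) *m v = v.
    move=> uY YE; pose m := bdiag (fun j : 'I_n => if j == i then Y else 1%:M).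
    have Lm : Levi m by apply: bdiag_Levi => j; case: eqP; rewrite ?unitmx1.
    have Pm := Levi_Parab Lm.
    pose u := perm_mx w *m m *m invmx (perm_mx w).
    have uE a b : u a b = m (w a) (w b).
      rewrite /u -row_permE.
      have -> : invmx (perm_mx w : mat) = perm_mx w^-1%g.
        by rewrite -[RHS](mulKmx uw) -perm_mxM mulgV perm_mx1 mulmx1.
      by rewrite -col_permE !mxE.
    have Uu : Urad u.
      apply: Urad_I => a b ba; rewrite uE -[a == b](inj_eq (@perm_inj _ w)).
      rewrite -[in RHS](tagnat.sig2K (w a)) -[in RHS](tagnat.sig2K (w b)).
      rewrite -[_ == _ :> 'I_(\sum_(i < n) r)]val_eqE tagnat.eq_Rank blkE blk_bdiag.
      case: eqP => [e|_]; last by rewrite mxE.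
      move: (tagnat.sig2 (w a)) (tagnat.sig2K (w a)) (tagnat.sig2 (w b)) (tagnat.sig2K (w b)).
      rewrite -e /= => x xE y yE; case: eqP => [ei|_]; last by rewrite mxE.
      apply: YE; rewrite -leqNgt /f -ei.
      by rewrite xE yE !permK.
    have Pu := Urad_Parab Uu.
    have e1 : Fn (u *m perm_mx w *m 1%:M) = Fn (perm_mx w).
      rewrite Fcov //; last exact: Parab1.
      by rewrite invmx1 rhoM_1 mul1mx rhoM_U ?mulmx1 //; exact: UradV.
    have e2 : Fn (1%:M *m perm_mx w *m m) = rhoM (invmx m) *m Fn (perm_mx w).
      rewrite Fcov //; last exact: Parab1.
      by rewrite invmx1 rhoM_1 mulmx1.
    have e3 : Fn (perm_mx w) = rhoM m *m Fn (perm_mx w).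
      have uwm : u *m perm_mx w *m 1%:M = 1%:M *m perm_mx w *m m.
        by rewrite mulmx1 mul1mx /u mulmxKV.
      by rewrite -[X in _ = _ *m X]e1 uwm e2 mulmxA rhoM_VK // mul1mx.
    rewrite /v colE mulmxA [in RHS]e3; congr (_ *m _ *m _).
    rewrite /m rhoM_bdiag -tau0_factor //.
  clearbody v; suff slices (a : idx) : (\col_x v (enum_rank (upd a i x)) 0 : 'cV[C]_d) = 0.
    apply/colP => a; have /colP/(_ (tidx a i)) := slices (tidx a).
    by rewrite !mxE upd_id enum_valK.
  apply: (@cuspidal_levels (f i)); first by exists x0, y0.
  move=> Y uY YE; apply/colP => x; have /colP/(_ (enum_rank (upd a i x))) := fixv Y uY YE.
  rewrite mul_factor upd_at => e; rewrite mxE [RHS]mxE -[RHS]e.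
  by apply: eq_bigr => y _; rewrite mxE upd_upd.
have fE i x y : f i x = f i y.
  have [lt|gt|//] := ltngtP (f i x) (f i y); case: const; first by exists i, x, y.
  by exists i, y, x.
pose o (j : 'I_n) := tagnat.sig1 (w (tagnat.Rank j (Ordinal r_gt0) : 'I_(\sum_(i < n) r))).
have blockw a : tagnat.sig1 a = tagnat.sig1 (w^-1%g (tagnat.Rank (tagnat.sig1 (w a)) (Ordinal r_gt0))).
  apply: val_inj; rewrite -[LHS]/(nat_of_ord (tagnat.sig1 a)).
  rewrite -[in LHS](permK w a) -[X in w^-1%g X](tagnat.sig2K (w a)).
  exact: (fE _ (tagnat.sig2 (w a)) (Ordinal r_gt0)).
have o_inj : injective o.
  move=> j j' e; have := blockw (tagnat.Rank j (Ordinal r_gt0)).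
  have := blockw (tagnat.Rank j' (Ordinal r_gt0)).
  rewrite !tagnat.Rank1K -/(o j) -/(o j') e => e1 e2.
  by rewrite e2 -e1.
have wo a : tagnat.sig1 (w a) = o (tagnat.sig1 a).
  apply: (can_inj (permK (perm o_inj)^-1%g)).
  rewrite -[o _](permE o_inj) permK.
  have := blockw a; set j := tagnat.sig1 (w a) => ->.
  have -> : j = o ((perm o_inj)^-1%g j) by rewrite -(permE o_inj) permKV.
  set l := (perm o_inj)^-1%g j; have := blockw (tagnat.Rank l (Ordinal r_gt0)).
  by rewrite tagnat.Rank1K -/(o l) => <-; rewrite -(permE o_inj) permK.
pose v : 'S_n := perm o_inj; pose m := invmx (blkperm k r v) *m perm_mx w.
have Lm : Levi m.
  split=> [|i j ij]; first by rewrite unitmx_mul unitmx_inv blkperm_unit.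
  rewrite /m invmx_blkperm blk_perml; apply/matrixP => x y; rewrite !mxE.
  case: eqP => // e; case/eqP: ij.
  have := congr1 (fun s => tagnat.sig1 s) e; rewrite /= wo !tagnat.Rank1K => <-.
  by rewrite -(permE o_inj) permKV.
have -> : perm_mx w = 1%:M *m blkperm k r v *m m :> mat.
  by rewrite mul1mx /m mulKVmx // blkperm_unit.
rewrite Fcov ?blkperm_unit //; [|exact: Parab1|exact: Levi_Parab].
by rewrite F0 mulmx0 mul0mx.
Qed.

(** Conjugation by w permutes the tensor factors of rho_M exactly as gamma_w
    does, so gamma_w^-1 times the value at w commutes with rho_M. *)
Lemma bicov_scalar Fn (w : 'S_n) : bicov Fn ->
  exists c, Fn (blkperm k r w) = c *: gammamx R d w.
Proof.
move=> Fcov; have [g ug|c cE] := @Schur_tensor (gammamx R d w^-1%g *m Fn (blkperm k r w)).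
  pose gV i := invmx (g i); pose m := bdiag gV; pose m' := bdiag (fun i => gV (w^-1%g i)).
  have uV i : gV i \in unitmx by rewrite unitmx_inv.
  have Lm : Levi m by exact: bdiag_Levi.
  have Lm' : Levi m' by apply: bdiag_Levi => i.
  have mw : m *m blkperm k r w = blkperm k r w *m m'.
    apply/blk_inj => i j; rewrite blk_permr blk_perml !blk_bdiag.
    by rewrite permK -[i == _](inj_eq (@perm_inj _ w)) permKV.
  have ub := blkperm_unit k r w.
  have e : Fn (blkperm k r w) *m rhoM (invmx m) = rhoM (invmx m') *m Fn (blkperm k r w).
    have := Fcov _ _ _ (Levi_Parab Lm) ub (Parab1 _ _ _).
    have := Fcov _ _ _ (Parab1 _ _ _) ub (Levi_Parab Lm').
    by rewrite mulmx1 mul1mx mw !invmx1 !rhoM_1 mul1mx mulmx1 => -> ->.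
  have rm : rhoM (invmx m) = tensmx (fun i => tau0 (g i)).
    rewrite invmx_bdiag // rhoM_bdiag; congr tensmx; apply/funext => i.
    by rewrite /gV invmxK.
  have rm' : rhoM (invmx m') = tensmx (fun i => tau0 (g (w^-1%g i))).
    rewrite invmx_bdiag // rhoM_bdiag; congr tensmx; apply/funext => i.
    by rewrite /gV invmxK.
  rewrite -rm -mulmxA e rm' rm !mulmxA gammamx_tens; congr (_ *m _ *m _).
  by congr tensmx; apply/funext => i; rewrite invgK permK.
exists c; rewrite -[LHS]mul1mx -(gammamxKV R d w) -mulmxA cE.
by rewrite mul_mx_scalar.
Qed.
End CuspidalRep.

(** * Linear maps and subspaces *)

Lemma trmxZ (K : fieldType) p q (c : K) (A : 'M[K]_(p, q)) : (c *: A)^T = c *: A^T.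
Proof. by apply/matrixP => i j; rewrite !mxE. Qed.

Lemma adj_flip n (i j l c : 'I_n) : j = i.+1 :> nat -> (l < c)%N ->
  (tperm i j c < tperm i j l)%N -> l = i /\ c = j.
Proof.
move=> ij lc.
have ne (x y : 'I_n) : x <> y -> (x != y :> nat) by move/eqP.
case: (tpermP i j c) => [ci|cj|/ne ci /ne cj];
  case: (tpermP i j l) => [li|lj|/ne li /ne lj] h; try (subst; lia).
all: by split; apply: val_inj; subst => /=; lia.
Qed.

Section LinearMaps.
Variables (K : fieldType) (L L' : lmodType K).
Variable f : L -> L'.
Hypothesis fP : linear f.

Lemma lin0 : f 0 = 0.
Proof. by have := fP 1 0 0; rewrite !scale1r addr0 => /eqP; rewrite -subr_eq0 opprD addNKr oppr_eq0 => /eqP. Qed.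

Lemma linZ a x : f (a *: x) = a *: f x.
Proof. by have := fP a x 0; rewrite lin0 !addr0. Qed.

Lemma linD x y : f (x + y) = f x + f y.
Proof. by have := fP 1 x y; rewrite !scale1r. Qed.

Lemma lin_sum (J : Type) (s : seq J) (P : pred J) (x : J -> L) :
  f (\sum_(l <- s | P l) x l) = \sum_(l <- s | P l) f (x l).
Proof. exact: (big_morph f linD lin0). Qed.
End LinearMaps.

Lemma linear_comp (K : fieldType) (L1 L2 L3 : lmodType K) (g : L2 -> L3) (f : L1 -> L2) :
  linear g -> linear f -> linear (g \o f).
Proof. by move=> gP fP a x y; rewrite /= fP gP. Qed.

Lemma mulmx_linear (K : fieldType) p q s (A : 'M[K]_(p, q)) :
  linear (mulmx A : 'M_(q, s) -> _).
Proof. by move=> a x y; rewrite mulmxDr scalemxAr. Qed.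

Section LinearOn.
Variables (R : realType) (L L' : lmodType R[i]) (E : set L).
Hypothesis Esub : subspace E.

Lemma subspaceZ a x : E x -> E (a *: x).
Proof. by move=> Ex; case: Esub => E0 /(_ a x 0 Ex E0); rewrite addr0. Qed.

Lemma subspaceD x y : E x -> E y -> E (x + y).
Proof. by move=> Ex Ey; case: Esub => _ /(_ 1 x y Ex Ey); rewrite scale1r. Qed.

Lemma subspaceB x y : E x -> E y -> E (x - y).
Proof. by move=> Ex Ey; rewrite addrC -scaleN1r; case: Esub => _; exact. Qed.

Lemma subspace_sum (J : Type) (s : seq J) (P : pred J) (x : J -> L) :
  (forall l, P l -> E (x l)) -> E (\sum_(l <- s | P l) x l).
Proof. by move=> xE; elim/big_ind: _ => //; [case: Esub | exact: subspaceD]. Qed.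

Variable f : L -> L'.
Hypothesis fP : linear_on E f.

Lemma linear_on0 : f 0 = 0.
Proof.
case: Esub => E0 _; have := fP 1 E0 E0; rewrite !scale1r addr0 => /eqP.
by rewrite -subr_eq0 opprD addNKr oppr_eq0 => /eqP.
Qed.

Lemma linear_onZ a x : E x -> f (a *: x) = a *: f x.
Proof. by case: Esub => E0 _ Ex; have := fP a Ex E0; rewrite linear_on0 !addr0. Qed.

Lemma linear_onD x y : E x -> E y -> f (x + y) = f x + f y.
Proof. by move=> Ex Ey; have := fP 1 Ex Ey; rewrite !scale1r. Qed.

Lemma linear_on_sum (J : Type) (s : seq J) (P : pred J) (x : J -> L) :
  (forall l, P l -> E (x l)) ->
  f (\sum_(l <- s | P l) x l) = \sum_(l <- s | P l) f (x l).
Proof.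
move=> xE; suff [] : E (\sum_(l <- s | P l) x l) /\
  f (\sum_(l <- s | P l) x l) = \sum_(l <- s | P l) f (x l) by [].
elim/big_rec2: _ => [|l y z Pl [Ez ez]]; first by split; [case: Esub | exact: linear_on0].
by split; [apply: subspaceD => //; exact: xE | rewrite -ez linear_onD //; exact: xE].
Qed.
End LinearOn.

Lemma linear_onT (R : realType) (L L' : lmodType R[i]) (f : L -> L') :
  linear_on setT f -> linear f.
Proof. by move=> fP a x y; exact: fP. Qed.

(** Naming the inverse keeps scalings by it in the module structure over the
    ring of scalars itself. *)
Definition invn (R : realType) (m : nat) : R[i] := m%:R^-1.

Lemma invnK (R : realType) m : (0 < m)%N -> invn R m * m%:R = 1.
Proof. by move=> m0; rewrite /invn mulVf // pnatr_eq0 -lt0n. Qed.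

Lemma invn_neq0 (R : realType) m : (0 < m)%N -> invn R m != 0.
Proof. by move=> m0; rewrite invr_eq0 pnatr_eq0 -lt0n. Qed.

Lemma invn_mulrn (R : realType) (V : lmodType R[i]) m (y : V) : (0 < m)%N ->
  invn R m *: (y *+ m) = y.
Proof. by move=> m0; rewrite -scaler_nat scalerA invnK // scale1r. Qed.

(** * The induced representation of the finite group *)

Section InducedRep.
Variables (R : realType) (k : finFieldType) (n r d : nat).
Local Notation C := R[i].
Local Notation nr := (\sum_(i < n) r)%N.
Local Notation N := #|{: {ffun 'I_n -> 'I_d}}|.
Local Notation mat := 'M[k]_nr.
Local Notation ga := {ffun mat -> C}.
Local Notation e := (ga_eU R k n r).
Local Notation elt := (@ga_elt R k n r).
Implicit Types (g p u : mat) (x : ga) (v : 'cV[C]_N).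

Lemma elt_mul g x (h : mat) : g \in unitmx -> ga_mul (elt g) x h = x (invmx g *m h).
Proof.
move=> ug; rewrite ffunE (bigD1 g) //= ffunE eqxx mul1r [X in _ + X]big1 ?addr0 // => g' /andP[_ ne].
by rewrite ffunE (negPf ne) mul0r.
Qed.

Lemma mul_elt x (m h : mat) : m \in unitmx ->
  ga_mul x (elt m) h = if h \in unitmx then x (h *m invmx m) else 0.
Proof.
move=> um; rewrite ffunE; case: ifP => [uh|/negbT nh].
  have u1 : h *m invmx m \in unitmx by rewrite unitmx_mul uh unitmx_inv.
  rewrite (bigD1 (h *m invmx m)) //= ffunE.
  have -> : invmx (h *m invmx m) *m h == m.
    by apply/eqP; apply: (can_inj (mulKmx u1)); rewrite mulKVmx // mulmxKV.
  rewrite mulr1 [X in _ + X]big1 ?addr0 // => g /andP[ug ne]; rewrite ffunE.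
  case: eqP => [E|_]; last by rewrite mulr0.
  by case/eqP: ne; rewrite -E -[LHS](mulmxK um) -E mulKVmx.
rewrite big1 // => g ug; rewrite ffunE; case: eqP => [E|_]; last by rewrite mulr0.
by move: um; rewrite -E unitmx_mul unitmx_inv ug (negPf nh).
Qed.

Definition Unum := #|[pred u : mat | `[< Urad u >]]|.

Lemma Unum_gt0 : (0 < Unum)%N.
Proof.
apply/card_gt0P; exists 1%:M; rewrite unfold_in /=.
by apply/asboolP; exact: Urad1.
Qed.

Lemma eUE (h : mat) : e h = invn R Unum * `[< Urad h >]%:R.
Proof.
rewrite /ga_eU ffunE; congr (_ * _); rewrite sum_ffunE.
case: asboolP => [Uh|nU].
  rewrite (bigD1 h) /=; last exact/asboolP.
  rewrite ffunE eqxx [X in _ + X]big1 ?addr0 // => g /andP[_ ne].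
  by rewrite ffunE eq_sym (negPf ne).
rewrite big1 // => g /asboolP Ug; rewrite ffunE; case: eqP => // hg.
by case: nU; rewrite hg.
Qed.

Lemma sum_eU : \sum_(u | `[< Urad u >]) e u = 1.
Proof.
under eq_bigr => u Uu do rewrite eUE Uu mulr1.
by rewrite sumr_const -[X in _ *+ X]/Unum -[_ *+ _]mulr_natr invnK // Unum_gt0.
Qed.

Lemma elt1_mul x : ga_mul (elt 1%:M) x = x.
Proof. by apply/ffunP => h; rewrite elt_mul ?unitmx1 // invmx1 mul1mx. Qed.

Lemma elt_eltM g (h : mat) x : g \in unitmx -> h \in unitmx ->
  ga_mul (elt g) (ga_mul (elt h) x) = ga_mul (elt (g *m h)) x.
Proof.
move=> ug uh; have ugh : g *m h \in unitmx by rewrite unitmx_mul ug.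
apply/ffunP => z; rewrite !elt_mul //; congr (x _).
apply: (can_inj (mulKmx ugh)); rewrite mulKVmx // -mulmxA.
by rewrite [h *m _]mulKVmx // mulKVmx.
Qed.

Definition Gspan (y x : ga) := \sum_(g | g \in unitmx) y g *: ga_mul (elt g) x.

Lemma ga_mul_span (y x : ga) : ga_mul y x = Gspan y x.
Proof.
apply/ffunP => h; rewrite sum_ffunE ffunE; apply: eq_bigr => g ug.
by rewrite [in RHS]ffunE elt_mul.
Qed.

Lemma CGeU_sub : subspace (@ga_CGeU R k n r).
Proof.
split; first exists 0; first by move=> g _; rewrite ffunE.
  by apply/ffunP => h; rewrite !ffunE big1 // => g _; rewrite ffunE mul0r.
move=> a _ _ [x x0 ->] [y y0 ->]; exists (a *: x + y).
  by move=> g ng; rewrite !ffunE x0 // y0 // scaler0 addr0.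
apply/ffunP => h; rewrite !ffunE scaler_sumr -big_split; apply: eq_bigr => g _ /=.
by rewrite !ffunE mulrDl scalerAl.
Qed.

Lemma elt_CGeU g : g \in unitmx -> ga_CGeU (ga_mul (elt g) e).
Proof.
move=> ug; exists (elt g) => // h nh; rewrite ffunE.
by case: eqP nh => // ->; rewrite ug.
Qed.

Lemma e_CGeU : ga_CGeU e.
Proof. by rewrite -[e]elt1_mul; apply: elt_CGeU; exact: unitmx1. Qed.

Variable tau0 : 'M[k]_r -> 'M[C]_d.
Hypothesis cusp : irreducible_cuspidal tau0.
Hypothesis r_gt0 : (0 < r)%N.
Local Notation rhoM := (@rhoM R n d k r tau0).
Variables (I : lmodType C) (beta : ga -> 'cV[C]_N -> I) (act : mat -> I -> I).
Hypothesis indP : is_finInd tau0 beta act.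

Definition gen v : I := beta e v.

Lemma act_linear g : g \in unitmx -> linear (act g).
Proof. by move=> ug; case: indP => _ _ /(_ g ug)[]. Qed.

Lemma gen_linear : linear gen.
Proof. by case: indP => -[_ + _] _ _; apply; exact: e_CGeU. Qed.

Lemma act_gen g v : g \in unitmx -> act g (gen v) = beta (ga_mul (elt g) e) v.
Proof. by move=> ug; case: indP => _ _ /(_ g ug)[_ ->] //; exact: e_CGeU. Qed.

Lemma beta_span (y : ga) v : (forall g, g \notin unitmx -> y g = 0) ->
  beta (ga_mul y e) v = \sum_(g | g \in unitmx) y g *: act g (gen v).
Proof.
move=> y0; case: indP => -[bl _ _] _ _.
rewrite ga_mul_span /Gspan (linear_on_sum CGeU_sub (bl v)); last first.
  by move=> g ug; apply: (subspaceZ CGeU_sub); exact: elt_CGeU.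
apply: eq_bigr => g ug.
by rewrite (linear_onZ CGeU_sub (bl v)) ?act_gen //; exact: elt_CGeU.
Qed.

(** The induced module is spanned by the translates of the generating copy of
    rho_M, in the form in which the universal property expresses it. *)
Lemma ind_ext (W : lmodType C) (Phi Psi : I -> W) : linear Phi -> linear Psi ->
  (forall g v, g \in unitmx -> Phi (act g (gen v)) = Psi (act g (gen v))) -> Phi = Psi.
Proof.
move=> lPhi lPsi ePP; case: (indP) => -[b1 b2 b3] univ _.
have bal : balanced tau0 (fun x v => Phi (beta x v)).
  split=> [v a x y Ex Ey|x Ex a v w|x m v Ex Lm].
  - by rewrite b1 // lPhi.
  - by rewrite b2 // lPhi.
  - by rewrite b3.
have [G [_ uniqG]] := univ W _ bal.
rewrite -(uniqG Phi) ?(uniqG Psi) //; split=> // x v [y y0 ->].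
by rewrite !beta_span // !lin_sum //; apply: eq_bigr => g ug; rewrite !linZ // ePP.
Qed.

Lemma actM g (h : mat) y : g \in unitmx -> h \in unitmx -> act (g *m h) y = act g (act h y).
Proof.
move=> ug uh; have ugh : g *m h \in unitmx by rewrite unitmx_mul ug.
suff -> : act (g *m h) = act g \o act h by [].
apply: ind_ext => [||l v ul]; first exact: act_linear.
  by apply: linear_comp; exact: act_linear.
have aE (g' h' : mat) : g' \in unitmx -> h' \in unitmx ->
    act g' (beta (ga_mul (elt h') e) v) = beta (ga_mul (elt (g' *m h')) e) v.
  move=> ug' uh'; case: (indP) => _ _ /(_ g' ug')[_ ->]; last exact: elt_CGeU.
  by rewrite elt_eltM.
by rewrite /= act_gen // !aE ?mulmxA // unitmx_mul uh.
Qed.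

Lemma act1 y : act 1%:M y = y.
Proof.
suff -> : act 1%:M = id by [].
apply: ind_ext => [||l v ul] //; first by apply: act_linear; exact: unitmx1.
by rewrite -actM ?unitmx1 // mul1mx.
Qed.

Lemma act_Parab p v : Parab p -> act p (gen v) = gen (rhoM p *m v).
Proof.
move=> Pp; have [m [u [Lm Uu ->]]] := Parab_fact Pp.
have [um uu] : m \in unitmx /\ u \in unitmx by split; [case: Lm | exact: Urad_unit].
rewrite actM // rhoM_M //; [|exact: Levi_Parab|exact: Urad_Parab].
rewrite (rhoM_U cusp Uu) mulmx1.
have -> : act u (gen v) = gen v.
  rewrite act_gen //; congr beta; apply/ffunP => h; rewrite elt_mul // !eUE.
  congr (_ * (nat_of_bool _)%:R); apply: asbool_equiv_eq; split=> [Uh|Uh].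
    by rewrite -(mulKVmx uu h); exact: UradM.
  by apply: UradM => //; exact: UradV.
rewrite act_gen // /gen; case: indP => -[_ _ b3] _ _; rewrite -b3 //; last exact: e_CGeU.
congr beta; apply/ffunP => h; rewrite elt_mul // mul_elt // !eUE.
case: ifP => [uh|/negbT nh].
  congr (_ * (nat_of_bool _)%:R); apply: asbool_equiv_eq; split=> [Uh|Uh].
    have -> : h *m invmx m = m *m (invmx m *m h) *m invmx m by rewrite mulKVmx.
    exact: Levi_conjU.
  have := Levi_conjU (LeviV Lm) Uh; rewrite invmxK -!mulmxA mulVmx // mulmx1 //.
case: asboolP => [/Urad_unit|_]; last by rewrite mulr0.
by rewrite unitmx_mul (negPf nh) andbF.
Qed.

(** Frobenius reciprocity. *)
Lemma ind_univ (W : lmodType C) (A : mat -> 'cV[C]_N -> W) :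
  (forall g, g \in unitmx -> linear (A g)) ->
  (forall g p v, g \in unitmx -> Parab p -> A (g *m p) v = A g (rhoM p *m v)) ->
  exists Phi : I -> W, linear Phi /\
    forall g v, g \in unitmx -> Phi (act g (gen v)) = A g v.
Proof.
move=> lA covA; case: (indP) => _ univ _.
pose f x v := \sum_(g | g \in unitmx) x g *: A g v.
have bal : balanced tau0 f.
  split=> [v a x y _ _|x _ a v w|x m v _ Lm].
  - rewrite /f scaler_sumr -big_split; apply: eq_bigr => g _ /=.
    by rewrite !ffunE scalerDl scalerA.
  - rewrite /f scaler_sumr -big_split; apply: eq_bigr => g ug /=.
    by rewrite lA // scalerDr !scalerA mulrC.
  - have um : m \in unitmx by case: Lm.
    rewrite /f (reindex_inj (can_inj (mulmxK um))) /=.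
    under eq_bigl do rewrite unitmx_mul um andbT.
    apply: eq_bigr => g ug; rewrite mul_elt // unitmx_mul ug um mulmxK //.
    by rewrite covA //; exact: Levi_Parab.
have [Phi [[lPhi PhiE] _]] := univ W _ bal.
exists Phi; split=> // g v ug; rewrite act_gen // PhiE; last exact: elt_CGeU.
rewrite /f (reindex_inj (can_inj (mulKmx ug))) /=.
under eq_bigl do rewrite unitmx_mul ug.
rewrite (bigID (fun u => `[< Urad u >])) /= [X in _ + X]big1 ?addr0; last first.
  by move=> u /andP[_ /negPf nU]; rewrite elt_mul // mulKmx // eUE nU mulr0 scale0r.
rewrite -[RHS]scale1r -sum_eU scaler_suml; apply: eq_big => [u|u /andP[uu /asboolP Uu]].
  by case: asboolP => [/Urad_unit ->|]; rewrite ?andbF.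
by rewrite elt_mul // mulKmx // covA ?(rhoM_U cusp) ?mul1mx //; exact: Urad_Parab.
Qed.

Definition Pset := [pred p : mat | `[< Parab p >]].
Definition Pnum := #|Pset|.

Lemma Pnum_gt0 : (0 < Pnum)%N.
Proof.
apply/card_gt0P; exists 1%:M; rewrite unfold_in /=.
by apply/asboolP; exact: Parab1.
Qed.

Lemma ParabMr g p : Parab p -> Parab (g *m p) <-> Parab g.
Proof.
move=> Pp; split=> [Pgp|Pg]; last exact: ParabM.
have -> : g = g *m p *m invmx p by rewrite mulmxK //; case: Pp.
by apply: ParabM => //; exact: ParabV.
Qed.

Lemma ParabMl g p : Parab p -> Parab (p *m g) <-> Parab g.
Proof.
move=> Pp; split=> [Pgp|Pg]; last exact: ParabM.
have -> : g = invmx p *m (p *m g) by rewrite mulKmx //; case: Pp.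
by apply: ParabM => //; exact: ParabV.
Qed.

Lemma ev_exists : exists ev : I -> 'cV[C]_N, linear ev /\
  forall g v, g \in unitmx -> ev (act g (gen v)) = if `[< Parab g >] then rhoM g *m v else 0.
Proof.
apply: ind_univ => [g ug|g p v ug Pp].
  by case: asboolP => _ a x y; [exact: mulmx_linear | rewrite scaler0 addr0].
rewrite (asbool_equiv_eq (ParabMr g Pp)); case: asboolP => // Pg.
by rewrite rhoM_M // mulmxA.
Qed.

(** Evaluation at 1, when the induced module is viewed as functions on the
    finite group with values in rho_M. *)
Definition ev : I -> 'cV[C]_N := projT1 (cid ev_exists).

Lemma ev_linear : linear ev.
Proof. by rewrite /ev; case: cid => ? []. Qed.

Lemma evE g v : g \in unitmx ->
  ev (act g (gen v)) = if `[< Parab g >] then rhoM g *m v else 0.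
Proof. by rewrite /ev; case: cid => ? [/= _]; exact. Qed.

Lemma ev_Parab p y : Parab p -> ev (act p y) = rhoM p *m ev y.
Proof.
move=> Pp; have up : p \in unitmx by case: Pp.
suff E : ev \o act p = mulmx (rhoM p) \o ev by exact: (congr1 (fun f => f y) E).
apply: ind_ext => [||g v ug].
- by apply: linear_comp; [exact: ev_linear | exact: act_linear].
- by apply: linear_comp; [exact: mulmx_linear | exact: ev_linear].
rewrite /= -actM // !evE ?unitmx_mul ?up //.
rewrite (asbool_equiv_eq (ParabMl g Pp)); case: asboolP => Pg; last by rewrite mulmx0.
by rewrite rhoM_M // mulmxA.
Qed.

(** On a translate of a generator by h only the terms g in h P survive, and they
    contribute equally. *)
Lemma ind_recon y : y = invn R Pnum *:
  \sum_(g | g \in unitmx) act g (gen (ev (act (invmx g) y))).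
Proof.
pose Rec y := invn R Pnum *: \sum_(g | g \in unitmx) act g (gen (ev (act (invmx g) y))).
rewrite -/(Rec y); suff -> : Rec = id by [].
apply: ind_ext => [a x z|//|h v uh].
  rewrite /Rec scalerA mulrC -scalerA -scalerDr; congr (_ *: _).
  rewrite scaler_sumr -big_split; apply: eq_bigr => g ug /=.
  by rewrite act_linear ?unitmx_inv // ev_linear gen_linear act_linear.
rewrite /Rec (reindex_inj (can_inj (mulKmx uh))) /=.
under eq_bigl do rewrite unitmx_mul uh.
rewrite (reindex_inj (inv_inj (@invmxK _ _))) /=.
under eq_bigl do rewrite unitmx_inv.
have inv g : g \in unitmx -> invmx (h *m invmx g) = g *m invmx h.
  by move=> ug; rewrite mul_invmx ?unitmx_inv // invmxK.
rewrite (bigID Pset) /= [X in _ + X]big1 ?addr0; last first.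
  move=> g /andP[ug /negPf nP]; rewrite -actM ?inv ?unitmx_mul ?unitmx_inv ?ug //.
  rewrite mulmxKV // evE // [asbool _]nP lin0 ?lin0 //; last exact: gen_linear.
  by apply: act_linear; rewrite unitmx_mul uh unitmx_inv.
rewrite (eq_bigr (fun=> act h (gen v))) => [|g /andP[ug Pg]].
  rewrite (eq_bigl (mem Pset)) => [|g].
    by rewrite sumr_const -scaler_nat scalerA invnK ?scale1r // Pnum_gt0.
  by apply: andb_idl => /asboolP[].
rewrite -actM ?inv ?unitmx_mul ?unitmx_inv ?ug // mulmxKV // evE //.
have -> : `[< Parab g >] = true := Pg; have {}Pg : Parab g by exact/asboolP.
by rewrite -act_Parab // -actM ?unitmx_mul ?uh ?unitmx_inv // mulmxKV.
Qed.

(** The kernel through which h acts as a convolution operator, by [ker_recon]. *)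
Definition ker_of (h : I -> I) g : 'M[C]_N :=
  \matrix_(a, b) ev (act (invmx g) (h (gen (delta_mx b 0)))) a 0.

Lemma matrix_of_linear (a1 a2 : nat) (f : 'cV[C]_a1 -> 'cV[C]_a2) (w : 'cV[C]_a1) : linear f ->
  (\matrix_(a, b) f (delta_mx b 0) a 0) *m w = f w.
Proof.
move=> lf; have wE : w = \sum_b w b 0 *: delta_mx b 0.
  apply/colP => a; rewrite summxE (bigD1 a) //= !mxE !eqxx mulr1 big1 ?addr0 // => b ba.
  by rewrite !mxE eq_sym (negPf ba) mulr0.
rewrite [in RHS]wE (lin_sum lf); apply/colP => a; rewrite !mxE summxE.
by apply: eq_bigr => b _; rewrite (linZ lf) !mxE mulrC.
Qed.

Lemma ker_ofE h g v : linear h -> g \in unitmx ->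
  ker_of h g *m v = ev (act (invmx g) (h (gen v))).
Proof.
move=> lh ug; rewrite /ker_of.
rewrite (matrix_of_linear (f := fun v => ev (act (invmx g) (h (gen v))))) //.
move=> a x y; rewrite gen_linear lh act_linear ?unitmx_inv // ev_linear //.
Qed.

Lemma cV_eq (a1 a2 : nat) (A B : 'M[C]_(a1, a2)) : (forall w : 'cV[C]_a2, A *m w = B *m w) -> A = B.
Proof.
move=> AB; apply/matrixP => a b; have /colP/(_ a) := AB (delta_mx b 0).
by rewrite -!colE !mxE.
Qed.

Lemma H1_lin h : H1 act h -> linear h. Proof. by case. Qed.
Lemma H1_act h g y : H1 act h -> g \in unitmx -> h (act g y) = act g (h y).
Proof. by case=> _ hA ug; exact: hA. Qed.

Lemma ker_bicov h : H1 act h -> bicov tau0 (ker_of h).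
Proof.
move=> Hh p g q Pp ug Pq; have lh := H1_lin Hh.
have [up uq] : p \in unitmx /\ q \in unitmx by case: Pp Pq => ? _ [].
have u1 : p *m (g *m q) \in unitmx by rewrite !unitmx_mul up ug uq.
apply: cV_eq => v; rewrite -!mulmxA !ker_ofE //.
rewrite -(act_Parab v (ParabV Pp)).
rewrite H1_act ?unitmx_inv // -ev_Parab; last exact: ParabV.
rewrite -!actM ?unitmx_mul ?unitmx_inv ?ug ?uq //; congr (ev (act _ _)).
by rewrite !mul_invmx ?unitmx_mul ?up ?ug // mulmxA.
Qed.

Lemma ker_recon h v : H1 act h -> h (gen v) =
  invn R Pnum *: \sum_(g | g \in unitmx) act g (gen (ker_of h g *m v)).
Proof.
move=> Hh; rewrite {1}[h _]ind_recon; congr (_ *: _); apply: eq_bigr => g ug.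
by rewrite ker_ofE //; exact: H1_lin.
Qed.

Lemma H1_ext h h' : H1 act h -> H1 act h' -> (forall v, h (gen v) = h' (gen v)) -> h = h'.
Proof.
move=> Hh Hh' e_; apply: ind_ext => [||g v ug]; [exact: H1_lin..|].
by rewrite !H1_act // e_.
Qed.

Lemma ker_inj h h' : H1 act h -> H1 act h' ->
  (forall g, g \in unitmx -> ker_of h g = ker_of h' g) -> h = h'.
Proof.
move=> Hh Hh' e_; apply: H1_ext => // v; rewrite !ker_recon //; congr (_ *: _).
by apply: eq_bigr => g ug; rewrite e_.
Qed.

Lemma H1_id : H1 act id. Proof. by split. Qed.

Lemma H1_mul h h' : H1 act h -> H1 act h' -> H1 act (mul1 h h').
Proof.
move=> Hh Hh'; split; first by apply: linear_comp; exact: H1_lin.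
by move=> g y ug; rewrite /mul1 /= !H1_act.
Qed.

Lemma H1_comb a h h' : H1 act h -> H1 act h' -> H1 act (a *: h + h').
Proof.
move=> Hh Hh'; split=> [c x y|g y ug].
  rewrite !fctE; rewrite !(H1_lin Hh, H1_lin Hh') !scalerDr !scalerA.
  by rewrite [a * c]mulrC addrACA.
by rewrite !fctE (H1_act y Hh ug) (H1_act y Hh' ug) act_linear.
Qed.

Lemma ker_mul h h' (x : mat) : H1 act h -> H1 act h' -> x \in unitmx -> ker_of (mul1 h h') x =
  invn R Pnum *: \sum_(g | g \in unitmx) ker_of h' (invmx g *m x) *m ker_of h g.
Proof.
move=> Hh Hh' ux; apply: cV_eq => v; have lh' := H1_lin Hh'.
have uV : invmx x \in unitmx by rewrite unitmx_inv.
rewrite ker_ofE //; last by apply: H1_lin; exact: H1_mul.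
rewrite /mul1 /= ker_recon // (linZ lh') (lin_sum lh') (linZ (act_linear uV)).
rewrite (lin_sum (act_linear uV)) (linZ ev_linear) (lin_sum ev_linear).
rewrite -scalemxAl; congr (_ *: _); rewrite mulmx_suml; apply: eq_bigr => g ug.
have u1 : invmx g *m x \in unitmx by rewrite unitmx_mul unitmx_inv ug.
rewrite (H1_act _ Hh' ug) -mulmxA (ker_ofE _ lh' u1) -actM //; congr (ev (act _ _)).
by rewrite mul_invmx ?unitmx_inv // invmxK.
Qed.

Lemma ker_id g : g \in unitmx ->
  ker_of id g = if `[< Parab g >] then rhoM (invmx g) else 0.
Proof.
move=> ug; apply: cV_eq => v; rewrite ker_ofE // evE ?unitmx_inv //.
have -> : `[< Parab (invmx g) >] = `[< Parab g >].
  by apply: asbool_equiv_eq; split=> [/ParabV|/ParabV //]; rewrite invmxK.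
by case: asboolP => _ //; rewrite mul0mx.
Qed.

Lemma ker_comb a h h' g : H1 act h -> H1 act h' -> g \in unitmx ->
  ker_of (a *: h + h') g = a *: ker_of h g + ker_of h' g.
Proof.
move=> Hh Hh' ug; apply: cV_eq => v.
rewrite mulmxDl -scalemxAl !ker_ofE //; try exact: H1_lin.
  by rewrite !fctE act_linear ?unitmx_inv // ev_linear.
by apply: H1_lin; exact: H1_comb.
Qed.

(** The operator e_U w e_U followed by the permutation of the tensor factors. *)
Definition opX (w : 'S_n) v : I := invn R Unum *:
  \sum_(u : mat | `[< Urad u >]) act (u *m blkperm k r w) (gen (gammamx R d w *m v)).

Lemma T_simple_form s h : is_T_simple beta act s h ->
  exists c, forall v, h (gen v) = c *: opX s v.
Proof.
move=> [_ [c hc] _]; exists c => v; have ub := blkperm_unit k r s.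
have := hc 1%:M v (unitmx1 _ _); rewrite !elt1_mul => ->; congr (_ *: _).
rewrite beta_span; last first.
  move=> g ng; rewrite mul_elt // (negPf ng) //.
rewrite (reindex_inj (can_inj (mulmxK ub))) /=.
under eq_bigl do rewrite unitmx_mul ub andbT.
rewrite (bigID (fun u => `[< Urad u >])) /= [X in _ + X]big1 ?addr0; last first.
  move=> u /andP[uu /negPf nU].
  by rewrite mul_elt // unitmx_mul uu ub mulmxK // eUE nU mulr0 scale0r.
rewrite /opX scaler_sumr; apply: eq_big => [u|u /andP[uu Uu]].
  by case: asboolP => [/Urad_unit ->|]; rewrite ?andbF.
by rewrite mul_elt // unitmx_mul uu ub mulmxK // eUE Uu mulr1.
Qed.

Lemma rho_conj_U u (w : 'S_n) : Urad u ->
  rhoM (invmx (blkperm k r w) *m u *m blkperm k r w) = 1%:M.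
Proof.
move=> [u1 _]; rewrite /Defs.rhoM -tensmx1; congr tensmx; apply/funext => i.
by rewrite invmx_blkperm blk_permr blk_perml u1 tau0_1.
Qed.

(** By [Bruhat_disjoint] the evaluation sees only the double coset of w, to which
    the term u = 1 contributes. *)
Lemma ker_opX h c (w : 'S_n) : linear h -> (forall v, h (gen v) = c *: opX w v) ->
  exists2 a : C, a != 0 & forall w',
    ker_of h (blkperm k r w') = if w' == w then (c * a) *: gammamx R d w else 0.
Proof.
move=> lh hE; pose Q (u : mat) := `[< Urad u >] &&
  `[< Parab (invmx (blkperm k r w) *m u *m blkperm k r w) >].
exists (invn R Unum * #|Q|%:R).
  rewrite mulf_neq0 ?invn_neq0 ?Unum_gt0 // pnatr_eq0 -lt0n; apply/card_gt0P.
  exists 1%:M; rewrite unfold_in /Q /=; apply/andP; split; apply/asboolP; first exact: Urad1.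
  by rewrite mulmx1 mulVmx ?blkperm_unit //; exact: Parab1.
have ub (z : 'S_n) := blkperm_unit k r z; move=> w'; apply: cV_eq => v.
have uV : invmx (blkperm k r w') \in unitmx by rewrite unitmx_inv.
rewrite ker_ofE // hE /opX !(linZ (act_linear uV)) !(linZ ev_linear).
rewrite (lin_sum (act_linear uV)) (lin_sum ev_linear).
have term u : `[< Urad u >] ->
    ev (act (invmx (blkperm k r w')) (act (u *m blkperm k r w) (gen (gammamx R d w *m v)))) =
    if (w' == w) && Q u then gammamx R d w *m v else 0.
  move=> Uu'; have Uu : Urad u by exact/asboolP.
  have uu := Urad_unit Uu.
  rewrite -actM ?unitmx_mul ?uu ?ub // evE ?unitmx_mul ?uV ?uu ?ub // mulmxA.
  case: asboolP => [Pp|nP]; last first.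
    by case: eqP => //= ww; rewrite /Q Uu'; case: asboolP => // P; case: nP; rewrite ww.
  have ww : w = w'.
    apply: (Bruhat_disjoint r_gt0 (Urad_Parab Uu) Pp).
    by rewrite !mulmxA mulmxV // mul1mx.
  rewrite /Q Uu' -ww eqxx /=; move: Pp; rewrite -ww; case: asboolP => // _ _.
  by rewrite rho_conj_U // mul1mx.
rewrite (eq_bigr _ term); case: eqP => [ww|_] /=; last by rewrite big1 ?mul0mx ?scaler0.
rewrite -big_mkcondr sumr_const -scaler_nat -!scalemxAl !scalerA.
congr (_ *: _); rewrite -!mulrA; congr (_ * (_ * _%:R)).
by apply: eq_card => u; rewrite unfold_in /= /Q andbA andbb.
Qed.

(** When lengths add, the inner e_U in e_U s e_U w e_U may be dropped: U is the
    product of a part that s moves into U, absorbed on the left, and of the root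
    subgroup of s, which w moves into U and so is absorbed on the right. *)
Lemma opX_mul (i j : 'I_n) (w : 'S_n) u' v : j = i.+1 :> nat -> (w i < w j)%N -> Urad u' ->
  \sum_(u : mat | `[< Urad u >]) act (u *m blkperm k r (tperm i j))
     (act (u' *m blkperm k r w) (gen v)) =
  \sum_(u : mat | `[< Urad u >]) act (u *m blkperm k r (tperm i j * w)%g) (gen v).
Proof.
move=> ij wij Uu'; set s := tperm i j; have ub (z : 'S_n) := blkperm_unit k r z.
have ij' : i != j by rewrite -val_eqE /= ij ltn_eqF.
pose X := blk u' i j.
pose Z : mat := \mxblock_(a < n, b < n) (if (a == i) && (b == j) then X else 0).
have ZE a b : blk Z a b = if (a == i) && (b == j) then X else 0 by exact: mxblockK.
have ZZ : Z *m Z = 0.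
  apply/blk_inj => a b; rewrite blkM [RHS]submxblock0 big1 // => c _; rewrite !ZE.
  case: (c =P j) => [->|_]; last by rewrite andbF mul0mx.
  by rewrite [j == i]eq_sym (negPf ij') mulmx0.
have Pm : (1%:M - Z) *m (1%:M + Z) = 1%:M.
  by rewrite mulmxBl !mulmxDr !mulmx1 !mul1mx ZZ addr0 addrK.
have [uM uP] := mulmx1_unit Pm.
pose a := u' *m (1%:M - Z).
have u'E : u' = a *m (1%:M + Z) by rewrite /a -mulmxA Pm mulmx1.
have U1Z : Urad (1%:M - Z).
  split=> [c|c l lc]; rewrite blkD blkN blk1 ZE.
    rewrite eqxx; case: eqP => [->|_] /=; last by rewrite subr0.
    by rewrite (negPf ij') subr0.
  rewrite -val_eqE gtn_eqF // raddf0 sub0r; case: eqP => [ci|_] /=; last by rewrite oppr0.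
  by case: eqP => [lj|_]; rewrite ?oppr0 //; move: lc; rewrite ci lj ij ltnNge leqnSn.
have Ua : Urad a by exact: UradM.
have aij : blk a i j = 0.
  rewrite /a mulmxBr mulmx1 blkD blkN blkM (bigD1 i) //= ZE !eqxx.
  rewrite big1 ?addr0; last by move=> c ci; rewrite ZE (negPf ci) mulmx0.
  by case: Uu' => -> _; rewrite mul1mx subrr.
have Usa : Urad (blkperm k r s *m a *m invmx (blkperm k r s)).
  rewrite invmx_blkperm; split=> [c|c l lc]; rewrite blk_permr blk_perml invgK.
    by case: Ua.
  have [a1 a0] := Ua; rewrite /s.
  have [cs|ci|/val_inj ce] := ltngtP (tperm i j l) (tperm i j c); first exact: a0.
    have [-> ->] := adj_flip ij lc ci; by rewrite tpermL tpermR.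
  by move: lc; rewrite (perm_inj ce) ltnn.
have UwZ : Urad (invmx (blkperm k r w) *m (1%:M + Z) *m blkperm k r w).
  rewrite invmx_blkperm; split=> [c|c l lc]; rewrite blk_permr blk_perml blkD blk1 ZE.
    rewrite eqxx; case: eqP => [->|_] /=; last by rewrite addr0.
    by rewrite (negPf ij') addr0.
  rewrite (inj_eq perm_inj) -[c == l]val_eqE gtn_eqF // raddf0 add0r.
  case: eqP => [ci|_] //=; case: eqP => [lj|_] //.
  by move: wij; rewrite -ci -lj !permKV ltnNge ltnW.
have [ua us] := (Urad_unit Ua, ub s).
rewrite [RHS](reindex_inj (can_inj (mulmxK (Urad_unit Usa)))) /=.
apply: eq_big => [u|u /asboolP Uu].
  apply: asbool_equiv_eq; split=> [Uu|Uu]; first exact: UradM.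
  by rewrite -[u](mulmxK (Urad_unit Usa)); apply: UradM => //; exact: UradV.
have uu := Urad_unit Uu.
have uZ := Urad_unit UwZ; have uU' := Urad_unit Uu'; have uSa := Urad_unit Usa.
have gz : act (invmx (blkperm k r w) *m (1%:M + Z) *m blkperm k r w) (gen v) = gen v.
  by rewrite act_Parab ?(rhoM_U cusp UwZ) ?mul1mx //; exact: Urad_Parab.
have u1 : u *m blkperm k r s \in unitmx by rewrite unitmx_mul uu us.
have u2 : u' *m blkperm k r w \in unitmx by rewrite unitmx_mul uU' ub.
have u3 : u *m (blkperm k r s *m a *m invmx (blkperm k r s)) *m blkperm k r (s * w)%g
    \in unitmx by rewrite unitmx_mul ub andbT unitmx_mul uu.
rewrite -[in RHS]gz -(actM _ u3 uZ) -(actM _ u1 u2); congr act.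
by rewrite {1}u'E blkpermM !mulmxA (mulmxKV us) (mulmxK (ub w)).
Qed.
End InducedRep.

(** * The finite Hecke algebra *)

Section Words.
Variable n : nat.
Implicit Types (s w : 'S_n) (ss : seq 'S_n).

(** The exchange condition: along a word for w the pair (a, b) with a < b gets
    reversed at some letter, and deleting that letter multiplies w by the
    transposition of a and b. *)
Lemma exchange ss (a b : 'I_n) : (forall s, s \in ss -> simple_refl s) -> (a < b)%N ->
  ((\prod_(s <- ss) s)%g b < (\prod_(s <- ss) s)%g a)%N ->
  exists ss', [/\ forall s, s \in ss' -> simple_refl s, (size ss').+1 = size ss &
                  (tperm a b * \prod_(s <- ss) s)%g = (\prod_(s <- ss') s)%g].
Proof.
elim: ss a b => [|s ss IH] a b simp ab.
  by rewrite big_nil !perm1 ltnNge ltnW.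
have simp' t : t \in ss -> simple_refl t by move=> ts; apply: simp; rewrite inE ts orbT.
have [i [j [ij sE]]] : simple_refl s by apply: simp; rewrite inE eqxx.
rewrite big_cons !permM => flip.
have [ba|ab'|e] := ltngtP (s b) (s a).
- rewrite sE in ba; have [ai bj] := adj_flip ij ab ba.
  exists ss; split=> //; rewrite sE ai bj mulgA -{1}(tpermV i j) mulVg mul1g //.
- have [ss' [simp'' sz e]] := IH _ _ simp' ab' flip.
  exists (s :: ss'); split=> [t||]; first 1 last.
  + by rewrite /= sz.
  + rewrite big_cons -e !mulgA; congr (_ * _)%g.
    by rewrite -tpermJ conjgE !mulgA mulgV mul1g.
  + by rewrite inE => /predU1P[->|/simp''//]; exists i, j.
- by move: ab; rewrite (perm_inj (val_inj e)) ltnn.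
Qed.

Lemma reduced_cons s ss w : reduced_word (s :: ss) w ->
  exists i j : 'I_n, [/\ j = i.+1 :> nat, s = tperm i j,
    reduced_word ss (\prod_(t <- ss) t)%g, w = (s * \prod_(t <- ss) t)%g &
    ((\prod_(t <- ss) t)%g i < (\prod_(t <- ss) t)%g j)%N].
Proof.
move=> [[simp wE] red]; rewrite big_cons in wE.
have simp' t : t \in ss -> simple_refl t by move=> ts; apply: simp; rewrite inE ts orbT.
have ss_s : simple_refl s by apply: simp; rewrite inE eqxx.
have [i [j [ij sE]]] := ss_s; exists i, j; split=> //.
  split=> // ss' [simp'' e].
  have := red (s :: ss'); rewrite /= ltnS; apply; split.
    by move=> t; rewrite inE => /predU1P[->|/simp''].
  by rewrite big_cons -e.
rewrite ltnNge; apply/negP; rewrite leq_eqVlt => /predU1P[e|flip].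
  by move: (perm_inj (val_inj e)) ij => ->; apply/eqP; rewrite ltn_eqF.
have ltij : (i < j)%N by rewrite ij.
have [ss' [simp'' sz e]] := exchange simp' ltij flip.
have : word_of ss' w by split=> //; rewrite wE sE.
by move=> /red; rewrite /= -sz ltnNge leqnSn.
Qed.

Lemma simple_neq1 s : simple_refl s -> s != 1%g.
Proof.
move=> [i [j [ij ->]]]; apply/eqP => /permP/(_ i); rewrite tpermL perm1 => e.
by move: ij; rewrite e => /eqP; rewrite ltn_eqF.
Qed.

Lemma reduced_size ss ss' w : reduced_word ss w -> reduced_word ss' w -> size ss = size ss'.
Proof. by move=> [w1 r1] [w2 r2]; apply/eqP; rewrite eqn_leq r1 ?r2. Qed.
End Words.

Lemma lin_transpose (K : fieldType) (V : lmodType K) (a b c e : K) (x y : V) :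
  a *: x + b *: y = c *: x + e *: y -> (a - c) *: x = (e - b) *: y.
Proof.
move=> E; rewrite !scalerBl; have -> : a *: x = c *: x + e *: y - b *: y by rewrite -E addrK.
by rewrite [LHS]addrC !addrA addNr add0r.
Qed.

Lemma scale2_eq0 (K : fieldType) (V : lmodType K) (a b : K) (x : V) :
  a *: (b *: x) = 0 -> b != 0 -> x != 0 -> a = 0.
Proof.
move=> /eqP; rewrite !scaler_eq0 => /orP[/eqP //|/orP[]/eqP ->]; by rewrite eqxx.
Qed.

Section FiniteHecke.
Variables (R : realType) (k : finFieldType) (n r d : nat).
Local Notation C := R[i].
Local Notation nr := (\sum_(i < n) r)%N.
Local Notation N := #|{: {ffun 'I_n -> 'I_d}}|.
Local Notation mat := 'M[k]_nr.
Local Notation ga := {ffun mat -> C}.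
Variable tau0 : 'M[k]_r -> 'M[C]_d.
Hypothesis cusp : irreducible_cuspidal tau0.
Hypothesis r_gt0 : (0 < r)%N.
Local Notation rhoM := (@rhoM R n d k r tau0).
Variables (I : lmodType C) (beta : ga -> 'cV[C]_N -> I) (act : mat -> I -> I).
Hypothesis indP : is_finInd tau0 beta act.
Variable T : 'S_n -> I -> I.
Hypothesis TP : is_T_basis beta act T.
Local Notation gen := (gen beta).
Local Notation opX := (opX beta act).
Local Notation ker_of := (ker_of cusp indP).
Local Notation q := ((#|k| ^ r)%:R : C).
Implicit Types (h : I -> I) (w s : 'S_n).

Lemma q_neq1 : q - 1 != 0.
Proof.
rewrite subr_eq0 (eqr_nat _ _ 1) gtn_eqF // -{1}(exp1n r) ltn_exp2r //.
exact: card_finNzRing_gt1.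
Qed.

Lemma q_neq0 : q != 0.
Proof. by rewrite pnatr_eq0 expn_eq0 -leqn0 leqNgt (ltnW (card_finNzRing_gt1 k)). Qed.

Lemma gamma_neq0 w : gammamx R d w != 0.
Proof.
apply/eqP => g0; have := gammamxKV R d w; rewrite g0 mul0mx.
have a := Ordinal (N_gt0 n cusp); move=> /matrixP/(_ a a).
by rewrite !mxE eqxx => /eqP; rewrite eq_sym oner_eq0.
Qed.

Lemma T_H1 s : simple_refl s -> H1 act (T s).
Proof. by case: TP => + _ => /[apply] -[]. Qed.

Lemma T_quad s : simple_refl s -> mul1 (T s) (T s) = (q - 1) *: T s + q *: id.
Proof. by case: TP => + _ => /[apply] -[]. Qed.

Lemma opX1 v : opX 1%g v = gen v.
Proof.
rewrite /opX gammamx1 mul1mx blkperm1 (eq_bigr (fun=> gen v)) => [|u /asboolP Uu].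
  rewrite sumr_const -scaler_nat scalerA invnK ?scale1r //; exact: Unum_gt0.
rewrite mulmx1 (act_Parab cusp indP) ?(rhoM_U cusp Uu) ?mul1mx //; exact: Urad_Parab.
Qed.

Lemma T_step s h (i j : 'I_n) w (c c' : C) : s = tperm i j -> j = i.+1 :> nat ->
  (w i < w j)%N -> H1 act (T s) -> (forall v, T s (gen v) = c *: opX s v) ->
  H1 act h -> (forall v, h (gen v) = c' *: opX w v) ->
  forall v, mul1 (T s) h (gen v) = (c * c') *: opX (s * w)%g v.
Proof.
move=> sE ij wij HT Tv Hh hv v; have lh := H1_lin Hh.
rewrite /mul1 /= Tv (linZ lh) -scalerA; congr (_ *: _).
rewrite [in LHS]/opX (linZ lh) (lin_sum lh).
pose Z (u : mat) := act (u *m blkperm k r (s * w)%g) (gen (gammamx R d (s * w)%g *m v)).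
have term u : `[< Urad u >] ->
    h (act (u *m blkperm k r s) (gen (gammamx R d s *m v))) =
    c' *: (invn R (Unum k n r) *: \sum_(u' : mat | `[< Urad u' >])
      act (u *m blkperm k r s) (act (u' *m blkperm k r w) (gen (gammamx R d (s * w)%g *m v)))).
  move=> /asboolP Uu; have uu : u *m blkperm k r s \in unitmx.
    by rewrite unitmx_mul Urad_unit // blkperm_unit.
  rewrite (H1_act _ Hh uu) hv (linZ (act_linear indP uu)) /opX (linZ (act_linear indP uu)).
  rewrite (lin_sum (act_linear indP uu)); congr (_ *: (_ *: _)).
  by apply: eq_bigr => u' _; rewrite gammamxM mulmxA.
rewrite (eq_bigr _ term) -!scaler_sumr exchange_big /=.
rewrite (eq_bigr (fun=> \sum_(u : mat | `[< Urad u >]) Z u)) => [|u' /asboolP Uu']; last first.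
  by rewrite /Z sE; exact: (opX_mul cusp indP _ ij wij Uu').
rewrite sumr_const [invn _ _ *: (_ *+ _)]invn_mulrn; last exact: Unum_gt0.
by rewrite scalerA mulrC -scalerA.
Qed.

Lemma ev_gen v : ev cusp indP (gen v) = v.
Proof.
rewrite -[gen v](act1 indP) evE ?unitmx1 // rhoM_1 // mul1mx.
by case: asboolP => // -[]; exact: Parab1.
Qed.

Lemma T_coef s : simple_refl s ->
  exists2 c, c != 0 & forall v, T s (gen v) = c *: opX s v.
Proof.
move=> ss; case: (TP) => /(_ s ss) Ts _; have [c Tc] := T_simple_form indP Ts.
exists c => //; apply/eqP => c0; have lT := H1_lin (T_H1 ss).
pose v : 'cV[C]_N := const_mx 1.
have := congr1 (fun f => f (gen v)) (T_quad ss).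
rewrite !fctE /mul1 /= Tc c0 scale0r (lin0 lT) scaler0 add0r => /esym e.
have := congr1 (ev cusp indP) e.
rewrite (linZ (ev_linear _ _)) (lin0 (ev_linear _ _)) ev_gen.
move=> /colP/(_ (Ordinal (N_gt0 n cusp))); rewrite !mxE mulr1 => /eqP.
by rewrite (negPf q_neq0).
Qed.

Lemma ker_prop a a' h h' g : H1 act h -> H1 act h' -> g \in unitmx ->
  (forall v, a *: h (gen v) = a' *: h' (gen v)) -> a *: ker_of h g = a' *: ker_of h' g.
Proof.
move=> Hh Hh' ug e; apply: cV_eq => v; have uV : invmx g \in unitmx by rewrite unitmx_inv.
rewrite -!scalemxAl (ker_ofE cusp indP v (H1_lin Hh) ug) (ker_ofE cusp indP v (H1_lin Hh') ug).
by rewrite -!(linZ (ev_linear _ _)) -!(linZ (act_linear indP uV)) e.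
Qed.

(** The braid relation conjugates neighbouring generators up to the ratio of
    their normalising constants; the quadratic relation has the non-opposite
    roots q^r and -1, which forces the ratio to be 1. *)
Lemma T_coef_adj (i j l : 'I_n) (cs ct : C) : j = i.+1 :> nat -> l = j.+1 :> nat ->
  cs != 0 -> ct != 0 ->
  (forall v, T (tperm i j) (gen v) = cs *: opX (tperm i j) v) ->
  (forall v, T (tperm j l) (gen v) = ct *: opX (tperm j l) v) -> cs = ct.
Proof.
move=> ij jl cs0 ct0; set s := tperm i j; set t := tperm j l => Ts Tt.
have ss : simple_refl s by exists i, j.
have st : simple_refl t by exists j, l.
have [HS HT] := (T_H1 ss, T_H1 st); have [lS lT] := (H1_lin HS, H1_lin HT).
have nij : i != j by rewrite -val_eqE /= ij ltn_eqF.
have njl : j != l by rewrite -val_eqE /= jl ltn_eqF.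
have nil : i != l by rewrite -val_eqE /= jl ij ltn_eqF // ltnW.
have ltij : (i < j)%N by rewrite ij.
have ltjl : (j < l)%N by rewrite jl.
have sl : s l = l by rewrite /s tpermD.
have ti : t i = i by rewrite /t tpermD // eq_sym.
have H_ts := H1_mul HT HS; have H_st := H1_mul HS HT.
have Hsts := H1_mul HS H_ts; have Htst := H1_mul HT H_st.
have ts_form v : mul1 (T t) (T s) (gen v) = (ct * cs) *: opX (t * s)%g v.
  apply: (T_step (erefl t) jl _ HT Tt HS Ts); rewrite sl /s tpermR.
  exact: ltn_trans ltjl.
have st_form v : mul1 (T s) (T t) (gen v) = (cs * ct) *: opX (s * t)%g v.
  apply: (T_step (erefl s) ij _ HS Ts HT Tt); rewrite ti /t tpermL.
  exact: ltn_trans ltjl.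
have sts_form v : mul1 (T s) (mul1 (T t) (T s)) (gen v) =
    (cs * (ct * cs)) *: opX (s * (t * s))%g v.
  apply: (T_step (erefl s) ij _ HS Ts H_ts ts_form).
  by rewrite !permM ti {1}/s tpermL /t tpermL sl.
have tst_form v : mul1 (T t) (mul1 (T s) (T t)) (gen v) =
    (ct * (cs * ct)) *: opX (t * (s * t))%g v.
  apply: (T_step (erefl t) jl _ HT Tt H_st st_form).
  by rewrite !permM sl /s tpermR ti /t tpermR.
have braid : (s * (t * s) = t * (s * t))%g.
  have e1 : (t ^ s = s ^ t)%g by rewrite !tpermJ sl ti /s tpermR /t tpermL.
  move: e1; rewrite !conjgE !tpermV => e1; by rewrite e1.
have E y : ct *: T s (T t (T s y)) = cs *: T t (T s (T t y)).
  suff e : ct *: mul1 (T s) (mul1 (T t) (T s)) + (- cs) *: mul1 (T t) (mul1 (T s) (T t)) = 0 *: id.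
    have := congr1 (fun f => f y) e; rewrite !fctE /mul1 /= scale0r scaleNr => /eqP.
    by rewrite subr_eq0 => /eqP ->.
  have H0 h : H1 act h -> H1 act (0 *: h).
    by move=> Hh; have := H1_comb indP (-1) Hh Hh; rewrite scaleN1r addNr scale0r.
  have HH := H1_comb indP (- cs) Htst (H0 _ Htst).
  rewrite scale0r addr0 in HH.
  apply: (H1_ext indP); [exact: (H1_comb indP) | apply: H0; exact: H1_id |].
  move=> v; have e1 := sts_form v; have e2 := tst_form v.
  rewrite !fctE scale0r; move: e1 e2 => /= -> ->.
  by rewrite braid !scalerA -scalerDl (_ : _ + _ = 0) ?scale0r //; ring.
have quad z (Tz : simple_refl z) y : T z (T z y) = (q - 1) *: T z y + q *: y.
  by have := congr1 (fun f => f y) (T_quad Tz); rewrite !fctE.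
have Ez (z : C) y : (z * ct) *: T s (T t (T s y)) = (z * cs) *: T t (T s (T t y)).
  by rewrite -!scalerA E.
have Ez' (z : C) y : (z * ct) *: T t (T s (T t (T s y))) =
    (z * cs) *: T t (T t (T s (T t y))).
  by rewrite -!scalerA; congr (_ *: _); rewrite -[LHS](linZ lT) E (linZ lT).
have main y : ((q - 1) * cs * (ct - cs)) *: T t (T s (T t y)) =
    (q * (cs ^+ 2 - ct ^+ 2)) *: T s (T t y).
  have lTS : linear (T t \o T s) by exact: linear_comp.
  have e1 : ct ^+ 2 *: T s (T t (T s (T s y))) =
      (ct * (q - 1) * cs) *: T t (T s (T t y)) + (ct ^+ 2 * q) *: T s (T t y).
    rewrite (quad s ss) lT (linZ lT) lS (linZ lS) scalerDr !scalerA; congr (_ + _).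
    by rewrite expr2 mulrAC; exact: Ez.
  have e2 : ct ^+ 2 *: T s (T t (T s (T s y))) =
      (cs ^+ 2 * (q - 1)) *: T t (T s (T t y)) + (cs ^+ 2 * q) *: T s (T t y).
    by rewrite expr2 Ez [ct * cs]mulrC Ez' (quad t st) scalerDr !scalerA -expr2.
  have := lin_transpose (etrans (esym e1) e2); move: q => Q.
  have -> : ct * (Q - 1) * cs - cs ^+ 2 * (Q - 1) = (Q - 1) * cs * (ct - cs) by ring.
  by have -> : cs ^+ 2 * Q - ct ^+ 2 * Q = Q * (cs ^+ 2 - ct ^+ 2) by ring.
have ug := blkperm_unit k r (t * (s * t))%g.
have := ker_prop Htst H_ts ug (fun v => main (gen v)).
have [a a0 ->] := ker_opX cusp r_gt0 indP (H1_lin Htst) tst_form.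
have [a' _ ->] := ker_opX cusp r_gt0 indP (H1_lin H_ts) ts_form.
rewrite eqxx (_ : _ == _ = false); last first.
  apply/eqP => /mulgI; rewrite -[s in RHS]mulg1 => /mulgI e.
  by move: (simple_neq1 st); rewrite e eqxx.
rewrite scaler0 => e0.
have nz : ct * (cs * ct) * a != 0 by rewrite !mulf_neq0.
have : (q - 1) * cs * (ct - cs) = 0 := scale2_eq0 e0 nz (gamma_neq0 _).
move=> /eqP; rewrite mulf_eq0 (negPf (mulf_neq0 q_neq1 cs0)) /= subr_eq0.
by move=> /eqP.
Qed.

Lemma T_const : exists2 c, c != 0 &
  forall s, simple_refl s -> forall v, T s (gen v) = c *: opX s v.
Proof.
have ex s : exists c, simple_refl s -> c != 0 /\ forall v, T s (gen v) = c *: opX s v.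
  have [ss|ns] := pselect (simple_refl s); last by exists 0.
  by have [c c0 cE] := T_coef ss; exists c.
have [c cP] := choice ex.
have step (m : nat) (i j i' j' : 'I_n) : (i' - i = m)%N -> (i <= i')%N ->
    j = i.+1 :> nat -> j' = i'.+1 :> nat -> c (tperm i j) = c (tperm i' j').
  elim: m i' j' => [|m IH] i' j' im ii ij ij'.
    have ei : i' = i by apply: val_inj => /=; lia.
    by congr (c (tperm _ _)); apply: val_inj => /=; rewrite ?ei // ij ij' ei.
  have lt : (i'.-1 < n)%N by have := ltn_ord i'; lia.
  pose p : 'I_n := Ordinal lt.
  have pi : i' = p.+1 :> nat by rewrite /=; lia.
  rewrite (IH p i') //=; try lia.
  have [p0 pE] := cP (tperm p i') (ex_intro _ p (ex_intro _ i' (conj pi erefl))).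
  have [i0 iE] := cP (tperm i' j') (ex_intro _ i' (ex_intro _ j' (conj ij' erefl))).
  exact: T_coef_adj pi ij' p0 i0 pE iE.
have [[s ss]|ns] := pselect (exists s, simple_refl (n := n) s); last first.
  by exists 1; [exact: oner_neq0 | move=> s ss; case: ns; exists s].
exists (c s); first by case: (cP s ss).
move=> t st; suff -> : c s = c t by case: (cP t st).
case: ss st => i [j [ij ->]] [i' [j' [ij' ->]]].
by have [le|/ltnW le] := leqP i i'; [|symmetry]; apply: step (erefl _) _ _ _.
Qed.

Definition prodT (ss : seq 'S_n) : I -> I := foldr (fun s x => mul1 (T s) x) id ss.

Lemma prodT_form c ss w : (forall s, simple_refl s -> forall v, T s (gen v) = c *: opX s v) ->
  reduced_word ss w ->
  H1 act (prodT ss) /\ forall v, prodT ss (gen v) = c ^+ size ss *: opX w v.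
Proof.
move=> cP; elim: ss w => [|s ss IH] w red.
  split; first exact: H1_id.
  by move=> v; case: red => -[_ ->] _; rewrite big_nil opX1 expr0 scale1r.
have [i [j [ij sE red' -> lt]]] := reduced_cons red; have [Hh hv] := IH _ red'.
have ss' : simple_refl s by exists i, j.
split; first by apply: H1_mul => //; exact: T_H1.
by move=> v; rewrite /= exprS; exact: (T_step sE ij lt (T_H1 ss') (cP s ss') Hh hv).
Qed.

(** By [prodT_form] both sides are the operator of w with a coefficient that only
    depends on the length of the word. *)
Lemma prodT_eq ss w : reduced_word ss w -> prodT ss = T w.
Proof.
move=> red; have [c c0 cP] := T_const; case: TP => _ /(_ w)[ss' red' ->].
have [H1 E1] := prodT_form cP red; have [H2 E2] := prodT_form cP red'.
by apply: (H1_ext indP) => // v; rewrite -/(prodT ss') E1 E2 (reduced_size red red').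
Qed.

Lemma T_H1w w : H1 act (T w).
Proof.
have [c c0 cP] := T_const; case: (TP) => _ /(_ w)[ss red ->].
by case: (prodT_form cP red).
Qed.

Lemma ker_T w : exists2 a : C, a != 0 & forall w',
  ker_of (T w) (blkperm k r w') = if w' == w then a *: gammamx R d w else 0.
Proof.
have [c c0 cP] := T_const; case: (TP) => _ /(_ w)[ss red _].
have [Hh hv] := prodT_form cP red; rewrite (prodT_eq red) in Hh hv.
have [a a0 aE] := ker_opX cusp r_gt0 indP (H1_lin Hh) hv.
by exists (c ^+ size ss * a) => //; rewrite mulf_neq0 // expf_neq0.
Qed.

Lemma ker_sum (J : Type) (js : seq J) (a : J -> C) (h : J -> I -> I) :
  (forall l, H1 act (h l)) -> H1 act (\sum_(l <- js) a l *: h l) /\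
  forall g, g \in unitmx -> ker_of (\sum_(l <- js) a l *: h l) g =
    \sum_(l <- js) a l *: ker_of (h l) g.
Proof.
move=> Hh; elim: js => [|l js [IH IHk]].
  have H0 : H1 act (0 : I -> I).
    by have := H1_comb indP (-1) (@H1_id R k n r I act) (@H1_id R k n r I act);
       rewrite scaleN1r addNr.
  split=> [|g ug]; first by rewrite big_nil.
  rewrite !big_nil; have := ker_comb cusp indP (-1) H0 H0 ug.
  by rewrite scaler0 addr0 scaleN1r addNr.
rewrite big_cons; split=> [|g ug]; first exact: (H1_comb indP).
by rewrite big_cons (ker_comb cusp indP _ (Hh l) IH ug) IHk.
Qed.

Lemma bicov_comb a (F1 F2 : mat -> 'M[C]_N) : bicov tau0 F1 -> bicov tau0 F2 ->
  bicov tau0 (fun g => F1 g - a *: F2 g).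
Proof.
move=> H1 H2 p g p' Pp ug Pp'; rewrite H1 // H2 // mulmxBr mulmxBl.
by rewrite -scalemxAr -scalemxAl.
Qed.

Lemma bicov_sum (J : Type) (js : seq J) (a : J -> C) (Fs : J -> mat -> 'M[C]_N) Fn :
  bicov tau0 Fn -> (forall l, bicov tau0 (Fs l)) ->
  bicov tau0 (fun g => Fn g - \sum_(l <- js) a l *: Fs l g).
Proof.
move=> H0 Hs; elim: js => [|l js IH].
  by move=> p g p' Pp ug Pp'; rewrite !big_nil !subr0 H0.
have -> : (fun g => Fn g - \sum_(m <- l :: js) a m *: Fs m g) =
    (fun g => (Fn g - \sum_(m <- js) a m *: Fs m g) - a l *: Fs l g).
  by apply/funext => g; rewrite big_cons opprD addrA addrAC.
exact: bicov_comb.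
Qed.

(** Both sides are determined by their scalars at the block permutations, and the
    kernel of T w is supported on the double coset of w. *)
Lemma bicov_expand Fn : bicov tau0 Fn -> exists a : 'S_n -> C,
  (forall w, Fn (blkperm k r w) = 0 -> a w = 0) /\
  forall g, g \in unitmx -> Fn g = \sum_w a w *: ker_of (T w) g.
Proof.
move=> bF; have ex w : exists a, (Fn (blkperm k r w) = 0 -> a = 0) /\
    Fn (blkperm k r w) = a *: ker_of (T w) (blkperm k r w).
  have [c cE] := bicov_scalar cusp w bF; have [x x0 xE] := ker_T w.
  exists (c / x); rewrite xE eqxx cE scalerA mulfVK //; split=> // /eqP.
  rewrite scaler_eq0 (negPf (gamma_neq0 w)) orbF => /eqP ->.
  by rewrite mul0r.
have [a aP] := choice ex; exists a; split=> [w|g ug]; first by case: (aP w).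
apply/eqP; rewrite -subr_eq0; apply/eqP.
apply: (bicov_zero cusp r_gt0 (Fn := fun g => Fn g - \sum_w a w *: ker_of (T w) g)) => // [|w].
  by apply: bicov_sum => // w; exact: (ker_bicov cusp indP (T_H1w w)).
rewrite (bigD1 w) //= (proj2 (aP w)) [X in _ - (_ + X)]big1 ?addr0 ?subrr // => w' ww'.
have [x _ ->] := ker_T w'; rewrite eq_sym (negPf ww') scaler0 //.
Qed.

Lemma T_span h : H1 act h -> exists a : 'S_n -> C, h = \sum_w a w *: T w.
Proof.
move=> Hh; have [a [_ aE]] := bicov_expand (ker_bicov cusp indP Hh).
have [Hs sE] := ker_sum (index_enum 'S_n) a T_H1w.
by exists a; apply: (ker_inj (cusp := cusp) (indP := indP) Hh Hs) => g ug; rewrite sE // aE.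
Qed.

Lemma T_free (a : 'S_n -> C) : \sum_w a w *: T w = 0 -> forall w, a w = 0.
Proof.
move=> s0 w; have [_ sE] := ker_sum (index_enum 'S_n) a T_H1w.
have := sE _ (blkperm_unit k r w); rewrite s0.
have -> : ker_of 0 (blkperm k r w) = 0.
  apply/matrixP => x y; rewrite mxE [in RHS]mxE.
  rewrite (lin0 (act_linear indP _)) ?unitmx_inv ?blkperm_unit //.
  by rewrite (lin0 (ev_linear _ _)) mxE.
rewrite (bigD1 w) //= [X in _ + X]big1 ?addr0 => [|w' ww'].
  have [x x0 ->] := ker_T w; rewrite eqxx => /esym e.
  exact: scale2_eq0 e x0 (gamma_neq0 w).
by have [x _ ->] := ker_T w'; rewrite eq_sym (negPf ww') scaler0.
Qed.

Lemma T_basis : is_basis (H1 act) T.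
Proof.
split; last exact: T_free.
apply/seteqP; split=> h; first exact: T_span.
by move=> [a ->]; case: (ker_sum (index_enum 'S_n) a T_H1w).
Qed.
End FiniteHecke.

(** * Representations of GL over a local field *)

Section Representations.
Variables (R : realType) (F : localField) (m : nat).
Variables (V : lmodType R[i]) (pi : 'M[F]_m -> V -> V).
Hypothesis piP : is_rep (@GL F m) setT pi.
Local Notation VK := (fixed (@Kplus F m) pi).

Lemma pi_linear g : g \in unitmx -> linear (pi g).
Proof. by move=> ug; case: piP => _ pl _ _; apply: linear_onT; exact: pl. Qed.

Lemma pi_M g x v : g \in unitmx -> x \in unitmx -> pi (g *m x) v = pi g (pi x v).
Proof. by move=> ug ux; case: piP => _ _ _; exact. Qed.

Lemma pi_1 v : pi 1%:M v = v.
Proof. by case: piP => _ _ + _; exact. Qed.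

Lemma pi_red g g' v : Kmax g -> Kmax g' -> mxred g = mxred g' -> VK v -> pi g v = pi g' v.
Proof.
move=> Kg Kg' e Vv; rewrite -[g'](mulKVmx (Kmax_unit Kg)).
have Kp := Kplus_div Kg Kg' e.
have [uk _] := Kp; rewrite pi_M ?(Kmax_unit Kg) ?(Kmax_unit uk) //.
by congr pi; rewrite (Vv _ Kp).
Qed.

Lemma VK_stable g v : Kmax g -> VK v -> VK (pi g v).
Proof.
move=> Kg Vv x Kx; have [ug ux] := (Kmax_unit Kg, Kmax_unit Kx.1).
rewrite -pi_M //; apply: pi_red => //; first by apply: KmaxM => //; case: Kx.
by rewrite mxredM ?Kx.2 ?mul1mx //; [exact: Kmax_int Kx.1 | exact: Kmax_int].
Qed.

(** An element of K_+ permutes the cosets over which the average is taken, and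
    pi x v depends only on the coset of x. *)
Lemma average_fixed j (s : seq 'M[F]_m) v : coset_reps j s -> fixed (@Kcong F m j) pi v ->
  VK (invn R (size s) *: \sum_(x <- s) pi x v).
Proof.
move=> [s0 sK sg] vj g Kg; have ug := Kmax_unit Kg.1.
rewrite (linZ (pi_linear ug)) (lin_sum (pi_linear ug)); congr (_ *: _).
have [f [ps fE]] := sg g Kg; rewrite -[RHS](perm_big _ ps) /= big_map.
rewrite !big_seq; apply: eq_bigr => x xs.
have ux := Kmax_unit (sK x xs).1.
have uf : f x \in unitmx.
  by apply: Kmax_unit; apply: (proj1 (sK _ _)); rewrite -(perm_mem ps) map_f.
have e := fE x xs; have ue := Kcong_unit e.
by rewrite -pi_M // -[g *m x](mulKVmx uf) pi_M // (vj _ e).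
Qed.
End Representations.

(** * The Hecke algebra of the type *)

Section HeckeSide.
Variables (R : realType) (F : localField) (n r d : nat).
Local Notation C := R[i].
Local Notation k := (lf_res F).
Local Notation nr := (\sum_(i < n) r)%N.
Local Notation N := #|{: {ffun 'I_n -> 'I_d}}|.
Local Notation mat := 'M[F]_nr.
Local Notation kmat := 'M[k]_nr.
Variable tau0 : 'M[k]_r -> 'M[C]_d.
Hypothesis cusp : irreducible_cuspidal tau0.
Hypothesis r_gt0 : (0 < r)%N.
Local Notation rhoM := (@rhoM R n d k r tau0).
Variables (I : lmodType C) (beta : {ffun kmat -> C} -> 'cV[C]_N -> I).
Variable act : kmat -> I -> I.
Hypothesis indP : is_finInd tau0 beta act.
Variable T : 'S_n -> I -> I.
Hypothesis TP : is_T_basis beta act T.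
Variables (mu : (mat -> C) -> C) (muP : is_haar mu).
Variable b : 'S_n -> mat -> 'M[C]_N.
Hypothesis bP : is_hecke_basis tau0 mu b.
Local Notation gen := (gen beta).
Local Notation ker_of := (ker_of cusp indP).
Local Notation J := (@Jgrp F n r).
Implicit Types (h : I -> I) (w s : 'S_n) (f : mat -> 'M[C]_N) (g x : mat).

Lemma J_Kmax g : J g -> Kmax g.
Proof. by move=> /JgrpP[]. Qed.

Lemma J_Parab g : J g -> Parab (mxred g).
Proof. by move=> /JgrpP[]. Qed.

Lemma Kplus_J g : Kplus g -> J g.
Proof. by move=> [Kg rg]; apply/JgrpP; rewrite rg; split=> //; exact: Parab1. Qed.

Lemma lft_J (p : kmat) : Parab p -> J (lft p).
Proof. by move=> Pp; apply/JgrpP; rewrite lftK; split=> //; apply: lft_Kmax; case: Pp. Qed.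

Lemma rhodE g : Kmax g -> rhod tau0 g = (rhoM (invmx (mxred g)))^T.
Proof. by move=> Kg; rewrite /rhod /rho mxredV. Qed.

Lemma Kmax_mulr g x : Kmax x -> Kmax (g *m x) <-> Kmax g.
Proof.
move=> Kx; split=> [Kgx|Kg]; last exact: KmaxM.
by rewrite -(mulmxK (Kmax_unit Kx) g); apply: KmaxM => //; exact: KmaxV.
Qed.

Lemma Kmax_mull g x : Kmax x -> Kmax (x *m g) <-> Kmax g.
Proof.
move=> Kx; split=> [Kgx|Kg]; last exact: KmaxM.
by rewrite -(mulKmx (Kmax_unit Kx) g); apply: KmaxM => //; exact: KmaxV.
Qed.

(** The inverse of the volume of J, by [mu_J]. *)
Definition volJV : C := (vol mu * (Pnum k n r)%:R)^-1.

Lemma volJV_neq0 : volJV != 0.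
Proof.
rewrite invr_eq0 mulf_neq0 ?(vol_neq0 muP) // pnatr_eq0 -lt0n; exact: Pnum_gt0.
Qed.

Lemma vol_volJV : vol mu * volJV = invn R (Pnum k n r).
Proof. by rewrite /volJV invfM mulrA mulfV ?mul1r // (vol_neq0 muP). Qed.

(** The Hecke operator supported on K that corresponds to an endomorphism of the
    finite induced representation. *)
Definition Psi h : mat -> 'M[C]_N := fun g =>
  if `[< Kmax g >] then volJV *: (ker_of h (mxred g))^T else 0.

Lemma hconv_fin (f1 f2 : mat -> 'M[C]_N) (F1 F2 : kmat -> 'M[C]_N) x :
  (forall g, f1 g = if `[< Kmax g >] then F1 (mxred g) else 0) ->
  (forall g, f2 g = if `[< Kmax g >] then F2 (mxred g) else 0) ->
  hconv mu f1 f2 x = if `[< Kmax x >] then vol mu *: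
    \sum_(y : kmat | y \in unitmx) F1 y *m F2 (invmx y *m mxred x) else 0.
Proof.
move=> f1E f2E; rewrite /hconv.
rewrite (vint_fin muP (h0 := fun y => if `[< Kmax x >] then
    F1 y *m F2 (invmx y *m mxred x) else 0)) => [|g ug Kg|g ug nK].
- case: asboolP => _ //; by rewrite [X in _ *: X]big1 ?scaler0.
- rewrite f1E f2E; case: asboolP => // _.
  rewrite (asbool_equiv_eq (Kmax_mull x (KmaxV Kg))); case: asboolP => [Kx|_].
    rewrite mxredM ?mxredV //; [exact: Kmax_int (KmaxV Kg) | exact: Kmax_int].
  by rewrite mulmx0.
- by rewrite f1E; case: asboolP => // _; rewrite mul0mx.
Qed.

Lemma Psi_mul h h' : H1 act h -> H1 act h' ->
  hconv mu (Psi h) (Psi h') = Psi (mul1 h h').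
Proof.
move=> Hh Hh'; apply/funext => x; rewrite /Psi.
rewrite (hconv_fin (F1 := fun y => volJV *: (ker_of h y)^T)
                   (F2 := fun y => volJV *: (ker_of h' y)^T)) //.
case: asboolP => // Kx; rewrite (ker_mul cusp indP Hh Hh') ?Kmax_red //.
set S := (X in invn R _ *: X).
transitivity (vol mu *: ((volJV * volJV) *: S^T)).
  congr (_ *: _); rewrite /S raddf_sum /= scaler_sumr; apply: eq_bigr => y _.
  by rewrite trmx_mul -scalemxAl -scalemxAr scalerA.
by rewrite -vol_volJV trmxZ !scalerA mulrCA.
Qed.

Lemma mu_J : mu (fun x => (`[< J x >])%:R) = vol mu * (Pnum k n r)%:R.
Proof.
have PA (p : 'I_(Pnum k n r)) : Parab (enum_val p : kmat).
  by apply/asboolP; exact: (enum_valP p).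
rewrite (_ : (fun x => _) = fun x => \sum_(p < Pnum k n r) 1 * cind R 0 (lft (enum_val p)) x).
  rewrite (mu_sum muP) => [|p]; last first.
    by apply: Cc_ind; apply: Kmax_unit; apply: lft_Kmax; case: (PA p).
  rewrite (eq_bigr (fun=> vol mu)) => [|p _]; last first.
    by rewrite mul1r (mu_ind muP) //; apply: Kmax_unit; apply: lft_Kmax; case: (PA p).
  by rewrite sumr_const card_ord mulr_natr.
apply/funext => x.
under eq_bigr => p _ do rewrite mul1r cind_lft ?(proj1 (PA p)) //.
case: asboolP => [/JgrpP[Kx Px]|nJ].
  have xP : mxred x \in Pset k n r by apply/asboolP.
  rewrite (bigD1 (enum_rank_in xP (mxred x))) //= enum_rankK_in // eqxx andbT.
  case: asboolP => // _; rewrite big1 ?addr0 // => p pne.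
  case: eqP => // e; case/eqP: pne; apply: enum_val_inj.
  by rewrite enum_rankK_in.
rewrite big1 // => p _; case: asboolP => // Kx; case: eqP => // e.
by case: nJ; apply/JgrpP; split=> //; rewrite e; exact: PA.
Qed.

Lemma Psi_id : Psi id = hone tau0 mu.
Proof.
apply/funext => g; rewrite /Psi /hone mu_J -/volJV.
case: asboolP => Kg; last by case: asboolP => // /J_Kmax.
rewrite (ker_id cusp indP (Kmax_red Kg)) rhodE //.
have -> : `[< J g >] = `[< Parab (mxred g) >].
  by apply: asbool_equiv_eq; split=> [/J_Parab //|Pg]; apply/JgrpP.
by case: asboolP => // _; rewrite linear0 scaler0.
Qed.

Lemma Psi_comb a h h' : H1 act h -> H1 act h' -> Psi (a *: h + h') = a *: Psi h + Psi h'.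
Proof.
move=> Hh Hh'; apply/funext => g; rewrite !fctE /Psi.
case: asboolP => Kg; last by rewrite scaler0 addr0.
by rewrite (ker_comb cusp indP _ Hh Hh' (Kmax_red Kg)) linearD /= trmxZ scalerDr !scalerA [a * _]mulrC.
Qed.

Lemma Psi_inj h h' : H1 act h -> H1 act h' -> Psi h = Psi h' -> h = h'.
Proof.
move=> Hh Hh' e; apply: (ker_inj (cusp := cusp) (indP := indP) Hh Hh') => y uy.
have := congr1 (fun f => f (lft y)) e; rewrite /Psi lftK.
case: asboolP => [_|[]]; last exact: lft_Kmax.
by move=> /(scalerI volJV_neq0) /trmx_inj.
Qed.

Lemma Psi_hecke h : H1 act h -> hecke tau0 (Psi h).
Proof.
move=> Hh; split.
- by move=> g ug; rewrite /Psi; case: asboolP => // /Kmax_unit; rewrite (negPf ug).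
- exists [:: 1%:M] => g; rewrite /Psi; case: asboolP => // Kg _.
  exists 1%:M, g; rewrite inE eqxx mul1mx; split=> //; exact: unitmx1.
- move=> x g x' Jx ug Jx'; have [Kx Kx'] := (J_Kmax Jx, J_Kmax Jx').
  rewrite /Psi (asbool_equiv_eq (Kmax_mulr _ Kx')) (asbool_equiv_eq (Kmax_mull _ Kx)).
  case: asboolP => Kg; last by rewrite mulmx0 mul0mx.
  rewrite !rhodE // !mxredM; try exact: Kmax_int; last by apply/intmxM; exact: Kmax_int.
  rewrite (ker_bicov cusp indP Hh (J_Parab Jx) (Kmax_red Kg) (J_Parab Jx')).
  by rewrite !trmx_mul mulmxA -scalemxAr -scalemxAl.
Qed.

(** The operator b s is bicovariant on K and supported on the double coset of s,
    so it is a multiple l of [Psi (T s)]. Comparing the two quadratic relations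
    gives l ^+ 2 = 1 from the constant term and l = 1 from the linear term. *)
Lemma b_simple s : simple_refl s -> Psi (T s) = b s.
Proof.
move=> ss; case: bP => /(_ s ss)[[f0 _ fcov] supp quad] _.
have suppK g : b s g <> 0 -> Kmax g.
  move=> /supp[x [x' [/J_Kmax Kx /J_Kmax Kx' ->]]].
  by apply: KmaxM => //; apply: KmaxM => //; exact: Kmax_blkperm.
have rhod1 g : Kplus g -> rhod tau0 g = 1%:M.
  by move=> [Kg rg]; rewrite rhodE // rg invmx1 rhoM_1 // trmx1.
have bred g g' : Kmax g -> Kmax g' -> mxred g = mxred g' -> b s g = b s g'.
  move=> Kg Kg' e; have ug := Kmax_unit Kg; rewrite -[g'](mulKVmx ug).
  have Kp := Kplus_div Kg Kg' e; rewrite -[X in _ = b s (X *m _)]mul1mx.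
  rewrite (fcov _ _ _ (Kplus_J (Kplus1 _ _)) ug (Kplus_J Kp)).
  by rewrite !rhod1 ?mul1mx ?mulmx1 //; exact: Kplus1.
pose Fb (y : kmat) := (b s (lft y))^T.
have bFb : bicov tau0 Fb.
  move=> p y q Pp uy Pq; rewrite /Fb.
  have up : p \in unitmx by case: Pp.
  have uq : q \in unitmx by case: Pq.
  rewrite (bred _ (lft p *m lft y *m lft q)).
  - rewrite fcov; [|exact: lft_J|exact: Kmax_unit (lft_Kmax uy)|exact: lft_J].
    by rewrite !rhodE ?lftK; [rewrite !trmx_mul !trmxK mulmxA | exact: lft_Kmax..].
  - by apply: lft_Kmax; rewrite !unitmx_mul up uy.
  - by apply: KmaxM; [apply: KmaxM|]; exact: lft_Kmax.
  - by rewrite mxredM ?mxredM ?lftK //; try exact: lft_int; apply: intmxM; exact: lft_int.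
have [a [a0 aE]] := bicov_expand cusp r_gt0 indP TP bFb.
have Fb0 w : w != s -> a w = 0.
  move=> ws; apply: a0; rewrite /Fb; apply: contrapT => nz.
  have /supp[x [x' [Jx Jx' e]]] : b s (lft (blkperm k r w)) <> 0.
    by move=> e; apply: nz; rewrite e linear0.
  have [Kx Kx'] := (J_Kmax Jx, J_Kmax Jx').
  have := congr1 (@mxred F nr) e; rewrite lftK !mxredM; try exact: Kmax_int; last first.
  - by apply: intmxM; apply: Kmax_int => //; exact: Kmax_blkperm.
  - exact: Kmax_int (Kmax_blkperm _ _ _).
  rewrite red_blkperm => E.
  have ux' := Kmax_red Kx'; case/eqP: ws; symmetry.
  apply: (Bruhat_disjoint r_gt0 (J_Parab Jx) (ParabV (J_Parab Jx'))).
  by rewrite E mulmxK.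
pose l := a s / volJV.
have bE : b s = Psi (l *: T s).
  apply/funext => g; rewrite /Psi; case: asboolP => [Kg|nK]; last first.
    by apply: contrapT => /suppK.
  have ug := Kmax_red Kg.
  have ker_l : ker_of (l *: T s) (mxred g) = l *: ker_of (T s) (mxred g).
    have [_ /(_ _ ug)] := ker_sum cusp indP [:: tt] (fun=> l) (fun=> T_H1 TP ss).
    by rewrite !big_seq1.
  rewrite ker_l trmxZ scalerA mulrC mulfVK ?volJV_neq0 //.
  have := aE _ ug; rewrite (bigD1 s) //= [X in _ + X]big1 ?addr0 => [E|w /Fb0 ->]; last by rewrite scale0r.
  rewrite -trmxZ -E /Fb trmxK; apply: bred => //; first exact: lft_Kmax.
  by rewrite lftK.
have HT := T_H1 TP ss; have Hid := @H1_id R k n r I act.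
have Hl : H1 act (l *: T s).
  have [] := ker_sum cusp indP [:: tt] (fun=> l) (fun=> HT).
  by rewrite big_seq1.
have q1 := q_neq1 R k r_gt0.
set q : C := (#|k| ^ r)%:R in quad q1.
have Hqid : H1 act (q *: id).
  have [] := ker_sum cusp indP [:: tt] (fun=> q) (fun=> Hid).
  by rewrite big_seq1.
have quadl : mul1 (l *: T s) (l *: T s) = (q - 1) *: (l *: T s) + q *: id.
  apply: Psi_inj; [exact: H1_mul | exact: (H1_comb indP) |].
  rewrite -Psi_mul // -bE quad Psi_comb //; congr (_ + _); first by rewrite -bE.
  rewrite -Psi_id; have := Psi_comb q Hid (H1_comb indP (-1) Hid Hid).
  rewrite scaleN1r addNr addr0 => ->.
  have -> : Psi 0 = 0; last by rewrite addr0.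
  have := Psi_comb (-1) Hid Hid; rewrite !scaleN1r !addNr //.
have lT := H1_lin HT.
have pt v : (l ^+ 2 * (q - 1) - (q - 1) * l) *: T s (gen v) = (q - l ^+ 2 * q) *: gen v.
  have e1 := congr1 (fun z : I -> I => z (gen v)) quadl.
  have e2 := congr1 (fun z : I -> I => z (gen v)) (T_quad TP ss).
  move: e1 e2; rewrite !fctE /mul1 /= -/q => e1 e2.
  rewrite (linZ lT) e2 !scalerDr !scalerA -expr2 in e1.
  exact: lin_transpose e1.
have ub w := blkperm_unit k r w.
have KT := fun w => ker_prop cusp indP HT Hid (ub w) pt.
have [x x0 xE] := ker_T cusp r_gt0 indP TP s.
have k1 w : ker_of id (blkperm k r w) = if w == 1%g then 1%:M else 0.
  have := ker_opX cusp r_gt0 indP (w := 1%g) (h := id) (c := 1).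
  case=> [//|v|c c0 cE]; first by rewrite scale1r (opX1 cusp indP).
  rewrite cE mul1r; case: eqP => // _.
  have := cE 1%g; rewrite eqxx mul1r => <-; rewrite blkperm1 ker_id ?unitmx1 //.
  case: asboolP => [_|[]]; last exact: Parab1.
  by rewrite invmx1 rhoM_1.
have s1 := negPf (simple_neq1 ss).
have l1 : l ^+ 2 * (q - 1) - (q - 1) * l = 0.
  have := KT s; rewrite xE k1 s1 eqxx scaler0 => e.
  exact: (scale2_eq0 e x0 (gamma_neq0 cusp s)).
have l2 : q - l ^+ 2 * q = 0.
  have := KT 1%g; rewrite xE k1 eq_sym s1 eqxx scaler0 => /esym e.
  have a1 := Ordinal (N_gt0 n cusp).
  by have /matrixP/(_ a1 a1) := e; rewrite !mxE eqxx mulr1.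
have l21 : l ^+ 2 = 1.
  apply/eqP; rewrite -subr_eq0 -oppr_eq0 opprB.
  have q0 : q != 0 by exact: (@q_neq0 R k r).
  by have := l2; rewrite -[X in X - _]mul1r -mulrBl => /eqP; rewrite mulf_eq0 (negPf q0) orbF.
have {}l1 : l = 1.
  move: l1; rewrite l21 mul1r -[X in X - _]mulr1 -mulrBr => /eqP.
  by rewrite mulf_eq0 (negPf q1) /= subr_eq0 => /eqP.
by rewrite bE l1 scale1r.
Qed.

Lemma Psi_T w : Psi (T w) = b w.
Proof.
case: bP => _ /(_ w)[ss red ->]; rewrite -(prodT_eq cusp r_gt0 indP TP red).
case: red => -[simp _] _.
suff [] : H1 act (prodT T ss) /\ Psi (prodT T ss) =
  foldr (fun s f => hconv mu (b s) f) (hone tau0 mu) ss by [].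
elim: ss simp => [|s ss IH] simp /=; first by split; [exact: H1_id | exact: Psi_id].
have ss' : simple_refl s by apply: simp; rewrite inE eqxx.
have [|HH <-] := IH; first by move=> t ts; apply: simp; rewrite inE ts orbT.
by split; [apply: H1_mul => //; exact: (T_H1 TP) | rewrite -b_simple // Psi_mul //; exact: (T_H1 TP)].
Qed.

Lemma Psi_sum (a : 'S_n -> C) : Psi (\sum_w a w *: T w) = \sum_w a w *: b w.
Proof.
apply/funext => g; rewrite /Psi.
have [_ sE] := ker_sum cusp indP (index_enum 'S_n) a (T_H1w cusp r_gt0 indP TP).
have -> : (\sum_w a w *: b w) g = \sum_w a w *: b w g by rewrite fct_sumE.
case: asboolP => [Kg|nK].
  rewrite sE ?Kmax_red // linear_sum /= scaler_sumr; apply: eq_bigr => w _.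
  rewrite -Psi_T /Psi trmxZ.
  by case: asboolP => // _; rewrite !scalerA mulrC.
by rewrite big1 // => w _; rewrite -Psi_T /Psi; case: asboolP => // _; rewrite scaler0.
Qed.

Lemma H1_spanE h : H1 act h <-> exists a : 'S_n -> C, h = \sum_w a w *: T w.
Proof.
split=> [/(T_span cusp r_gt0 indP TP)//|[a ->]].
by have [] := ker_sum cusp indP (index_enum 'S_n) a (T_H1w cusp r_gt0 indP TP).
Qed.

Lemma b_hecke : lin_span b `<=` hecke tau0.
Proof.
move=> f [a ->]; rewrite -Psi_sum; apply: Psi_hecke; apply/H1_spanE.
by exists a.
Qed.

Lemma b_basis : is_basis (lin_span b) b.
Proof.
split=> // a s0; apply: (T_free cusp r_gt0 indP TP).
have Hs : H1 act (\sum_w a w *: T w) by apply/H1_spanE; exists a.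
have H0 : H1 act (0 : I -> I).
  by apply/H1_spanE; exists (fun=> 0); rewrite big1 // => w _; rewrite scale0r.
apply: Psi_inj => //; rewrite Psi_sum s0 -[in RHS](subrr id) -scaleN1r addrC.
have Hid := @H1_id R k n r I act.
by rewrite (Psi_comb _ Hid Hid) scaleN1r addNr.
Qed.

Lemma Psi_iso : algebra_iso (@mul1 R I) id (H1 act) (hconv mu) (hone tau0 mu) (lin_span b) Psi.
Proof.
split.
- by move=> a h h'; exact: Psi_comb.
- split.
  + by move=> h /H1_spanE[a ->]; rewrite Psi_sum; exists a.
  + by move=> h h'; rewrite !inE; exact: Psi_inj.
  + by move=> f [a ->]; exists (\sum_w a w *: T w); [apply/H1_spanE; exists a | exact: Psi_sum].
- exact: Psi_id.
- by move=> h h' Hh Hh'; rewrite Psi_mul.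
Qed.

Section OnRepresentation.
Variables (V : lmodType C) (pi : mat -> V -> V).
Hypothesis piP : is_rep (@GL F nr) setT pi.
Local Notation VK := (fixed (@Kplus F nr) pi).
Local Notation res := (fun (Phi : I -> V) v => Phi (beta (ga_eU R k n r) v)).

Lemma HomJ_PF : HomJ tau0 pi = HomPF tau0 pi.
Proof.
apply/seteqP; split=> phi.
  move=> [lphi phiJ]; split=> // [v x Kx|g v Kg Pg].
    rewrite -phiJ; last exact: Kplus_J.
    by rewrite /rho Kx.2 rhoM_1 // mul1mx.
  by rewrite -phiJ //; apply/JgrpP.
move=> [lphi _ phiP]; split=> // x v Jx.
by rewrite -phiP //; [exact: J_Kmax | exact: J_Parab].
Qed.

Lemma HomGF_gen Phi g v : HomGF act pi Phi -> Kmax g ->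
  Phi (act (mxred g) v) = pi g (Phi v).
Proof. by case=> _ _; exact. Qed.

Lemma res_bij : set_bij (HomGF act pi) (HomPF tau0 pi) res.
Proof.
split.
- move=> Phi HPhi; have [lPhi PhiV _] := HPhi; split=> [|v|g v Kg Pg].
  + exact: (linear_comp lPhi (gen_linear indP)).
  + exact: PhiV.
  + by rewrite -[beta _ _]/(gen _) -(act_Parab cusp indP) // HomGF_gen.
- move=> Phi Phi' /set_mem HP /set_mem HP' e.
  have [lP _ _] := HP; have [lP' _ _] := HP'.
  apply: (ind_ext indP) => // g v ug; have Kg := lft_Kmax ug.
  by rewrite -[g]lftK !HomGF_gen //; congr pi; exact: (congr1 (fun z => z v) e).
move=> phi [lphi phiV phiP].
have [g ug||Phi [lPhi PhiE]] := ind_univ cusp indP (A := fun y v => pi (lft y) (phi v)).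
- have ul := Kmax_unit (lft_Kmax ug).
  exact: (linear_comp (pi_linear piP ul) lphi).
- move=> g p v ug Pp; have up : p \in unitmx by case: Pp.
  have [Kg Kp] := (lft_Kmax ug, lft_Kmax up).
  have := phiP (lft p) v Kp; rewrite lftK => -> //.
  rewrite -(pi_M piP) ?(Kmax_unit Kg) ?(Kmax_unit Kp) //; apply: (pi_red piP) => //.
  + by apply: lft_Kmax; rewrite unitmx_mul ug.
  + exact: KmaxM.
  + by rewrite mxredM ?lftK //; exact: lft_int.
have lftP g y : Kmax g -> Phi (act (mxred g) y) = pi g (Phi y).
  move=> Kg; have ur := Kmax_red Kg; have ug := Kmax_unit Kg.
  suff e : Phi \o act (mxred g) = pi g \o Phi by exact: (congr1 (fun z => z y) e).
  apply: (ind_ext indP) => [||x v ux].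
  - by apply: linear_comp => //; exact: (act_linear indP).
  - by apply: linear_comp => //; exact: (pi_linear piP).
  rewrite /= -(actM indP) // !PhiE ?unitmx_mul ?ur // -(pi_M piP) ?(Kmax_unit (lft_Kmax ux)) //.
  apply: (pi_red piP) => //.
  - by apply: lft_Kmax; rewrite unitmx_mul ur.
  - by apply: KmaxM => //; exact: lft_Kmax.
  - by rewrite mxredM ?lftK //; [exact: Kmax_int | exact: lft_int].
exists Phi; first split=> // y g Kg.
  by rewrite -lftP ?Kg.2 ?(act1 indP) //; case: Kg.
apply/funext => v; have := PhiE 1%:M v (unitmx1 _ _).
by rewrite lft1 (pi_1 piP) (act1 indP).
Qed.

Lemma hact_Psi h Phi : H1 act h -> HomGF act pi Phi ->
  res (Phi \o h) = hact mu pi (Psi h) (res Phi).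
Proof.
move=> Hh HPhi; have [lPhi PhiV PhiE] := HPhi; apply/funext => v; rewrite /hact.
have lg := gen_linear indP.
rewrite (vint_fin muP (h0 := fun y => volJV *: Phi (act y (gen (ker_of h y *m v))))).
- rewrite -[beta _ _]/(gen v) /= (ker_recon cusp indP v Hh) -vol_volJV (linZ lPhi).
  rewrite (lin_sum lPhi) -scalerA; congr (_ *: _); rewrite scaler_sumr.
  by apply: eq_bigr.
- move=> g ug Kg; rewrite /Psi; case: asboolP => // _.
  rewrite trmxZ trmxK -[beta _ _]/(gen _) -scalemxAl (linZ lg) (linZ lPhi).
  by rewrite (linZ (pi_linear piP ug)) PhiE.
- move=> g ug nK; rewrite /Psi; case: asboolP => // _.
  rewrite linear0 mul0mx -[beta _ _]/(gen _) (lin0 lg) (lin0 lPhi).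
  exact: (lin0 (pi_linear piP ug)).
Qed.
End OnRepresentation.
End HeckeSide.

(** * The depth-zero vectors of the supercuspidal representation *)

Section CentreTimesMaximal.
Variables (F : localField) (m : nat).
Implicit Types g h : 'M[F]_m.

Lemma FKmax_unit g : FKmax g -> g \in unitmx.
Proof. by move=> [z [k0 [z0 /Kmax_unit uk ->]]]; rewrite unitmxZ ?unitfE. Qed.

Lemma Kmax_FK g : Kmax g -> FKmax g.
Proof. by move=> Kg; exists 1, g; rewrite oner_neq0 scale1r. Qed.

Lemma FKmaxM g h : FKmax g -> FKmax h -> FKmax (g *m h).
Proof.
move=> [z [x [z0 Kx ->]]] [t [y [t0 Ky ->]]]; exists (z * t), (x *m y); split.
- by rewrite mulf_neq0.
- exact: KmaxM.
- by rewrite -scalemxAl -scalemxAr scalerA.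
Qed.

Lemma FKmaxV g : FKmax g -> FKmax (invmx g).
Proof.
move=> [z [x [z0 Kx ->]]]; exists z^-1, (invmx x); split; [by rewrite invr_neq0|exact: KmaxV|].
by rewrite invmxZ // unitmxZ ?unitfE // Kmax_unit.
Qed.
End CentreTimesMaximal.

Section RightTranslation.
Variables (R : realType) (F : localField) (m : nat) (W : lmodType R[i]).

Lemma rtrans_rep : is_rep (@GL F m) setT (@rtrans F m W).
Proof.
split=> //.
- by move=> x _; apply/funext => g; rewrite /rtrans mulmx1.
- by move=> g h x _ _ _; apply/funext => y; rewrite /rtrans mulmxA.
Qed.

Lemma right_smooth_fixed (f : 'M[F]_m -> W) : on_GL f -> right_smooth f ->
  exists j, fixed (@Kcong F m j) (@rtrans F m W) f.
Proof.
move=> fG [j fj]; exists j => x Kx; apply/funext => g; rewrite /rtrans.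
have [ug|nug] := boolP (g \in unitmx); first exact: fj.
by rewrite !fG // unitmx_mul (negPf nug).
Qed.
End RightTranslation.

Section DepthZeroFiber.
Variables (R : realType) (F : localField) (r d : nat).
Local Notation C := R[i].
Local Notation k := (lf_res F).
Hypothesis r_gt0 : (0 < r)%N.
Variables (tau0 : 'M[k]_r -> 'M[C]_d) (tau1 : 'M[F]_r -> 'M[C]_d).
Hypothesis cusp : irreducible_cuspidal tau0.
Hypothesis tau1P : is_rep (@FKmax F r) setT (mxact tau1).
Hypothesis tau1K : forall g, Kmax g -> tau1 g = tau0 (mxred g).

Lemma tau1_M g h : FKmax g -> FKmax h -> tau1 (g *m h) = tau1 g *m tau1 h.
Proof.
move=> Zg Zh; apply: cV_eq => w; case: tau1P => _ _ _ tM.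
by rewrite -mulmxA; exact: (tM g h w Zg Zh).
Qed.

Lemma tau1_1 : tau1 1%:M = 1%:M.
Proof. by rewrite tau1K ?mxred1 ?(tau0_1 cusp) //; exact: Kmax1. Qed.

(** A K_+-invariant f transforms at g both by tau1 on the left and trivially on
    the right. Outside F^*K the conjugate by g of the unipotent radical of some
    parahoric falls, modulo K_+, into K_+, so that f (g) is a vector of tau0
    fixed by the unipotent radical of a proper parabolic subgroup. *)
Lemma cInd_support f g : cInd tau1 f -> fixed (@Kplus F r) (@rtrans F r _) f ->
  g \in unitmx -> ~ FKmax g -> f g = 0.
Proof.
move=> [_ fZ _ _] fK ug ncg.
have [rh [x [y [rho0 Kx Ky cont]]]] := noncentral_contracts r_gt0 ug ncg.
have [ux uy] := (Kmax_unit Kx, Kmax_unit Ky).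
have Zx := Kmax_FK Kx; have uxg : x *m g \in unitmx by rewrite unitmx_mul ux.
have pc : proper_cut r (pred1 rh) by exists rh => //=; rewrite eqxx.
suff : fixed (@unip_rad k r (pred1 rh)) (mxact tau0) (f (x *m g)).
  case: cusp => _ ->// fx0; rewrite -[f g]mul1mx -tau1_1 -(mulVmx ux).
  by rewrite (tau1_M (FKmaxV Zx) Zx) -mulmxA -fZ // fx0 mulmx0.
move=> v /cont[u [Ku <-]]; set z := x *m g *m y => Kz.
have uz : z \in unitmx by rewrite unitmx_mul uxg.
rewrite /mxact -tau1K // -fZ //; last exact: Kmax_FK.
have -> : u *m (x *m g) = x *m g *m (y *m (invmx z *m u *m z) *m invmx y).
  by rewrite !mulmxA -/z mulmxV // mul1mx /z ?mulmxA mulmxK.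
by have /(congr1 (fun q => q (x *m g))) := fK _ (Kplus_conj Ky Kz).
Qed.

Lemma fixed_rtrans1 f g : cInd tau1 f -> FKmax g -> f g = tau1 g *m f 1%:M.
Proof. by move=> [_ fZ _ _] Zg; rewrite -fZ ?mulmx1 //; exact: unitmx1. Qed.

Definition extend (v : 'cV[C]_d) : 'M[F]_r -> 'cV[C]_d :=
  fun g => if `[< FKmax g >] then tau1 g *m v else 0.

Lemma extend_cInd v : cInd tau1 (extend v).
Proof.
have mulZ (h g : 'M[F]_r) : FKmax h -> FKmax (h *m g) <-> FKmax g.
  move=> Zh; split=> [Zhg|]; last exact: FKmaxM.
  by rewrite -[g](mulKmx (FKmax_unit Zh)); apply: FKmaxM => //; exact: FKmaxV.
split.
- move=> g nug; rewrite /extend; case: asboolP => // /FKmax_unit.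
  by rewrite (negPf nug).
- move=> h g Zh ug; rewrite /extend (asbool_equiv_eq (mulZ h g Zh)).
  by case: asboolP => [Zg|]; rewrite ?mulmx0 // mulmxA tau1_M.
- exists 0%N => g x ug; rewrite -Kplus_cong => -[Kx rx]; rewrite /extend.
  have Zx := Kmax_FK Kx; have ux := Kmax_unit Kx.
  have e : FKmax (g *m x) <-> FKmax g.
    split=> [Zgx|Zg]; last exact: FKmaxM.
    by rewrite -[g](mulmxK ux); apply: FKmaxM => //; exact: FKmaxV.
  rewrite (asbool_equiv_eq e); case: asboolP => // Zg.
  by rewrite tau1_M // (tau1K Kx) rx (tau0_1 cusp) mulmx1.
- exists [:: 1%:M] => g ug; rewrite /extend; case: asboolP => // Zg _.
  by exists 1%:M, g, 1%:M; rewrite inE !mulmx1; split=> //; exact: Kmax1.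
Qed.

Lemma extend_fixed f : cInd tau1 f -> fixed (@Kplus F r) (@rtrans F r _) f ->
  extend (f 1%:M) = f.
Proof.
move=> cf fK; apply/funext => g; rewrite /extend; case: asboolP => [Zg|nZ].
  by rewrite -fixed_rtrans1.
have [ug|nug] := boolP (g \in unitmx); first by rewrite cInd_support.
by case: cf => ->.
Qed.

(** By [cInd_support] a K_+-fixed vector of the compactly induced
    representation is determined by its value at 1, hence by its image under
    [p]; the section [s] rebuilds it from that value. *)
Lemma depth_zero_fiber (L : lmodType C) (tau : 'M[F]_r -> L -> L) :
  isomorphic (@GL F r) setT tau (cInd tau1) (@rtrans F r _) ->
  exists (p : L -> 'cV[C]_d) (s : 'cV[C]_d -> L),
    [/\ linear p, linear s,
        forall g v, Kmax g -> p (tau g v) = tau0 (mxred g) *m p v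
      & forall v, fixed (@Kplus F r) tau v -> s (p v) = v].
Proof.
move=> [io [[iol ioG] [ioC ioI ioS]]].
have iol' := linear_onT iol.
have ioc v : cInd tau1 (io v) by exact: ioC.
have ioinj : injective io by move=> x y; apply: ioI; rewrite inE.
have ex v : exists x, io x = extend v.
  by have [x _ xE] := ioS _ (extend_cInd v); exists x.
have [s sE] := choice ex.
exists (fun v => io v 1%:M), s; split.
- by move=> a x y; rewrite iol'.
- move=> a x y; apply: ioinj; rewrite iol' !sE; apply/funext => g.
  rewrite !fctE /extend; case: asboolP => _; last by rewrite scaler0 addr0.
  exact: mulmx_linear.
- move=> g v Kg; rewrite ioG //; last exact: Kmax_unit.
  by rewrite /rtrans mul1mx fixed_rtrans1 ?(tau1K Kg) //; exact: Kmax_FK.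
move=> v vK; apply: ioinj; rewrite sE; apply: extend_fixed => // g Kg.
by rewrite -ioG ?vK //; exact: Kmax_unit Kg.1.
Qed.
End DepthZeroFiber.

(** * Tensor powers and the fibre of the parabolically induced representation *)

Section SubmoduleType.
Variables (R : realType) (T : lmodType R[i]) (E : set T).
Hypothesis Esub : subspace E.

Definition sub_mem : {pred T} := fun x => `[< E x >].

Fact sub_mem_closed : submod_closed sub_mem.
Proof.
case: Esub => E0 Elin; split; first exact/asboolP.
by move=> a x y /asboolP Ex /asboolP Ey; apply/asboolP; exact: Elin.
Qed.

HB.instance Definition _ := GRing.isSubmodClosed.Build R[i] T sub_mem sub_mem_closed.

Record sub_type := SubType {sub_val : T; sub_valP : sub_val \in sub_mem}.

HB.instance Definition _ := [isSub for sub_val].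
HB.instance Definition _ := [Choice of sub_type by <:].
HB.instance Definition _ := [SubChoice_isSubLmodule of sub_type by <:].

(** The inclusion of E as a linear map defined on a module, as universal
    properties require. *)
Lemma submodule_exists : exists (W : lmodType R[i]) (v : W -> T),
  [/\ linear v, injective v & forall x, E x <-> exists y, v y = x].
Proof.
exists sub_type, sub_val; split.
- by move=> a x y.
- exact: val_inj.
- move=> x; split=> [Ex|[y <-]]; last by apply/asboolP; exact: sub_valP.
  have Ex' : x \in sub_mem by apply/asboolP.
  by exists (SubType Ex').
Qed.
End SubmoduleType.

Section TensorPower.
Variables (R : realType) (n : nat) (L : lmodType R[i]).
Implicit Types (W T : lmodType R[i]).

Definition vupd (v : 'I_n -> L) i z := fun j => if j == i then z else v j.

Lemma vupd_id v i : vupd v i (v i) = v.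
Proof. by apply/funext => j; rewrite /vupd; case: eqP => [->|]. Qed.

Lemma multilinear_at W (f : ('I_n -> L) -> W) v i : multilinear f ->
  linear (fun z => f (vupd v i z)).
Proof. by move=> fP a x y; exact: fP. Qed.

(** Expanding the arguments one at a time in the spanning family. *)
Lemma multilinear_ext (J : finType) (e : J -> L) W (f f' : ('I_n -> L) -> W) :
  (forall x, exists c : J -> R[i], x = \sum_j c j *: e j) ->
  multilinear f -> multilinear f' ->
  (forall phi : 'I_n -> J, f (e \o phi) = f' (e \o phi)) -> f =1 f'.
Proof.
move=> span fP f'P ff'.
suff st (q : seq 'I_n) v : (forall i, i \notin q -> exists j, v i = e j) -> f v = f' v.
  by move=> v; apply: (st (enum 'I_n)) => i; rewrite mem_enum.
elim: q v => [|i q IH] v vq.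
  have [phi phiE] := choice (fun i => vq i isT).
  by have -> : v = e \o phi by exact/funext.
have [c cE] := span (v i); rewrite -(vupd_id v i) cE.
rewrite (lin_sum (multilinear_at v i fP)) (lin_sum (multilinear_at v i f'P)).
apply: eq_bigr => j _.
rewrite (linZ (multilinear_at v i fP)) (linZ (multilinear_at v i f'P)); congr (_ *: _).
apply: IH => l lq; rewrite /vupd; case: (eqVneq l i) => [_|li]; first by exists j.
by apply: vq; rewrite inE negb_or li.
Qed.

Variables (T : lmodType R[i]) (t : ('I_n -> L) -> T).
Hypothesis tP : is_tensor_power t.

Lemma tens_ext W (g g' : T -> W) : linear g -> linear g' ->
  (forall v, g (t v) = g' (t v)) -> g = g'.
Proof.
move=> lg lg' gg'; have [mt univ] := tP.
have mg : multilinear (g \o t) by move=> v i a x y upd; rewrite /= mt lg.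
have [g0 [_ uq]] := univ W _ mg.
by transitivity g0; [apply: esym|]; apply: uq; split=> // v; rewrite /= gg'.
Qed.

(** Pure tensors span: the universal map to the submodule E, composed with the
    inclusion, agrees with the identity on them. *)
Lemma tens_gen (E : set T) : subspace E -> (forall v, E (t v)) -> forall w, E w.
Proof.
move=> Esub Et w; have [W [v [lv vi vE]]] := submodule_exists Esub.
have [mt univ] := tP.
have [f fE] := choice (fun u => proj1 (vE (t u)) (Et u)).
have mf : multilinear f.
  by move=> u i a x y upd; apply: vi; rewrite lv !fE; exact: mt.
have [g [[lg gE] _]] := univ W f mf.
apply/vE; exists (g w).
suff e : v \o g = id :> (T -> T) by exact: (congr1 (fun h => h w) e).
apply: tens_ext => // [|u]; first exact: linear_comp.
by rewrite /= gE fE.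
Qed.
End TensorPower.

Section PureTensors.
Variables (R : realType) (n d : nat).
Local Notation C := R[i].

Lemma ptens_multilinear : multilinear (@ptens R n d).
Proof.
move=> v i a x y upd; apply/colP => b; rewrite !mxE.
rewrite (bigD1 i) //= [in X in _ = _ * X + _](bigD1 i) //= [in X in _ = _ + X](bigD1 i) //=.
rewrite /upd !eqxx !mxE mulrDl mulrA.
by congr (_ * _ + _ * _); apply: eq_bigr => j /negPf ->.
Qed.

Lemma ptens_basis (phi : 'I_n -> 'I_d) a :
  ptens (fun i => delta_mx (phi i) 0 : 'cV[C]_d) a 0 = (tidx a == [ffun i => phi i])%:R.
Proof.
rewrite mxE; under eq_bigr do rewrite mxE andbT.
have := @prod_nat_eq R n d (tidx a) [ffun i => phi i] predT.
under eq_bigr do rewrite ffunE; move=> ->; congr ((nat_of_bool _)%:R).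
apply/idP/eqP => [/fintype.forallP e|->]; last by apply/fintype.forallP => i; rewrite eqxx implybT.
by apply/ffunP => i; apply/eqP; have := e i.
Qed.

Lemma col_span (x : 'cV[C]_d) : exists c : 'I_d -> C, x = \sum_j c j *: delta_mx j 0.
Proof.
by exists (fun j => x j 0); rewrite [LHS]matrix_sum_delta; apply: eq_bigr => i _; rewrite big_ord1.
Qed.
End PureTensors.

Section TensorFibre.
Variables (R : realType) (F : localField) (n r d : nat).
Local Notation C := R[i].
Local Notation k := (lf_res F).
Local Notation N := #|{: {ffun 'I_n -> 'I_d}}|.
Variables (tau0 : 'M[k]_r -> 'M[C]_d) (cusp : irreducible_cuspidal tau0).
Variables (L : lmodType C) (tau : 'M[F]_r -> L -> L).
Hypothesis tau_rep : is_rep (@GL F r) setT tau.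
Hypothesis tau_smooth : smooth tau.
Variables (p : L -> 'cV[C]_d) (s : 'cV[C]_d -> L).
Hypotheses (pl : linear p) (sl : linear s).
Hypothesis pK : forall g v, Kmax g -> p (tau g v) = tau0 (mxred g) *m p v.
Hypothesis sp : forall v, fixed (@Kplus F r) tau v -> s (p v) = v.
Variables (S : lmodType C) (sigma : 'M[F]_(\sum_(i < n) r) -> S -> S).
Variables (t : ('I_n -> L) -> S) (tP : is_tensor_power t).
Hypothesis sigmaP : forall m, Levi m -> linear (sigma m) /\
  forall v, sigma m (t v) = t (fun i => tau (blk m i i) (v i)).

(** Inverse to eps on the vectors fixed by the intersection of M and K_+, by
    [delta_eps]. *)
Definition delta (x : 'cV[C]_N) : S := \sum_a x a 0 *: t (fun i => s (delta_mx (tidx a i) 0)).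

Lemma delta_linear : linear delta.
Proof.
move=> a x y; rewrite /delta scaler_sumr -big_split; apply: eq_bigr => b _ /=.
by rewrite !mxE scalerDl scalerA.
Qed.

Lemma delta_ptens x : delta (ptens x) = t (s \o x).
Proof.
have [mt _] := tP.
pose f' := fun y : 'I_n -> 'cV[C]_d => t (s \o y).
apply: (@multilinear_ext R n _ 'I_d (fun j => delta_mx j 0) _ (delta \o @ptens R n d) f').
- exact: col_span.
- by move=> v i a y z upd; rewrite /= ptens_multilinear delta_linear.
- move=> v i a y z upd; rewrite /f'.
  have e w : s \o upd w = vupd (s \o v) i (s w).
    by apply/funext => j; rewrite /upd /vupd /=; case: eqP.
  by rewrite !e sl; exact: mt.
move=> phi; rewrite /f' /= /delta.
pose G (c : {ffun 'I_n -> 'I_d}) : S := (c == [ffun i => phi i])%:R *: t (fun i => s (delta_mx (c i) 0)).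
rewrite (eq_bigr (fun a => G (tidx a))) => [|a _]; last by rewrite ptens_basis.
rewrite big_tidx (bigD1 [ffun i => phi i]) //= big1 ?addr0 /G => [|c /negPf ->].
  by rewrite eqxx scale1r; congr t; apply/funext => i; rewrite ffunE.
by rewrite scale0r.
Qed.

Lemma eps_exists : exists2 eps : S -> 'cV[C]_N, linear eps &
  forall v, eps (t v) = ptens (p \o v).
Proof.
have [_ univ] := tP; have [|e [[le eE] _]] := univ _ (fun v => ptens (p \o v)).
  move=> v i a y z upd.
  have e w : p \o upd w = vupd (p \o v) i (p w).
    by apply/funext => j; rewrite /upd /vupd /=; case: eqP.
  by rewrite !e pl; exact: ptens_multilinear.
by exists e.
Qed.

Definition slot (i : 'I_n) (x : 'M[F]_r) : 'M[F]_(\sum_(i < n) r) :=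
  bdiag (fun l => if l == i then x else 1%:M).

Lemma slot_Levi i x : x \in unitmx -> Levi (slot i x).
Proof. by move=> ux; apply: bdiag_Levi => l; case: eqP => // _; exact: unitmx1. Qed.

Lemma slot_Kplus i x : Kplus x -> Kplus (slot i x).
Proof.
move=> [Kx rx]; split.
  by apply: bdiag_Kmax => l; case: eqP => // _; exact: Kmax1.
rewrite red_bdiag -bdiag1; congr bdiag; apply/funext => l.
by case: eqP => // _; exact: mxred1.
Qed.

Definition average (q : seq 'M[F]_r) (v : L) := invn R (size q) *: \sum_(x <- q) tau x v.

Definition slot_average (q : seq 'M[F]_r) (i : 'I_n) (w : S) :=
  invn R (size q) *: \sum_(x <- q) sigma (slot i x) w.

Lemma slot_average_linear q i : (forall x, x \in q -> x \in unitmx) -> linear (slot_average q i).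
Proof.
move=> uq a x y; rewrite /slot_average scalerA mulrC -scalerA -scalerDr; congr (_ *: _).
rewrite scaler_sumr -big_split !big_seq; apply: eq_bigr => z /uq uz.
by rewrite (proj1 (sigmaP (slot_Levi i uz))).
Qed.

Lemma slot_average_tens q i v : (forall x, x \in q -> x \in unitmx) ->
  slot_average q i (t v) = t (vupd v i (average q (v i))).
Proof.
move=> uq; have lt := multilinear_at v i (proj1 tP).
rewrite (linZ lt) (lin_sum lt); congr (_ *: _); rewrite !big_seq; apply: eq_bigr => x /uq ux.
rewrite (proj2 (sigmaP (slot_Levi i ux))); congr t; apply/funext => l.
rewrite blk_bdiag eqxx /vupd; case: eqP => [->//|_].
exact: (pi_1 tau_rep).
Qed.

Definition full_average q w := foldr (slot_average q) w (enum 'I_n).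

Lemma full_average_linear q : (forall x, x \in q -> x \in unitmx) -> linear (full_average q).
Proof.
move=> uq a x y; rewrite /full_average; elim: (enum _) => //= i l ->.
exact: slot_average_linear.
Qed.

Lemma full_average_tens q v : (forall x, x \in q -> x \in unitmx) ->
  full_average q (t v) = t (average q \o v).
Proof.
move=> uq.
have st l : uniq l -> foldr (slot_average q) (t v) l =
    t (fun i => if i \in l then average q (v i) else v i).
  elim: l => //= i l IH /andP[il ul]; rewrite IH // slot_average_tens // (negPf il).
  by congr t; apply/funext => j; rewrite /vupd inE; case: eqP => [->|].
rewrite /full_average st ?enum_uniq //; congr t; apply/funext => i.
by rewrite mem_enum.
Qed.

(** A vector fixed by the intersection of M and K_+ is its own average. On pure
    tensors the average replaces each factor by a K_+-fixed vector, on which [s]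
    inverts [p]. *)
Lemma delta_eps eps w : linear eps -> (forall v, eps (t v) = ptens (p \o v)) ->
  (forall m, Levi m -> Kplus m -> sigma m w = w) -> delta (eps w) = w.
Proof.
move=> le epsE wM.
pose E u := exists j0, forall j q, (j0 <= j)%N -> coset_reps j q ->
  delta (eps (full_average q u)) = full_average q u.
have qu j (q : seq 'M[F]_r) : coset_reps j q -> forall x, x \in q -> x \in unitmx.
  by move=> [_ qK _] x /qK[/Kmax_unit].
have Ew : E w.
  apply: (tens_gen tP (E := E)) => [|v].
    split.
      exists 0%N => j q _ /qu uq.
      by rewrite (lin0 (full_average_linear uq)) (lin0 le) (lin0 delta_linear).
    move=> a x y [jx xE] [jy yE]; exists (maxn jx jy) => j q; rewrite geq_max => /andP[hx hy] cq.
    rewrite (full_average_linear (qu _ _ cq)) le delta_linear.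
    by rewrite (xE _ _ hx cq) (yE _ _ hy cq).
  have [jv jvE] := choice (fun i => tau_smooth (v i)).
  exists (\max_i jv i) => j q hj cq; rewrite full_average_tens; last exact: qu cq.
  rewrite epsE delta_ptens; congr t; apply/funext => i /=; apply: sp.
  apply: (average_fixed tau_rep cq) => g Kg; apply: jvE.
  by apply: Kcong_le Kg; apply: leq_trans hj; exact: leq_bigmax.
have [j0 j0E] := Ew; have [q cq] := transversal F r j0.
suff aw : full_average q w = w by have := j0E _ _ (leqnn _) cq; rewrite aw.
rewrite /full_average; elim: (enum _) => //= i l ->; rewrite /slot_average.
have [q0 qK _] := cq.
rewrite (eq_big_seq (fun=> w)) => [|x xq]; last first.
  have Kx := qK x xq; apply: wM; last exact: slot_Kplus.
  by apply: slot_Levi; exact: Kmax_unit Kx.1.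
by rewrite big_const_seq count_predT iter_addr_0 invn_mulrn.
Qed.

Lemma eps_equiv eps m w : linear eps -> (forall v, eps (t v) = ptens (p \o v)) ->
  Levi m -> Kmax m -> eps (sigma m w) = rhoM tau0 (mxred m) *m eps w.
Proof.
move=> le epsE Lm Km; have [ls st] := sigmaP Lm.
suff e : eps \o sigma m = mulmx (rhoM tau0 (mxred m)) \o eps.
  exact: (congr1 (fun f => f w) e).
apply: (tens_ext tP) => [||v].
- exact: linear_comp.
- by apply: linear_comp => //; exact: mulmx_linear.
rewrite /= st !epsE tensmx_ptens; congr ptens; apply/funext => i /=.
rewrite blk_red pK //; apply/KmaxP; split; first exact/blk_int/Kmax_int.
by rewrite -blk_red; exact/Levi_blk_unit/red_Levi.
Qed.
End TensorFibre.

(** The tensor power of the evaluation of [depth_zero_fiber] reads the values of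
    functions in the parabolically induced representation in the space of rho_M. *)
Lemma tensor_fibre (R : realType) (F : localField) n r d
    (tau0 : 'M[lf_res F]_r -> 'M[R[i]]_d) (L : lmodType R[i]) (tau : 'M[F]_r -> L -> L)
    (S : lmodType R[i]) (sigma : 'M[F]_(\sum_(i < n) r) -> S -> S) :
  (0 < r)%N -> depth_zero_sc_of_type tau0 tau -> is_tensor_rep tau sigma ->
  exists eps : S -> 'cV[R[i]]_#|{: {ffun 'I_n -> 'I_d}}|,
    [/\ linear eps, forall m, Levi m -> linear (sigma m),
        forall m w, Levi m -> Kmax m -> eps (sigma m w) = rhoM tau0 (mxred m) *m eps w
      & forall w, (forall m, Levi m -> Kplus m -> sigma m w = w) -> eps w = 0 -> w = 0].
Proof.
move=> r0 [cusp [[[tr _ _] tsm] _] _ [tau1 [tP tK iso]]] [t tenP sP].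
have [p [s [pl sl pK sp]]] := depth_zero_fiber r0 cusp tP tK iso.
have [eps le epsE] := eps_exists pl tenP.
exists eps; split=> //.
  by move=> m /sP[].
  by move=> m w Lm Km; exact: (eps_equiv pK tenP sP).
move=> w wM e0; rewrite -(delta_eps tr tsm sl sp tenP sP le epsE wM) e0.
exact: (lin0 (delta_linear s t)).
Qed.

(** * Recovering a covariant function from its P-averages *)

Section Projection.
Variable R : realType.
Local Notation C := R[i].
Local Notation adj A := ((map_mx (@Num.conj C) A)^T).

Lemma adj_definite m (u : 'rV[C]_m) : u *m adj u = 0 -> u = 0.
Proof.
move=> /matrixP/(_ 0 0); rewrite !mxE => /eqP.
rewrite psumr_eq0 => [/allP u0|j _]; last by rewrite !mxE mul_conjC_ge0.
apply/rowP => j; have := u0 j (mem_index_enum j).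
by rewrite !mxE mul_conjC_eq0 => /eqP.
Qed.

(** The kernels of B and of the Gram matrix of its rows coincide by definiteness,
    so the normal equations are solvable. *)
Lemma orth_projection m p (B : 'M[C]_(m, p)) (v : 'rV_p) :
  exists c, (v - c *m B) *m adj B = 0.
Proof.
suff : (v *m adj B <= B *m adj B)%MS.
  by case/submxP => c e; exists c; rewrite mulmxBl e mulmxA subrr.
apply: submx_trans (submxMl _ _) _.
have s : (B *m adj B <= adj B)%MS by exact: submxMl.
suff e : \rank (B *m adj B) = \rank (adj B).
  by have := mxrank_leqif_sup s; rewrite e => -[_ <-].
rewrite mxrank_tr mxrank_map.
have ker : (kermx (B *m adj B) <= kermx B)%MS.
  apply/rV_subP => u; rewrite !sub_kermx => /eqP u0; apply/eqP; apply: adj_definite.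
  by rewrite map_mxM trmx_mul mulmxA -[u *m B *m _]mulmxA u0 mul0mx.
have ker' := mxrankS ker; rewrite !mxrank_ker in ker'.
apply/eqP; rewrite eqn_leq mxrankM_maxl /=.
by rewrite leq_sub2lE ?rank_leq_row in ker'.
Qed.

Lemma orth_family (X J : finType) (b : J -> X -> C) (f : X -> C) :
  exists c : J -> C, forall j, \sum_x (f x - \sum_i c i * b i x) * (b j x)^* = 0.
Proof.
pose B := \matrix_(i < #|J|, x < #|X|) b (enum_val i) (enum_val x).
have [c /rowP cE] := orth_projection B (\row_x f (enum_val x)).
exists (fun i => c 0 (enum_rank i)) => j; have := cE (enum_rank j).
rewrite !mxE => e; rewrite -[RHS]e (reindex (@enum_val X predT)) /=; last exact/onW_bij/enum_val_bij.
apply: eq_bigr => x _; rewrite !mxE ?enum_rankK; congr ((_ - _) * _).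
rewrite (reindex (@enum_val J predT)) /=; last exact/onW_bij/enum_val_bij.
by apply: eq_bigr => i _; rewrite !mxE enum_valK.
Qed.
End Projection.

Section CovariantFunctions.
Variables (R : realType) (k : finFieldType) (n r d l : nat).
Local Notation C := R[i].
Local Notation mat := 'M[k]_(\sum_(i < n) r).
Local Notation N := #|{: {ffun 'I_n -> 'I_d}}|.
Variables (tau0 : 'M[k]_r -> 'M[C]_d) (cusp : irreducible_cuspidal tau0).
Local Notation rhoM := (rhoM tau0).
Local Notation fn := (mat -> 'M[C]_(N, l)).

Definition herm (G H : fn) : C :=
  \sum_(x | x \in unitmx) \sum_(u : 'I_N * 'I_l) G x u.1 u.2 * (H x u.1 u.2)^*.

Lemma eq_herm G G' H H' : (forall x, x \in unitmx -> G x = G' x) ->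
  (forall x, x \in unitmx -> H x = H' x) -> herm G H = herm G' H'.
Proof. by move=> GG' HH'; apply: eq_bigr => x ux; rewrite GG' // HH'. Qed.

Lemma herm_suml (J : finType) (P : pred J) (c : J -> C) (G : J -> fn) H :
  herm (fun x => \sum_(i | P i) c i *: G i x) H = \sum_(i | P i) c i * herm (G i) H.
Proof.
rewrite /herm; under [RHS]eq_bigr do rewrite mulr_sumr.
rewrite [RHS]exchange_big; apply: eq_bigr => x _ /=.
under [RHS]eq_bigr do rewrite mulr_sumr.
rewrite [RHS]exchange_big; apply: eq_bigr => u _ /=.
by rewrite summxE mulr_suml; apply: eq_bigr => i _; rewrite mxE mulrA.
Qed.

Lemma herm_conj G H : herm G H = (herm H G)^*.
Proof.
rewrite /herm rmorph_sum; apply: eq_bigr => x _; rewrite rmorph_sum.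
by apply: eq_bigr => u _; rewrite rmorphM /= conjCK mulrC.
Qed.

Lemma herm_sumr (J : finType) (P : pred J) (c : J -> C) (H : J -> fn) G :
  herm G (fun x => \sum_(i | P i) c i *: H i x) = \sum_(i | P i) (c i)^* * herm G (H i).
Proof.
rewrite herm_conj herm_suml rmorph_sum; apply: eq_bigr => i _.
by rewrite rmorphM /= -herm_conj.
Qed.

Lemma herm_subr G H H' : herm G (fun x => H x - H' x) = herm G H - herm G H'.
Proof.
rewrite /herm -sumrB; apply: eq_bigr => x _; rewrite -sumrB; apply: eq_bigr => u _.
by rewrite !mxE rmorphB /= mulrBr.
Qed.

Lemma herm_translate w G H : w \in unitmx ->
  herm (fun x => G (x *m w)) H = herm G (fun x => H (x *m invmx w)).
Proof.
move=> uw; rewrite /herm (reindex (fun x => x *m invmx w)) /=; last first.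
  by exists (fun x => x *m w) => x _; rewrite ?mulmxKV ?mulmxK.
apply: eq_big => [x|x _]; first by rewrite unitmx_mul unitmx_inv uw andbT.
by rewrite mulmxKV.
Qed.

Lemma herm_definite G : herm G G = 0 -> forall x, x \in unitmx -> G x = 0.
Proof.
have ge0 x : 0 <= \sum_(u : 'I_N * 'I_l) G x u.1 u.2 * (G x u.1 u.2)^*.
  by apply: sumr_ge0 => u _; exact: mul_conjC_ge0.
move=> /eqP; rewrite psumr_eq0 // => /allP G0 x ux.
have := G0 x (mem_index_enum x); rewrite ux /= psumr_eq0 => [/allP Gx0|u _]; last exact: mul_conjC_ge0.
apply/matrixP => a b; rewrite mxE; apply/eqP; rewrite -mul_conjC_eq0.
exact: (Gx0 (a, b) (mem_index_enum _)).
Qed.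

Local Notation index := ((mat * mat) * ('I_N * 'I_N))%type.

Definition two_units (i : index) := (i.1.1 \in unitmx) && (i.1.2 \in unitmx).

Definition P_average (i : index) (G : fn) : fn := fun x =>
  \sum_(p | `[< Parab p >]) rhoM (invmx p) i.2.1 i.2.2 *: G (x *m i.1.1 *m p *m i.1.2).

Definition covariant (G : fn) :=
  forall p x, Parab p -> x \in unitmx -> G (p *m x) = rhoM p *m G x.

Lemma P_average_covariant i G : two_units i -> covariant G -> covariant (P_average i G).
Proof.
move=> /andP[u1 u2] cG p x Pp ux; rewrite /P_average mulmx_sumr; apply: eq_bigr => q /asboolP Pq.
by rewrite -scalemxAr -!mulmxA cG // !unitmx_mul ux u1 u2; case: Pq => ->.
Qed.

(** Schur orthogonality in its most elementary form: summing the averages of a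
    covariant function against the matrix coefficients of rho_M returns its
    values. *)
Lemma P_average_trace G z a : covariant G -> z \in unitmx ->
  \sum_e row e (P_average ((1%:M, z), (a, e)) G 1%:M) = row a (G z) *+ Pnum k n r.
Proof.
move=> cG uz; apply/rowP => b; rewrite summxE.
have E e : row e (P_average ((1%:M, z), (a, e)) G 1%:M) 0 b =
    \sum_(p | `[< Parab p >]) rhoM (invmx p) a e * (rhoM p *m G z) e b.
  rewrite mxE summxE; apply: eq_bigr => p /asboolP Pp.
  by rewrite mxE /= !mul1mx cG.
under eq_bigr do rewrite E.
rewrite exchange_big /= (eq_bigr (fun=> G z a b)) => [|p /asboolP Pp].
  by rewrite sumr_const mulmxnE mxE.
have := congr1 (fun A : 'M_(N, l) => A a b) (mulmxA (rhoM (invmx p)) (rhoM p) (G z)).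
by rewrite /= (rhoM_V cusp Pp) mul1mx => <-; rewrite mxE.
Qed.

(** The remainder of the orthogonal projection of F onto the span of its
    averages is orthogonal to all translates of these averages. Its own averages
    are combinations of translates of averages of F, so they are orthogonal
    to themselves and vanish, and then so does the remainder, by
    [P_average_trace]. *)
Lemma covariant_span (F : fn) : covariant F -> exists c : index -> C,
  forall x, x \in unitmx -> F x = \sum_(i | two_units i) c i *: P_average i F x.
Proof.
move=> cF.
pose f (H : fn) (v : mat * ('I_N * 'I_l)) := if v.1 \in unitmx then H v.1 v.2.1 v.2.2 else 0.
pose bf i (H : fn) : fn := fun x => if two_units i then P_average i H x else 0.
have [c cE] := orth_family (fun i => f (bf i F)) (f F).
pose G : fn := fun x => F x - \sum_(i | two_units i) c i *: P_average i F x.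
suff G0 x : x \in unitmx -> G x = 0.
  by exists c => x ux; apply/eqP; rewrite -subr_eq0; apply/eqP; exact: G0.
have cG : covariant G.
  move=> p y Pp uy; rewrite /G mulmxBr -cF // mulmx_sumr; congr (_ - _).
  by apply: eq_bigr => i hi; rewrite (P_average_covariant hi) // scalemxAr.
have orth i : two_units i -> herm G (P_average i F) = 0.
  move=> hi; rewrite -[RHS](cE i) /herm pair_big_dep /=.
  rewrite big_mkcond; apply: eq_bigr => -[y u] _ /=; rewrite andbT /f /bf /= hi.
  case: ifP => _; last by rewrite conjC0 mulr0.
  congr (_ * _); rewrite /G !mxE summxE; congr (_ - _).
  rewrite [LHS]big_mkcond; apply: eq_bigr => j _.
  by case: ifP => _; rewrite mxE // mulr0.
have orthR i w : two_units i -> w \in unitmx ->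
    herm G (fun y => P_average i F (y *m w)) = 0.
  move=> hi uw; rewrite -[RHS](orth ((w *m i.1.1, i.1.2), i.2)).
    by apply: eq_herm => [//|y uy]; apply: eq_bigr => p _ /=; rewrite !mulmxA.
  by move: hi; rewrite /two_units /= unitmx_mul uw.
have orthRR i v w : two_units i -> v \in unitmx -> w \in unitmx ->
    herm (fun y => G (y *m v)) (fun y => P_average i F (y *m w)) = 0.
  move=> hi uv uw; rewrite herm_translate // -[RHS](orthR i (invmx v *m w)) //.
    by apply: eq_herm => [//|y _]; rewrite !mulmxA.
  by rewrite unitmx_mul unitmx_inv uv.
have orthP i j w : two_units i -> two_units j -> w \in unitmx ->
    herm (P_average i G) (fun y => P_average j F (y *m w)) = 0.
  move=> /andP[u1 u2] hj uw; rewrite herm_suml big1 // => p /asboolP[up _].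
  have uz : i.1.1 *m p *m i.1.2 \in unitmx by rewrite !unitmx_mul u1 up.
  rewrite [X in _ * X](_ : _ = 0) ?mulr0 // -[RHS](orthRR j _ w hj uz uw).
  by apply: eq_herm => [y _|//]; rewrite !mulmxA.
have avG i : two_units i -> forall x, x \in unitmx -> P_average i G x = 0.
  move=> hi; apply: herm_definite; have /andP[u1 u2] := hi.
  pose D : fn := fun x => P_average i F x - \sum_(j | two_units j) c j *: P_average i (P_average j F) x.
  have e y : P_average i G y = D y.
    rewrite /D; under [in X in _ - X]eq_bigr do rewrite scaler_sumr.
    rewrite exchange_big -sumrB; apply: eq_bigr => p _ /=.
    rewrite /G scalerBr; congr (_ - _); rewrite scaler_sumr; apply: eq_bigr => j _.
    by rewrite !scalerA mulrC.
  rewrite (@eq_herm _ (P_average i G) _ D) // herm_subr.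
  have -> : herm (P_average i G) (P_average i F) = 0.
    rewrite -[RHS](orthP i i 1%:M hi hi (unitmx1 _ _)).
    by apply: eq_herm => [//|y _]; rewrite mulmx1.
  rewrite sub0r herm_sumr big1 ?oppr0 // => j hj; rewrite herm_sumr big1 ?mulr0 // => p /asboolP[up _].
  rewrite [X in _ * X](_ : _ = 0) ?mulr0 //.
  have uz : i.1.1 *m p *m i.1.2 \in unitmx by rewrite !unitmx_mul u1 up.
  rewrite -[RHS](orthP i j _ hi hj uz).
  by apply: eq_herm => [//|y _]; rewrite !mulmxA.
move=> ux; apply/row_matrixP => a; rewrite row0.
apply/eqP; rewrite -(invn_mulrn (row a (G x)) (Pnum_gt0 k n r)) -P_average_trace //.
by rewrite big1 ?scaler0 // => e _; rewrite avG ?row0 ?unitmx1 // /two_units /= unitmx1.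
Qed.
End CovariantFunctions.

(** * K_+-fixed vectors of the representations in the block *)

Section FixedVectors.
Variables (R : realType) (F : localField) (m : nat).
Variables (V : lmodType R[i]) (pi : 'M[F]_m -> V -> V).
Hypothesis piP : is_rep (@GL F m) setT pi.

Lemma VK_subspace : subspace (fixed (@Kplus F m) pi).
Proof.
have lp g (Kg : Kplus g) := pi_linear piP (Kmax_unit Kg.1).
split=> [g Kg|a x y Vx Vy g Kg]; first by rewrite (lin0 (lp g Kg)).
by rewrite (lp g Kg) (Vx g Kg) (Vy g Kg).
Qed.
End FixedVectors.

Section ParabolicInduction.
Variables (R : realType) (F : localField) (n r d : nat).
Local Notation C := R[i].
Local Notation k := (lf_res F).
Local Notation nr := (\sum_(i < n) r)%N.
Local Notation N := #|{: {ffun 'I_n -> 'I_d}}|.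
Variables (tau0 : 'M[k]_r -> 'M[C]_d) (cusp : irreducible_cuspidal tau0).
Variables (S : lmodType C) (sigma : 'M[F]_nr -> S -> S).
Variable eps : S -> 'cV[C]_N.
Hypothesis eps_lin : linear eps.
Hypothesis sigma_lin : forall m, Levi m -> linear (sigma m).
Hypothesis eps_K : forall m w, Levi m -> Kmax m -> eps (sigma m w) = rhoM tau0 (mxred m) *m eps w.
Hypothesis eps_faithful :
  forall w, (forall m, Levi m -> Kplus m -> sigma m w = w) -> eps w = 0 -> w = 0.
Variable chi : 'M[F]_nr -> C.
Hypothesis chiP : unramified chi.
Local Notation right := (@rtrans F nr S).
Local Notation fixedK := (fixed (@Kplus F nr) right).

Lemma chi_Kmax m : Levi m -> Kmax m -> chi m = 1.
Proof.
move=> Lm Km; case: chiP => _ _; apply=> // i.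
have ib : intmx (blk m i i) by exact/blk_int/Kmax_int.
have ub : \det (mxred (blk m i i)) != 0.
  by rewrite -unitfE -unitmxE -blk_red; exact/Levi_blk_unit/red_Levi.
by rewrite mxred_det // in ub; have [_ ->] := int_unit (int_det ib) ub.
Qed.

Lemma right_red f a b g : fixedK f -> Kmax a -> Kmax b -> mxred a = mxred b ->
  f (g *m a) = f (g *m b).
Proof. by move=> fK Ka Kb e; have /(congr1 (fun h => h g)) := pi_red (@rtrans_rep R F nr S) Ka Kb e fK. Qed.

Lemma fixed_red f a b : fixedK f -> Kmax a -> Kmax b -> mxred a = mxred b -> f a = f b.
Proof. by move=> fK Ka Kb e; rewrite -[a]mul1mx -[b]mul1mx; exact: right_red. Qed.

Lemma eps_covariant f : parInd sigma chi f -> fixedK f ->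
  covariant tau0 (fun y => eps (f (lft y))).
Proof.
move=> [_ _ fP] fK p y Pp uy; have [m [u [Lm Uu ->]]] := Parab_fact Pp.
have [um uu] : m \in unitmx /\ u \in unitmx by split; [case: Lm | exact: Urad_unit].
have [Km Ku Ky] : [/\ Kmax (lft m), Kmax (lft u) & Kmax (lft y)] by split; exact: lft_Kmax.
rewrite (rhoM_M cusp) ?(rhoM_U cusp Uu) ?mulmx1; last 2 first.
- exact: Levi_Parab.
- exact: Urad_Parab.
have Lm' := lft_Levi Lm; have iK := Kmax_int.
rewrite (@fixed_red f _ (lft m *m lft u *m lft y)) //.
- rewrite fP ?(chi_Kmax Lm' Km) ?scale1r //; first by rewrite eps_K // lftK.
  + exact: lft_Urad.
  + exact: Kmax_unit.
- by apply: lft_Kmax; rewrite !unitmx_mul um uu.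
- by do !apply: KmaxM.
- by rewrite !mxredM ?lftK //; apply: Kmax_int; rewrite //; exact: KmaxM.
Qed.

(** By the Iwasawa decomposition f is determined by its values on K. If m is in
    the intersection of M and K_+, then f (m y) = f (y) for y in K because y
    normalizes K_+, so that eps is faithful on these values. *)
Lemma eps_injective f : parInd sigma chi f -> fixedK f ->
  (forall y, y \in unitmx -> eps (f (lft y)) = 0) -> f = 0.
Proof.
move=> [fG _ fP] fK f0.
have fy y : y \in unitmx -> f (lft y) = 0.
  move=> uy; apply: eps_faithful; last exact: f0.
  have Ky := lft_Kmax uy.
  move=> m Lm Km; have := fP m 1%:M (lft y) Lm (Urad1 _ _ _) (Kmax_unit Ky).
  rewrite mulmx1 (chi_Kmax Lm Km.1) scale1r => <-.
  apply: fixed_red => //; first by apply: KmaxM => //; case: Km.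
  by rewrite mxredM ?Km.2 ?mul1mx //; [exact: Kmax_int Km.1 | exact: Kmax_int].
apply/funext => g; have [ug|nug] := boolP (g \in unitmx); last by rewrite fG.
have [m [u [x [Lm Uu Kx ->]]]] := Iwasawa_block ug.
rewrite fP ?(Kmax_unit Kx) //; last exact: Kmax_unit.
rewrite (@fixed_red f x (lft (mxred x))) ?lftK //; last by apply: lft_Kmax; exact: Kmax_red.
by rewrite fy ?(lin0 (sigma_lin Lm)) ?scaler0 //; exact: Kmax_red.
Qed.

Variable E : set ('M[F]_nr -> S).
Hypothesis Esub : subspace E.
Hypothesis Estable : stable (@GL F nr) right E.
Hypothesis Eind : E `<=` parInd sigma chi.

(** Both sides are K_+-fixed, and by [covariant_span] eps does not distinguish
    their values on K. *)
Lemma parInd_span f : E f -> fixedK f -> exists c, f = \sum_(i | two_units i) c i *: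
  \sum_(p | `[< Parab p >]) rhoM tau0 (invmx p) i.2.1 i.2.2 *:
    right (lft i.1.1 *m lft p *m lft i.1.2) f.
Proof.
move=> Ef fK; have [c cE] := covariant_span cusp (eps_covariant (Eind Ef) fK); exists c.
have Kyz (i : ('M[k]_nr * 'M[k]_nr) * ('I_N * 'I_N)) p : two_units i -> `[< Parab p >] -> Kmax (lft i.1.1 *m lft p *m lft i.1.2 : 'M[F]_nr).
  by move=> /andP[u1 u2] /asboolP[up _]; do !apply: KmaxM; exact: lft_Kmax.
have rr := @rtrans_rep R F nr S.
set f2 := (X in _ = X).
have Ef2 : E f2.
  apply: (subspace_sum Esub) => i hi; apply: (subspaceZ Esub).
  apply: (subspace_sum Esub) => p hp; apply: (subspaceZ Esub).
  by apply: Estable => //; exact: Kmax_unit (Kyz _ _ hi hp).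
have f2K : fixedK f2.
  have Vs := VK_subspace rr.
  apply: (subspace_sum Vs) => i hi; apply: (subspaceZ Vs).
  apply: (subspace_sum Vs) => p hp; apply: (subspaceZ Vs).
  by apply: (VK_stable rr) => //; exact: Kyz.
apply/eqP; rewrite -subr_eq0; apply/eqP; apply: eps_injective.
- exact/Eind/(subspaceB Esub).
- exact: (subspaceB (VK_subspace rr)).
move=> x ux; rewrite (_ : (f - f2) _ = f (lft x) - f2 (lft x)) //.
rewrite -scaleN1r addrC eps_lin scaleN1r addrC cE // /f2 fct_sumE (lin_sum eps_lin).
rewrite -sumrB big1 // => i hi.
rewrite (_ : (c i *: _) _ = c i *: (\sum_(p | `[< Parab p >]) rhoM tau0 (invmx p) i.2.1 i.2.2 *:
    right (lft i.1.1 *m lft p *m lft i.1.2) f) (lft x)) // fct_sumE (linZ eps_lin).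
rewrite (lin_sum eps_lin) -scalerBr /P_average -sumrB big1 ?scaler0 // => p hp.
rewrite -(linZ eps_lin) [X in eps X - _](_ : _ = (rhoM tau0 (invmx p) i.2.1 i.2.2 *:
    right (lft i.1.1 *m lft p *m lft i.1.2) f) (lft x)) ?subrr //.
congr (_ *: _); have /andP[u1 u2] := hi; have up : p \in unitmx by case/asboolP: hp.
apply: fixed_red => //.
- by apply: lft_Kmax; rewrite !unitmx_mul ux u1 up.
- by apply: KmaxM; [exact: lft_Kmax | exact: Kyz].
rewrite lftK !mxredM ?lftK ?mulmxA //; try exact: lft_int.
- by apply: Kmax_int; apply: KmaxM; exact: lft_Kmax.
- exact/Kmax_int/Kyz.
Qed.
End ParabolicInduction.

(** * The representation of K on the K_+-fixed vectors *)

Section Generation.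
Variables (R : realType) (F : localField) (n r d : nat).
Local Notation C := R[i].
Local Notation k := (lf_res F).
Local Notation nr := (\sum_(i < n) r)%N.
Local Notation N := #|{: {ffun 'I_n -> 'I_d}}|.
Variables (tau0 : 'M[k]_r -> 'M[C]_d) (cusp : irreducible_cuspidal tau0).
Variables (I : lmodType C) (beta : {ffun 'M[k]_nr -> C} -> 'cV[C]_N -> I).
Variable act : 'M[k]_nr -> I -> I.
Hypothesis indP : is_finInd tau0 beta act.
Local Notation gen := (gen beta).

Lemma P_sum_linear (W : lmodType C) (a : 'I_N) (w : 'M[k]_nr -> W) :
  linear (fun v : 'cV[C]_N => \sum_(p | `[< Parab p >]) (rhoM tau0 (invmx p) *m v) a 0 *: w p).
Proof.
move=> c v v'; rewrite scaler_sumr -big_split; apply: eq_bigr => p _ /=.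
by rewrite mulmxDr -scalemxAr !mxE scalerDl scalerA.
Qed.

Lemma P_sum_Parab (W : lmodType C) (a : 'I_N) (w : 'M[k]_nr -> W) q (v : 'cV[C]_N) : Parab q ->
  \sum_(p | `[< Parab p >]) (rhoM tau0 (invmx p) *m (rhoM tau0 q *m v)) a 0 *: w p =
  \sum_(p | `[< Parab p >]) (rhoM tau0 (invmx p) *m v) a 0 *: w (q *m p).
Proof.
move=> Pq; have uq : q \in unitmx by case: Pq.
rewrite (reindex_inj (can_inj (mulKmx uq))) /=; apply: eq_big => p.
  by apply/asboolP/asboolP => /(ParabMl _ Pq).
move=> /asboolP/(ParabMl _ Pq) Pp; have up : p \in unitmx by case: Pp.
rewrite mul_invmx // (rhoM_M cusp (ParabV Pp) (ParabV Pq)) -mulmxA.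
by rewrite [rhoM _ (invmx q) *m _]mulmxA (rhoM_V cusp Pq) mul1mx.
Qed.

(** Averaging a vector over P against a matrix coefficient of rho_M gives a
    P-equivariant map from rho_M, hence an endomorphism of I. *)
Lemma avg_H1 a w : exists2 h, H1 act h & forall v, h (gen v) =
  \sum_(p | `[< Parab p >]) (rhoM tau0 (invmx p) *m v) a 0 *: act p w.
Proof.
pose psi (v : 'cV[C]_N) := \sum_(p | `[< Parab p >]) (rhoM tau0 (invmx p) *m v) a 0 *: act p w.
have psil : linear psi by exact: P_sum_linear.
have [y uy|y q v uy Pq|h [lh hE]] := ind_univ cusp indP (A := fun y v => act y (psi v)).
- exact: (linear_comp (act_linear indP uy) psil).
- have uq : q \in unitmx by case: Pq.
  rewrite (actM indP) // /psi P_sum_Parab // (lin_sum (act_linear indP uq)); congr act.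
  apply: eq_bigr => p /asboolP[up _].
  by rewrite (linZ (act_linear indP uq)) (actM indP).
have hg y v : y \in unitmx -> h (act y (gen v)) = act y (psi v) by exact: hE.
exists h => [|v]; last by rewrite -[gen v](act1 indP) hg ?unitmx1 // (act1 indP).
split=> // g y ug.
suff e : h \o act g = act g \o h by exact: (congr1 (fun z => z y) e).
apply: (ind_ext indP) => [||x v ux].
- exact: (linear_comp lh (act_linear indP ug)).
- exact: (linear_comp (act_linear indP ug) lh).
by rewrite /= -(actM indP) // !hg ?unitmx_mul ?ug // (actM indP).
Qed.

Lemma ev_inj y y' : (forall x, x \in unitmx -> ev cusp indP (act x y) = ev cusp indP (act x y')) ->
  y = y'.
Proof.
move=> e; rewrite (ind_recon cusp indP y) (ind_recon cusp indP y'); congr (_ *: _).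
by apply: eq_bigr => g ug; rewrite e // unitmx_inv.
Qed.

(** The functions x |-> ev (act x (Y j)) are the columns of a single covariant
    function, so that the coefficients do not depend on j. *)
Lemma act_span (J : finType) (Y : J -> I) :
  exists c : ('M[k]_nr * 'M[k]_nr) * ('I_N * 'I_N) -> C, forall j, Y j =
    \sum_(i | two_units i) c i *: act i.1.1 (\sum_(p | `[< Parab p >])
      rhoM tau0 (invmx p) i.2.1 i.2.2 *: act p (act i.1.2 (Y j))).
Proof.
have el := ev_linear cusp indP.
pose Fn x : 'M[C]_(N, #|J|) := \matrix_(a, j) ev cusp indP (act x (Y (enum_val j))) a 0.
have cF : covariant tau0 Fn.
  move=> p x Pp ux; have up : p \in unitmx by case: Pp.
  apply/matrixP => a j; rewrite !mxE (actM indP) // (ev_Parab cusp indP) // !mxE.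
  by apply: eq_bigr => b _; rewrite !mxE.
have [c cE] := covariant_span cusp cF; exists c => j; apply: ev_inj => x ux.
have al := act_linear indP; apply/colP => a.
have /matrixP/(_ a (enum_rank j)) := cE x ux; rewrite mxE enum_rankK => ->.
rewrite (lin_sum (al _ ux)) (lin_sum el) !summxE; apply: eq_bigr => i /andP[u1 u2].
rewrite (linZ (al _ ux)) (linZ el) !mxE; congr (_ * _).
have u1x : x *m i.1.1 \in unitmx by rewrite unitmx_mul ux.
rewrite -(actM indP) // (lin_sum (al _ u1x)) (lin_sum el) !summxE; apply: eq_bigr => p /asboolP[up _].
rewrite (linZ (al _ u1x)) (linZ el) !mxE enum_rankK; congr (_ * _).
by rewrite !(actM indP) ?unitmx_mul ?ux ?u1.
Qed.

Section OneRepresentation.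
Variables (V : lmodType C) (pi : 'M[F]_nr -> V -> V).
Hypothesis piP : is_rep (@GL F nr) setT pi.
Local Notation VK := (fixed (@Kplus F nr) pi).
Local Notation Hom := (HomGF act pi).

Lemma HomGF_subspace : subspace Hom.
Proof.
split; first split.
- by move=> a x y; rewrite scaler0 addr0.
- by move=> y; case: (VK_subspace piP).
- by move=> g y Kg; rewrite [RHS](lin0 (pi_linear piP (Kmax_unit Kg))).
move=> a P Q [lP PV PK] [lQ QV QK]; have cE y : (a *: P + Q) y = a *: P y + Q y by [].
split=> [c x y|y|g y Kg]; rewrite !cE.
- by rewrite lP lQ !scalerDr !scalerA addrACA mulrC.
- by case: (VK_subspace piP) => _; apply.
- by rewrite PK // QK // (pi_linear piP (Kmax_unit Kg)).
Qed.

Lemma HomGF_H1 Phi h : Hom Phi -> H1 act h -> Hom (Phi \o h).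
Proof.
move=> [lP PV PK] [lh hact]; split=> [|y|g y Kg] /=; first exact: linear_comp.
  exact: PV.
by rewrite hact ?PK //; exact: Kmax_red.
Qed.

Lemma avg_HomGF a w : VK w -> exists2 Phi, Hom Phi & forall v, Phi (gen v) =
  \sum_(p | `[< Parab p >]) (rhoM tau0 (invmx p) *m v) a 0 *: pi (lft p) w.
Proof.
move=> Vw; have Vs := VK_subspace piP; have [_ _ onto] := res_bij cusp indP piP.
pose phi (v : 'cV[C]_N) := \sum_(p | `[< Parab p >]) (rhoM tau0 (invmx p) *m v) a 0 *: pi (lft p) w.
have [|Phi HPhi PhiE] := onto phi; last first.
  by exists Phi => // v; have := congr1 (fun f => f v) PhiE.
split; first exact: P_sum_linear.
  move=> v; apply: (subspace_sum Vs) => p /asboolP[up _]; apply: (subspaceZ Vs).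
  by apply: (VK_stable piP) => //; exact: lft_Kmax.
move=> g v Kg Pg; have lg := pi_linear piP (Kmax_unit Kg).
rewrite /phi P_sum_Parab // (lin_sum lg); apply: eq_bigr => p /asboolP[up _].
have Kp := lft_Kmax up; rewrite (linZ lg) -(pi_M piP) ?(Kmax_unit Kp) ?(Kmax_unit Kg) //.
congr (_ *: _); apply: (pi_red piP) => //.
- by apply: lft_Kmax; rewrite unitmx_mul Kmax_red.
- exact: KmaxM.
- by rewrite lftK mxredM ?lftK //; exact: Kmax_int.
Qed.

Variables (S : lmodType C) (sigma : 'M[F]_nr -> S -> S) (eps : S -> 'cV[C]_N).
Hypothesis eps_lin : linear eps.
Hypothesis sigma_lin : forall m, Levi m -> linear (sigma m).
Hypothesis eps_K : forall m w, Levi m -> Kmax m -> eps (sigma m w) = rhoM tau0 (mxred m) *m eps w.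
Hypothesis eps_faithful :
  forall w, (forall m, Levi m -> Kplus m -> sigma m w = w) -> eps w = 0 -> w = 0.
Hypothesis irr : smooth_irreducible pi.
Hypothesis block : bernstein_block sigma pi.

(** An irreducible V in the block is a subquotient of some parabolic induction;
    averaging over K_+ lifts a K_+-fixed vector of V to one of the induced
    representation, to which [parInd_span] applies. *)
Lemma VK_spanned x : VK x -> exists (J : finType) (Phi : J -> I -> V) (Y : J -> I),
  (forall j, Hom (Phi j)) /\ x = \sum_j Phi j (Y j).
Proof.
move=> Vx; have Vs := VK_subspace piP.
have [_ _ /(_ V pi irr)[|chi chiP [E [f [[Eind Esub] Est [fl fG] fim]]]]] := block.
  exists setT, id; split=> //.
  by apply/seteqP; split=> // y _; exists y.
have [f0 Ef0 f0x] : exists2 f0, E f0 & f f0 = x by have : setT x by []; rewrite -fim => -[y]; exists y.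
have rr := @rtrans_rep R F nr S.
have [f0G f0s _] := Eind _ Ef0; have [j f0j] := right_smooth_fixed f0G f0s.
have [q cq] := transversal F nr j; have [q0 qK _] := cq.
pose f1 := invn R (size q) *: \sum_(y <- q) rtrans y f0.
have f1K : fixed (@Kplus F nr) (@rtrans F nr S) f1 := average_fixed rr cq f0j.
have Eq y : y \in q -> E (rtrans y f0).
  by move=> yq; apply: Est => //; exact: Kmax_unit (qK y yq).1.
have Es : E (\sum_(y <- q) rtrans y f0) by rewrite big_seq; exact: subspace_sum.
have Ef1 : E f1 by exact: subspaceZ.
have f1x : f f1 = x.
  rewrite (linear_onZ Esub fl) // [\sum_(y <- q) _]big_seq (linear_on_sum Esub fl) //.
  rewrite -[\sum_(y <- q | _) _]big_seq (eq_big_seq (fun=> x)) => [|y yq]; last first.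
    have Ky := qK y yq; rewrite fG // ?f0x ?Vx //; exact: Kmax_unit Ky.1.
  by rewrite big_const_seq count_predT iter_addr_0 invn_mulrn.
have [c f1E] := parInd_span cusp eps_lin sigma_lin eps_K eps_faithful chiP Esub Est Eind Ef1 f1K.
pose w (i : ('M[k]_nr * 'M[k]_nr) * ('I_N * 'I_N)) := if two_units i then pi (lft i.1.2) x else 0.
have Vw i : VK (w i).
  rewrite /w; case: ifP => [/andP[_ u2]|_]; last by case: Vs.
  by apply: (VK_stable piP) => //; exact: lft_Kmax.
have ex i : exists P, Hom P /\ forall v, P (gen v) =
    \sum_(p | `[< Parab p >]) (rhoM tau0 (invmx p) *m v) i.2.1 0 *: pi (lft p) (w i).
  by have [P HP PE] := avg_HomGF i.2.1 (Vw i); exists P.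
have [Phi PhiP] := choice ex.
pose Y (i : ('M[k]_nr * 'M[k]_nr) * ('I_N * 'I_N)) :=
  if two_units i then c i *: act i.1.1 (gen (delta_mx i.2.2 0)) else 0.
exists _, Phi, Y; split=> [i|]; first by case: (PhiP i).
have Eg g : Kmax g -> E (rtrans g f1) by move=> Kg; apply: Est => //; exact: Kmax_unit.
have Ey (i : ('M[k]_nr * 'M[k]_nr) * ('I_N * 'I_N)) p : two_units i -> `[< Parab p >] ->
    [/\ Kmax (lft i.1.1 : 'M[F]_nr), Kmax (lft p : 'M[F]_nr) & Kmax (lft i.1.2 : 'M[F]_nr)].
  by move=> /andP[u1 u2] /asboolP[up _]; split; exact: lft_Kmax.
have Et (i : ('M[k]_nr * 'M[k]_nr) * ('I_N * 'I_N)) p : two_units i -> `[< Parab p >] ->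
    E (rhoM tau0 (invmx p) i.2.1 i.2.2 *: rtrans (lft i.1.1 *m lft p *m lft i.1.2) f1).
  by move=> hi hp; have [Ky Kp Kz] := Ey i p hi hp; apply: subspaceZ => //; apply: Eg; do !apply: KmaxM.
have Ei (i : ('M[k]_nr * 'M[k]_nr) * ('I_N * 'I_N)) : two_units i -> E (c i *: \sum_(p | `[< Parab p >])
    rhoM tau0 (invmx p) i.2.1 i.2.2 *: rtrans (lft i.1.1 *m lft p *m lft i.1.2) f1).
  by move=> hi; apply: subspaceZ => //; apply: subspace_sum => // p; exact: Et.
rewrite -f1x [X in f X]f1E (linear_on_sum Esub fl) // big_mkcond; apply: eq_bigr => i _.
have [lP _ _] := (PhiP i).1; rewrite /Y; case: ifP => [hi|_]; last by rewrite (lin0 lP).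
have /andP[u1 u2] := hi; have Ky := lft_Kmax u1; have Kz := lft_Kmax u2.
have ly := pi_linear piP (Kmax_unit Ky).
rewrite (linear_onZ Esub fl) ?(linear_on_sum Esub fl) //; last 2 first.
- by move=> p; exact: Et.
- by apply: subspace_sum => // p; exact: Et.
rewrite (linZ lP) -{2}(lftK i.1.1) (HomGF_gen _ (PhiP i).1 Ky) (PhiP i).2.
rewrite (lin_sum ly); congr (_ *: _); apply: eq_bigr => p hp.
have [_ Kp _] := Ey i p hi hp.
rewrite (linear_onZ Esub fl); last by apply: Eg; do !apply: KmaxM.
rewrite fG //; last by apply: Kmax_unit; do !apply: KmaxM.
have [[uy up] uz] := (Kmax_unit Ky, Kmax_unit Kp, Kmax_unit Kz).
by rewrite f1x (linZ ly) -colE [col _ _ _ _]mxE /w hi !(pi_M piP) ?unitmx_mul ?uy ?up.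
Qed.
End OneRepresentation.
End Generation.

(** * Transporting relations between fixed vectors *)

Section Transfer.
Variables (R : realType) (F : localField) (n r d : nat).
Local Notation C := R[i].
Local Notation k := (lf_res F).
Local Notation nr := (\sum_(i < n) r)%N.
Local Notation N := #|{: {ffun 'I_n -> 'I_d}}|.
Variables (tau0 : 'M[k]_r -> 'M[C]_d) (cusp : irreducible_cuspidal tau0).
Variables (I : lmodType C) (beta : {ffun 'M[k]_nr -> C} -> 'cV[C]_N -> I).
Variable act : 'M[k]_nr -> I -> I.
Hypothesis indP : is_finInd tau0 beta act.
Local Notation gen := (gen beta).

(** A linear correspondence between homomorphisms from I to V and to V' which
    commutes with the action of H_1. It is kept as a relation because this makes
    it symmetric in V and V'. *)
Definition transfer (V V' : lmodType C) (pi : 'M[F]_nr -> V -> V) (pi' : 'M[F]_nr -> V' -> V')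
    (D : (I -> V) -> (I -> V') -> Prop) :=
  [/\ forall P P', D P P' -> HomGF act pi P /\ HomGF act pi' P',
      D 0 0,
      forall a P P' Q Q', D P P' -> D Q Q' -> D (a *: P + Q) (a *: P' + Q'),
      forall P P' h, D P P' -> H1 act h -> D (P \o h) (P' \o h)
    & forall P', D 0 P' -> P' = 0].

Definition related (V V' : lmodType C) (D : (I -> V) -> (I -> V') -> Prop) x x' :=
  exists (J : finType) (P : J -> I -> V) (P' : J -> I -> V') (Y : J -> I),
    [/\ forall j, D (P j) (P' j), x = \sum_j P j (Y j) & x' = \sum_j P' j (Y j)].

Section TwoRepresentations.
Variables (V V' : lmodType C) (pi : 'M[F]_nr -> V -> V) (pi' : 'M[F]_nr -> V' -> V').
Hypotheses (piP : is_rep (@GL F nr) setT pi) (piP' : is_rep (@GL F nr) setT pi').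
Variable D : (I -> V) -> (I -> V') -> Prop.
Hypothesis DP : transfer pi pi' D.

Lemma transfer_sum (J : finType) (P : J -> I -> V) (P' : J -> I -> V') :
  (forall j, D (P j) (P' j)) -> D (\sum_j P j) (\sum_j P' j).
Proof.
move=> DPP'; case: DP => _ D0 Dlin _ _; elim/big_rec2: _ => // j Q Q' _.
by move=> /(Dlin 1 _ _ _ _ (DPP' j)); rewrite !scale1r.
Qed.

(** The module of relations between the Y j is generated by values of elements
    of H_1 by [act_span]; hence a relation between the P j (Y j) amounts to
    relations between the P j \o h with h in H_1, which D transports. *)
Lemma transfer_relation (J : finType) (P : J -> I -> V) (P' : J -> I -> V') (Y : J -> I) :
  (forall j, D (P j) (P' j)) -> \sum_j P j (Y j) = 0 -> \sum_j P' j (Y j) = 0.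
Proof.
move=> DPP' rel; have [DHom _ _ Dcomp D0] := DP; have [c cE] := act_span cusp indP Y.
have ex (ij : (('M[k]_nr * 'M[k]_nr) * ('I_N * 'I_N)) * J) : exists h, H1 act h /\
    forall v, h (gen v) = \sum_(p | `[< Parab p >])
      (rhoM tau0 (invmx p) *m v) ij.1.2.1 0 *: act p (act ij.1.1.2 (Y ij.2)).
  by have [h Hh hE] := avg_H1 cusp indP ij.1.2.1 (act ij.1.1.2 (Y ij.2)); exists h.
have [h hP] := choice ex.
have lP j : linear (P j) by have [[]] := DHom _ _ (DPP' j).
have lP' j : linear (P' j) by have [_ []] := DHom _ _ (DPP' j).
have PK j x y : x \in unitmx -> P j (act x y) = pi (lft x) (P j y).
  move=> ux; have [HP _] := DHom _ _ (DPP' j).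
  by rewrite -(HomGF_gen _ HP (lft_Kmax ux)) lftK.
have PK' j x y : x \in unitmx -> P' j (act x y) = pi' (lft x) (P' j y).
  move=> ux; have [_ HP] := DHom _ _ (DPP' j).
  by rewrite -(HomGF_gen _ HP (lft_Kmax ux)) lftK.
pose Q i := \sum_j (P j \o h (i, j)); pose Q' i := \sum_j (P' j \o h (i, j)).
have DQ i : D (Q i) (Q' i).
  by apply: transfer_sum => j; apply: Dcomp => //; case: (hP (i, j)).
have Qgen i v : two_units i -> Q i (gen v) = 0.
  move=> /andP[u1 u2]; rewrite /Q fct_sumE.
  under eq_bigr => j _ do rewrite /= (proj2 (hP (i, j))) (lin_sum (lP j)).
  rewrite exchange_big big1 // => p /asboolP[up _] /=.
  have lp := pi_linear piP (Kmax_unit (lft_Kmax up)).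
  have lz := pi_linear piP (Kmax_unit (lft_Kmax u2)).
  under eq_bigr do rewrite (linZ (lP _)) !PK //.
  by rewrite -scaler_sumr -(lin_sum lp) -(lin_sum lz) rel (lin0 lz) (lin0 lp) scaler0.
have Q0 i : two_units i -> Q i = 0.
  move=> hi; have [[lQ QV QK] _] := DHom _ _ (DQ i).
  apply: (ind_ext indP) => [||g v ug]; [exact: lQ | by move=> a x y; rewrite scaler0 addr0 |].
  have Kg := lft_Kmax ug; rewrite -{1}[g]lftK QK // Qgen //.
  exact: (lin0 (pi_linear piP (Kmax_unit Kg))).
have Q'0 i : two_units i -> Q' i = 0.
  by move=> hi; apply: D0; rewrite -(Q0 i hi).
under eq_bigr => j _ do rewrite cE (lin_sum (lP' j)).
rewrite exchange_big big1 // => i hi /=; have /andP[u1 u2] := hi.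
have ly := pi_linear piP' (Kmax_unit (lft_Kmax u1)).
have hE j : \sum_(p | `[< Parab p >]) rhoM tau0 (invmx p) i.2.1 i.2.2 *: act p (act i.1.2 (Y j)) =
    h (i, j) (gen (delta_mx i.2.2 0)).
  by rewrite (proj2 (hP (i, j))); apply: eq_bigr => p _; rewrite -colE [col _ _ _ _]mxE.
under eq_bigr do rewrite (linZ (lP' _)) PK' // hE.
rewrite -scaler_sumr -(lin_sum ly).
have -> : \sum_j P' j (h (i, j) (gen (delta_mx i.2.2 0))) = Q' i (gen (delta_mx i.2.2 0)).
  by rewrite /Q' fct_sumE.
by rewrite Q'0 // (lin0 ly) scaler0.
Qed.

Lemma related_lin a x x' y y' : related D x x' -> related D y y' ->
  related D (a *: x + y) (a *: x' + y').
Proof.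
move=> [J [P [P' [Y [DJ -> ->]]]]] [K [Q [Q' [Z [DK -> ->]]]]].
exists (J + K)%type,
  (fun jl => match jl with inl j => P j | inr l => Q l end),
  (fun jl => match jl with inl j => P' j | inr l => Q' l end),
  (fun jl => match jl with inl j => a *: Y j | inr l => Z l end).
have [DHom _ _ _ _] := DP.
have lP j : linear (P j) by have [[]] := DHom _ _ (DJ j).
have lP' j : linear (P' j) by have [_ []] := DHom _ _ (DJ j).
split; first by case.
- rewrite big_sumType /= scaler_sumr; congr (_ + _).
  by apply: eq_bigr => j _; rewrite (linZ (lP j)).
- rewrite big_sumType /= scaler_sumr; congr (_ + _).
  by apply: eq_bigr => j _; rewrite (linZ (lP' j)).
Qed.

Lemma related_K g x x' : Kmax g -> related D x x' -> related D (pi g x) (pi' g x').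
Proof.
move=> Kg [J [P [P' [Y [DJ -> ->]]]]]; exists J, P, P', (fun j => act (mxred g) (Y j)).
have [DHom _ _ _ _] := DP; have ug := Kmax_unit Kg; split=> //.
- rewrite (lin_sum (pi_linear piP ug)); apply: eq_bigr => j _.
  by have [HP _] := DHom _ _ (DJ j); rewrite (HomGF_gen _ HP Kg).
- rewrite (lin_sum (pi_linear piP' ug)); apply: eq_bigr => j _.
  by have [_ HP] := DHom _ _ (DJ j); rewrite (HomGF_gen _ HP Kg).
Qed.

Lemma related_fixed x x' : related D x x' -> fixed (@Kplus F nr) pi' x'.
Proof.
move=> [J [P [P' [Y [DJ _ ->]]]]]; apply: (subspace_sum (VK_subspace piP')) => j _.
by have [DHom _ _ _ _] := DP; have [_ [_ + _]] := DHom _ _ (DJ j); apply.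
Qed.

Lemma related_functional x x' y' : related D x x' -> related D x y' -> x' = y'.
Proof.
move=> rx ry; have [J [P [P' [Y [DJ e e']]]]] := related_lin (-1) ry rx.
apply/eqP; rewrite -subr_eq0 addrC -scaleN1r e'; apply/eqP; apply: (transfer_relation DJ).
by rewrite -e scaleN1r addNr.
Qed.

Lemma related_total :
  (forall P, HomGF act pi P -> exists P', D P P') ->
  (forall x, fixed (@Kplus F nr) pi x -> exists (J : finType) (P : J -> I -> V) (Y : J -> I),
     (forall j, HomGF act pi (P j)) /\ x = \sum_j P j (Y j)) ->
  forall x, fixed (@Kplus F nr) pi x -> exists x', related D x x'.
Proof.
move=> tot span x /span[J [P [Y [HP ->]]]].
have [P' P'E] := choice (fun j => tot _ (HP j)).
by exists (\sum_j P' j (Y j)), J, P, P', Y.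
Qed.
End TwoRepresentations.

Lemma related_sym (V V' : lmodType C) (D : (I -> V) -> (I -> V') -> Prop) x x' :
  related D x x' -> related (fun P' P => D P P') x' x.
Proof. by move=> [J [P [P' [Y [DJ -> ->]]]]]; exists J, P', P, Y. Qed.

(** The relation [related D] is the graph of the isomorphism: it is functional in
    both directions by [transfer_relation]. *)
Lemma fixed_vectors_iso (V V' : lmodType C) (pi : 'M[F]_nr -> V -> V) (pi' : 'M[F]_nr -> V' -> V')
    (D : (I -> V) -> (I -> V') -> Prop) :
  is_rep (@GL F nr) setT pi -> is_rep (@GL F nr) setT pi' ->
  transfer pi pi' D -> transfer pi' pi (fun P' P => D P P') ->
  (forall x, fixed (@Kplus F nr) pi x -> exists x', related D x x') ->
  (forall x', fixed (@Kplus F nr) pi' x' -> exists x, related D x x') ->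
  isomorphic (@Kmax F nr) (fixed (@Kplus F nr) pi) pi (fixed (@Kplus F nr) pi') pi'.
Proof.
move=> piP piP' DP DP' tot tot'.
have ex x : exists x', fixed (@Kplus F nr) pi x -> related D x x'.
  have [/tot[x' rx]|nV] := pselect (fixed (@Kplus F nr) pi x); first by exists x'.
  by exists 0.
have [f fE] := choice ex; have Vs := VK_subspace piP.
have fq x x' : fixed (@Kplus F nr) pi x -> related D x x' -> f x = x'.
  by move=> Vx; apply: (related_functional piP piP' DP); exact: fE.
exists f; split; first split.
- move=> a x y Vx Vy; apply: fq; first by case: Vs => _; apply.
  by apply: (related_lin DP); exact: fE.
- move=> g x Kg Vx; apply: fq; first exact: (VK_stable piP).
  by apply: (related_K piP piP' DP) => //; exact: fE.
split.
- by move=> x /fE rx; exact: (related_fixed piP' DP rx).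
- move=> x y /set_mem Vx /set_mem Vy e.
  apply: (related_functional piP' piP DP' (x := f x)); apply: related_sym; first exact: fE.
  by rewrite e; exact: fE.
move=> x' Vx'; have [x rx] := tot' _ Vx'; have Vx := related_fixed piP DP' (related_sym rx).
by exists x => //; exact: fq.
Qed.
End Transfer.

(** * The comparison *)

Section Correspondence.
Variables (R : realType) (F : localField) (n r d : nat).
Local Notation C := R[i].
Local Notation k := (lf_res F).
Local Notation nr := (\sum_(i < n) r)%N.
Local Notation N := #|{: {ffun 'I_n -> 'I_d}}|.
Variables (tau0 : 'M[k]_r -> 'M[C]_d) (cusp : irreducible_cuspidal tau0).
Variables (I : lmodType C) (beta : {ffun 'M[k]_nr -> C} -> 'cV[C]_N -> I).
Variable act : 'M[k]_nr -> I -> I.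
Hypothesis indP : is_finInd tau0 beta act.
Variable mu : ('M[F]_nr -> C) -> C.
Variable b : 'S_n -> 'M[F]_nr -> 'M[C]_N.
Variable Psi : (I -> I) -> 'M[F]_nr -> 'M[C]_N.
Hypothesis Psi_span : forall h, H1 act h -> lin_span b (Psi h).
Variables (V V' : lmodType C) (pi : 'M[F]_nr -> V -> V) (pi' : 'M[F]_nr -> V' -> V').
Hypotheses (piP : is_rep (@GL F nr) setT pi) (piP' : is_rep (@GL F nr) setT pi').
Local Notation res Phi := (fun v => Phi (beta (ga_eU R k n r) v)).
Hypothesis act_V : forall h Phi, H1 act h -> HomGF act pi Phi ->
  res (Phi \o h) = hact mu pi (Psi h) (res Phi).
Hypothesis act_V' : forall h Phi, H1 act h -> HomGF act pi' Phi ->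
  res (Phi \o h) = hact mu pi' (Psi h) (res Phi).
Variable theta : ('cV[C]_N -> V) -> 'cV[C]_N -> V'.
Hypothesis theta_lin : linear_on (HomJ tau0 pi) theta.
Hypothesis theta_bij : set_bij (HomJ tau0 pi) (HomJ tau0 pi') theta.
Hypothesis theta_H : forall f phi, lin_span b f -> HomJ tau0 pi phi ->
  theta (hact mu pi f phi) = hact mu pi' f (theta phi).

Definition theta_related (P : I -> V) (P' : I -> V') :=
  [/\ HomGF act pi P, HomGF act pi' P' & theta (res P) = res P'].

Lemma res_HomJ P : HomGF act pi P -> HomJ tau0 pi (res P).
Proof. by move=> HP; rewrite (HomJ_PF cusp); have [mv _ _] := res_bij cusp indP piP; exact: (mv _ HP). Qed.

Lemma res_HomJ' P : HomGF act pi' P -> HomJ tau0 pi' (res P).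
Proof. by move=> HP; rewrite (HomJ_PF cusp); have [mv _ _] := res_bij cusp indP piP'; exact: (mv _ HP). Qed.

Lemma res_inj P Q : HomGF act pi P -> HomGF act pi Q -> res P = res Q -> P = Q.
Proof.
by have [_ inj _] := res_bij cusp indP piP => HP HQ e; apply: inj => //; exact: mem_set.
Qed.

Lemma res_inj' P Q : HomGF act pi' P -> HomGF act pi' Q -> res P = res Q -> P = Q.
Proof.
by have [_ inj _] := res_bij cusp indP piP' => HP HQ e; apply: inj => //; exact: mem_set.
Qed.

Lemma theta0 : theta (res (0 : I -> V)) = res (0 : I -> V').
Proof.
have [H0 _] := HomGF_subspace act piP.
have := theta_lin (-1) (res_HomJ H0) (res_HomJ H0).
have -> : -1 *: res (0 : I -> V) + res (0 : I -> V) = res (0 : I -> V).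
  by apply/funext => v; rewrite scaleN1r addNr.
by move=> ->; rewrite scaleN1r addNr.
Qed.

Lemma theta_lin_related a P P' Q Q' : theta_related P P' -> theta_related Q Q' ->
  theta_related (a *: P + Q) (a *: P' + Q').
Proof.
move=> [HP HP' e] [HQ HQ' e']; split.
- by case: (HomGF_subspace act piP) => _; apply.
- by case: (HomGF_subspace act piP') => _; apply.
- have -> : res (a *: P + Q) = a *: res P + res Q by [].
  by rewrite theta_lin ?e ?e' //; exact: res_HomJ.
Qed.

Lemma theta_comp P P' h : theta_related P P' -> H1 act h -> theta_related (P \o h) (P' \o h).
Proof.
move=> [HP HP' e] Hh; split; [exact: HomGF_H1 | exact: HomGF_H1 |].
by rewrite act_V // act_V' // theta_H ?e //; [exact: Psi_span | exact: res_HomJ].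
Qed.

Lemma theta_transfer : transfer act pi pi' theta_related.
Proof.
have [H0 _] := HomGF_subspace act piP; have [H0' _] := HomGF_subspace act piP'.
split.
- by move=> P P' [].
- by split=> //; exact: theta0.
- exact: theta_lin_related.
- exact: theta_comp.
- move=> P' [_ HP' e]; apply: res_inj' => //; rewrite -e; exact: theta0.
Qed.

Lemma theta_transfer_inv : transfer act pi' pi (fun P' P => theta_related P P').
Proof.
have [H0 _] := HomGF_subspace act piP; have [H0' _] := HomGF_subspace act piP'.
split.
- by move=> P P' [].
- by split=> //; exact: theta0.
- by move=> a P P' Q Q'; exact: theta_lin_related.
- by move=> P P' h; exact: theta_comp.
- move=> P [HP _ e]; apply: res_inj => //; have [_ inj _] := theta_bij.
  by apply: inj; rewrite ?e ?theta0 //; apply: mem_set; exact: res_HomJ.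
Qed.

Lemma theta_total P : HomGF act pi P -> exists P', theta_related P P'.
Proof.
move=> HP; have [tJ _ _] := theta_bij; have [_ _ onto] := res_bij cusp indP piP'.
have := tJ _ (res_HomJ HP); rewrite (HomJ_PF cusp) => /onto[P' HP' e].
by exists P'; split.
Qed.

Lemma theta_onto P' : HomGF act pi' P' -> exists P, theta_related P P'.
Proof.
move=> HP'; have [_ _ tonto] := theta_bij; have [_ _ onto] := res_bij cusp indP piP.
have [phi + e] := tonto _ (res_HomJ' HP').
rewrite (HomJ_PF cusp) => /onto[P HP Pphi].
by exists P; split; rewrite ?Pphi.
Qed.
End Correspondence.

Theorem proposition7p1 (R : realType) (F : localField) (n r d : nat)
  (n_gt0 : (0 < n)%N) (r_gt0 : (0 < r)%N)
  (tau0 : 'M[lf_res F]_r -> 'M[R[i]]_d)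
  (L : lmodType R[i]) (tau : 'M[F]_r -> L -> L)
  (tauP : depth_zero_sc_of_type tau0 tau)
  (S : lmodType R[i]) (sigma : 'M[F]_(\sum_(i < n) r) -> S -> S)
  (sigmaP : is_tensor_rep tau sigma)
  (I : lmodType R[i])
  (beta : {ffun 'M[lf_res F]_(\sum_(i < n) r) -> R[i]} ->
          'cV[R[i]]_#|{: {ffun 'I_n -> 'I_d}}| -> I)
  (act : 'M[lf_res F]_(\sum_(i < n) r) -> I -> I)
  (indP : is_finInd tau0 beta act)
  (T : 'S_n -> I -> I) (TP : is_T_basis beta act T)
  (mu : ('M[F]_(\sum_(i < n) r) -> R[i]) -> R[i]) (muP : is_haar mu)
  (b : 'S_n -> 'M[F]_(\sum_(i < n) r) ->
       'M[R[i]]_#|{: {ffun 'I_n -> 'I_d}}|)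
  (bP : is_hecke_basis tau0 mu b) :
  [/\ is_basis (H1 act) T,
      lin_span b `<=` hecke tau0 /\ is_basis (lin_span b) b,
      exists Psi,
        [/\ algebra_iso (@mul1 R I) id (H1 act)
                        (hconv mu) (hone tau0 mu) (lin_span b) Psi,
            forall w, Psi (T w) = b w
          & forall (V : lmodType R[i])
                   (pi : 'M[F]_(\sum_(i < n) r) -> V -> V),
              smooth_irreducible pi -> bernstein_block sigma pi ->
              let res (Phi : I -> V) := fun v => Phi (beta (ga_eU R _ n r) v) in
              [/\ HomJ tau0 pi = HomPF tau0 pi,
                  set_bij (HomGF act pi) (HomPF tau0 pi) res,
                  forall h Phi, H1 act h -> HomGF act pi Phi ->
                    res (Phi \o h) = hact mu pi (Psi h) (res Phi)
                & forall w Phi, HomGF act pi Phi ->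
                    res (Phi \o T w) = hact mu pi (b w) (res Phi)]]
    & forall (V V' : lmodType R[i])
             (pi : 'M[F]_(\sum_(i < n) r) -> V -> V)
             (pi' : 'M[F]_(\sum_(i < n) r) -> V' -> V'),
        smooth_irreducible pi -> bernstein_block sigma pi ->
        smooth_irreducible pi' -> bernstein_block sigma pi' ->
        (exists theta,
           [/\ linear_on (HomJ tau0 pi) theta,
               set_bij (HomJ tau0 pi) (HomJ tau0 pi') theta
             & forall f phi, lin_span b f -> HomJ tau0 pi phi ->
                 theta (hact mu pi f phi) = hact mu pi' f (theta phi)]) ->
        isomorphic (@Kmax F _) (fixed (@Kplus F _) pi) pi
                               (fixed (@Kplus F _) pi') pi'].

Proof.
have [cusp _ _ _] := tauP.
have [eps [eps_lin sigma_lin eps_K eps_faithful]] := tensor_fibre r_gt0 tauP sigmaP.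
have Psi_span h : H1 act h -> lin_span b (Psi cusp indP mu h).
  by have [_ [mv _ _] _ _] := Psi_iso cusp r_gt0 indP TP muP bP; exact: mv.
split.
- exact: (T_basis cusp r_gt0 indP TP).
- split; first exact: (b_hecke cusp r_gt0 indP TP muP bP).
  exact: (b_basis cusp r_gt0 indP TP muP bP).
- exists (Psi cusp indP mu); split.
  + exact: (Psi_iso cusp r_gt0 indP TP muP bP).
  + exact: (Psi_T cusp r_gt0 indP TP muP bP).
  move=> V pi [[piP _ _] _] _ res.
  have hP := hact_Psi cusp indP muP piP.
  split; [exact: (HomJ_PF cusp pi) | exact: (res_bij cusp indP piP) | exact: hP |].
  move=> w Phi HPhi; rewrite -(Psi_T cusp r_gt0 indP TP muP bP).
  by apply: hP => //; exact: (T_H1w cusp r_gt0 indP TP w).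
move=> V V' pi pi' irr block irr' block' [theta [theta_lin theta_bij theta_H]].
have [[piP _ _] _] := irr; have [[piP' _ _] _] := irr'.
have hP := hact_Psi cusp indP muP piP; have hP' := hact_Psi cusp indP muP piP'.
have D := theta_transfer cusp indP Psi_span piP piP' (@hP) (@hP') theta_lin theta_H.
have D' := theta_transfer_inv cusp indP Psi_span piP piP' (@hP) (@hP') theta_lin theta_bij theta_H.
apply: (fixed_vectors_iso cusp indP piP piP' D D').
- apply: (related_total (fun P => @theta_total _ _ _ _ _ _ cusp _ _ _ indP _ _ _ _ piP piP' _ theta_bij P)).
  exact: (VK_spanned cusp indP piP eps_lin sigma_lin eps_K eps_faithful irr block).
move=> x' Vx'; have onto := fun P => @theta_onto _ _ _ _ _ _ cusp _ _ _ indP _ _ _ _ piP piP' _ theta_bij P.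
have span := VK_spanned cusp indP piP' eps_lin sigma_lin eps_K eps_faithful irr' block'.
by have [x rx] := related_total onto span Vx'; exists x; exact: related_sym rx.
Qed.
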